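(* Let $A$ be a finite-dimensional $\mathbb{Z}$-graded algebra over a field $K$ with a triangular decomposition $(A^-,T,A^+)$, with $T$ semisimple. Suppose that $A$ is self-injective, and let $\nu$ be its graded Nakayama permutation. Then $P(\lambda)$ is a highest weight object of $\mathcal{G}(A)$ for every $\lambda\in\operatorname{Irr}\mathcal{G}(T)$. Moreover: (a) If $\lambda^h$ denotes the highest weight of $P(\lambda)$, then $\lambda\mapsto\lambda^h$ is a permutation of $\operatorname{Irr}\mathcal{G}(T)$. (b) $\operatorname{Soc}\Delta(\lambda)\simeq L(\lambda^\dagger)$, where $(-)^\dagger:=\nu\circ(-)^{h^{-1}}$ is a permutation of $\operatorname{Irr}\mathcal{G}(T)$. (c) $\Delta(\lambda^h)$ is at the bottom of any standard filtration of $P(\lambda)$. (d) $(\lambda^h)^*=(\nu(\lambda)^* )^h$. (e) $\nabla(\lambda^h)$ is at the top of any costandard filtration of $P(\lambda)$. (f) $\operatorname{Hd}\nabla(\lambda)=L(\nu^{-1}(\lambda^\dagger))=L(\lambda^{h^{-1}})$.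
   Context: **Triangular decomposition.** A triangular decomposition of $A$ is a triple $(A^-,T,A^+)$ of graded subalgebras such that: (a) multiplication $A^-\otimes_K T\otimes_K A^+\to A$ is an isomorphism of vector spaces; (b) $T$ is concentrated in degree $0$, $A^+$ is supported in degrees $\ge 0$ and $A^-$ in degrees $\le 0$; (c) $A^-_0=K=A^+_0$; (d) $A^+T=TA^+$ and $A^-T=TA^-$; (e) $T$ is split over $K$, i.e. $\operatorname{End}_T(\lambda)=K$ for every simple $T$-module $\lambda$. **Notation.** $\mathcal{G}(A)$ is the category of finitely generated graded left $A$-modules with degree-preserving morphisms; $\operatorname{Irr}$ is the set of isomorphism classes of simple objects. $B^{\pm}=A^{\pm}T$, a graded subalgebra; $T$-modules become $B^\pm$-modules via the quotient map $B^\pm\to T$ killing nonzero degrees. Each $\lambda\in\operatorname{Irr}\mathcal{G}(T)$ lies in a single degree $\deg\lambda$; $\lambda<\mu$ iff $\deg\lambda<\deg\mu$. $A^{\mathrm{op}}$ is graded by $(A^{\mathrm{op}})_i=A_{-i}$ and carries the triangular decomposition $((A^+)^{\mathrm{op}},T^{\mathrm{op}},(A^-)^{\mathrm{op}})$; $M^*=\operatorname{Hom}_K(M,K)$ is a graded left $A^{\mathrm{op}}$-module with $(M^* )_i=(M_i)^*$ (similarly for $T$). $\Delta(\lambda)=A\otimes_{B^+}\lambda$, $\nabla(\lambda)=\bigl(A^{\mathrm{op}}\otimes_{(B^-)^{\mathrm{op}}}\lambda^*\bigr)^*$. $\Delta(\lambda)$ has simple head $L(\lambda)$, and $\lambda\mapsto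 L(\lambda)$ is a bijection $\operatorname{Irr}\mathcal{G}(T)\to\operatorname{Irr}\mathcal{G}(A)$; $P(\lambda)$ is the projective cover of $L(\lambda)$ in $\mathcal{G}(A)$. $\operatorname{Hd}$ and $\operatorname{Soc}$ are head and socle. **Definitions.** $M$ has highest weight $\lambda$ (is a highest weight object) if $[M:L(\lambda)]=1$ and $[M:L(\mu)]\neq0$ implies $\mu\le\lambda$ (i.e. $\mu=\lambda$ or $\deg\mu<\deg\lambda$). A standard (costandard) filtration is a finite filtration with subquotients of the form $\Delta(\mu)$ (resp. $\nabla(\mu)$); its bottom is the smallest nonzero submodule, its top the last quotient. $A$ is self-injective if the left module $A$ is injective; then $\operatorname{Soc}P(\lambda)$ is simple and the graded Nakayama permutation $\nu$ of $\operatorname{Irr}\mathcal{G}(T)$ is defined by $\operatorname{Soc}P(\lambda)\simeq L(\nu(\lambda))$. $A^{\mathrm{op}}$ is then self-injective too; in (d), $(-)^h$ on the right-hand side is the corresponding permutation of $\operatorname{Irr}\mathcal{G}(T^{\mathrm{op}})$ for $A^{\mathrm{op}}$. *)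

(* Defs.v *)
From HB Require Import structures.
From mathcomp Require Import all_boot all_order all_algebra all_field.
From mathcomp.classical Require Import boolp.

Set Implicit Arguments.
Unset Strict Implicit.
Unset Printing Implicit Defensive.

Import Order.TTheory GRing.Theory Num.Theory.
Local Open Scope ring_scope.

(* Some x satisfying P if there is one, and the default x0 otherwise.  It is
   used for objects that a property determines up to isomorphism. *)
Definition choose (X : Type) (x0 : X) (P : X -> Prop) : X :=
  if pselect (exists x, P x) is left exP then projT1 (cid exP) else x0.

HB.instance Definition _ (K : fieldType) (A : falgType K) := Vector.copy A^c A.

Section ConverseAlgebra.
Variables (K : fieldType) (A : falgType K).

Fact converse_scaleAl (k : K) (a b : A^c) : k *: (a * b) = (k *: a : A^c) * b.
Proof. exact: (@scalerAr K A k b a). Qed.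
HB.instance Definition _ :=
  GRing.Lmodule_isLalgebra.Build K A^c converse_scaleAl.

Fact converse_scaleAr (k : K) (a b : A^c) : k *: (a * b) = a * (k *: b : A^c).
Proof. exact: (@scalerAl K A k b a). Qed.
HB.instance Definition _ :=
  GRing.Lalgebra_isAlgebra.Build K A^c converse_scaleAr.

End ConverseAlgebra.

HB.instance Definition _ (K : fieldType) (A : falgType K) :=
  Falgebra.on A^c.

Section ConverseSubalgebra.
Variables (K : fieldType) (A : falgType K).

Definition converse_vspace (U : {vspace A}) : {vspace A^c} := U.

Lemma converse_mulE (a b : A) : (a : A^c) * (b : A^c) = b * a :> A.
Proof. by []. Qed.

Lemma memv_converse (U : {vspace A}) (a : A) :
  ((a : A^c) \in converse_vspace U) = (a \in U).
Proof. by []. Qed.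

Fact converse_is_aspace (U : {aspace A}) : is_aspace (converse_vspace U).
Proof.
apply/andP; split.
  apply/has_algidP; exists (algid U : A^c); split.
  - exact: (memv_algid U).
  - exact: algid_neq0.
  by move=> u Uu; split; [exact: (@algidr K A U u Uu) | exact: (@algidl K A U u Uu)].
by apply/prodvP => u v Uu Uv; exact: (@memvM K A U v u Uv Uu).
Qed.

Definition converse_aspace (U : {aspace A}) : {aspace A^c} :=
  ASpace (converse_is_aspace U).

Lemma algid_converse (U : {aspace A}) : algid (converse_aspace U) = algid U :> A.
Proof.
have eU : (algid (converse_aspace U) : A) \in U.
  exact: (memv_algid (converse_aspace U)).
rewrite -[LHS](algidl eU) -converse_mulE.
have uU : (algid U : A^c) \in converse_aspace U by exact: (memv_algid U).
exact: (algidl uU).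
Qed.

End ConverseSubalgebra.

Section Gradings.
Variable K : fieldType.

Definition is_grading (V : vectType K) (g : int -> {vspace V}) : Prop :=
  (exists s : seq int, (\sum_(i <- s) g i)%VS == fullv) /\
  forall (s : seq int) (u : int -> V), uniq s -> (forall i, u i \in g i) ->
    \sum_(i <- s) u i = 0 -> forall i, i \in s -> u i = 0.

Definition homogeneous_sub (V : vectType K) (g : int -> {vspace V})
    (U : {vspace V}) : Prop :=
  exists s : seq int, U = (\sum_(i <- s) (U :&: g i))%VS.

Definition graded_algebra (A : falgType K) (gA : int -> {vspace A}) : Prop :=
  [/\ is_grading gA, 1 \in gA 0
    & forall i j, (gA i * gA j <= gA (i + j)%R)%VS].

Definition graded_subalgebra (A : falgType K) (gA : int -> {vspace A})
    (U : {aspace A}) : Prop :=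
  1 \in U /\ homogeneous_sub gA U.

Definition sub_grading (A : falgType K) (gA : int -> {vspace A})
    (U : {aspace A}) (i : int) : {vspace subvs_of U} :=
  (linfun vsval @^-1: gA i)%VS.

Definition opp_grading (A : falgType K) (gA : int -> {vspace A}) :
  int -> {vspace A^c} := fun i => converse_vspace (gA (- i)).

End Gradings.

(* Since the algebra B is finite-dimensional, the finitely generated graded
   B-modules are the finite-dimensional ones. *)
Record gmod (K : fieldType) (B : falgType K) (gB : int -> {vspace B}) := GMod {
  gm_sort :> vectType K;
  gact : B -> gm_sort -> gm_sort;
  ggr : int -> {vspace gm_sort};
  gact_linearl : forall v, linear (fun a => gact a v);
  gact_linearr : forall a, linear (gact a);
  gact1 : forall v, gact 1 v = v;
  gactM : forall a b v, gact (a * b) v = gact a (gact b v);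
  ggr_grading : is_grading ggr;
  gact_graded : forall i j a v,
    a \in gB i -> v \in ggr j -> gact a v \in ggr (i + j)
}.

Section ZeroModule.
Variables (K : fieldType) (B : falgType K) (gB : int -> {vspace B}).

Fact gmod0_grading : is_grading (fun _ : int => fullv : {vspace 'rV[K]_0}).
Proof.
have z (U : {vspace 'rV[K]_0}) : U = 0%VS.
  by apply/eqP; rewrite -subv0; apply/subvP=> v _; rewrite thinmx0 mem0v.
split; last by move=> s u _ _ _ i _; rewrite [u i]thinmx0.
by exists [::]; rewrite (z fullv) (z (\sum_(i <- _) _)%VS).
Qed.

Definition gmod0 : gmod gB.
Proof.
refine (@GMod K B gB 'rV[K]_0 (fun _ v => v) (fun=> fullv) _ _ _ _ _ _) => //.
- by move=> v k a b; rewrite [LHS]thinmx0 [RHS]thinmx0.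
- exact: gmod0_grading.
Defined.

End ZeroModule.

Arguments gact {K B gB} g a v.
Arguments ggr {K B gB} g i.
Arguments ggr_grading {K B gB} g.

HB.instance Definition _ (K : fieldType) (B : falgType K)
    (gB : int -> {vspace B}) (M : gmod gB) (a : B) :=
  GRing.isLinear.Build K M M _ (gact M a) (gact_linearr (g:=M) a).

Section Category.
Variables (K : fieldType) (B : falgType K) (gB : int -> {vspace B}).
Implicit Types M N S P : gmod gB.

Definition ghom M N (f : 'Hom(M, N)) : Prop :=
  (forall a v, f (gact M a v) = gact N a (f v)) /\
  (forall i v, v \in ggr M i -> f v \in ggr N i).

Definition giso M N : Prop :=
  exists (f : 'Hom(M, N)) (g : 'Hom(N, M)),
    [/\ ghom f, ghom g, cancel f g & cancel g f].

Definition gsubmod M (U : {vspace M}) : Prop :=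
  (forall a v, v \in U -> gact M a v \in U) /\ homogeneous_sub (ggr M) U.

(* For graded submodules V <= U of M: the graded module U / V is isomorphic
   to N.  The values of f outside of U are irrelevant. *)
Definition subquo_iso M (U V : {vspace M}) N : Prop :=
  exists f : 'Hom(M, N),
    [/\ forall a v, v \in U -> f (gact M a v) = gact N a (f v),
        forall i v, v \in U -> v \in ggr M i -> f v \in ggr N i,
        (f @: U)%VS = fullv & (U :&: lker f)%VS = V].

Definition simple_gmod M : Prop :=
  fullv != 0%VS :> {vspace M} /\
  forall U : {vspace M}, gsubmod U -> U = 0%VS \/ U = fullv.

Definition simple_gsubmod M (U : {vspace M}) : Prop :=
  [/\ gsubmod U, U != 0%VS
    & forall V : {vspace M}, gsubmod V -> (V <= U)%VS -> V = 0%VS \/ V = U].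

Definition maximal_gsubmod M (U : {vspace M}) : Prop :=
  [/\ gsubmod U, U != fullv
    & forall V : {vspace M}, gsubmod V -> (U <= V)%VS -> V = U \/ V = fullv].

(* The sum of the simple graded submodules, as a least upper bound. *)
Definition is_socle M (U : {vspace M}) : Prop :=
  (forall W : {vspace M}, simple_gsubmod W -> (W <= U)%VS) /\
  forall V : {vspace M}, (forall W, simple_gsubmod W -> (W <= V)%VS) ->
    (U <= V)%VS.

(* The intersection of the maximal graded submodules. *)
Definition is_radical M (U : {vspace M}) : Prop :=
  (forall W : {vspace M}, maximal_gsubmod W -> (U <= W)%VS) /\
  forall V : {vspace M}, (forall W, maximal_gsubmod W -> (V <= W)%VS) ->
    (V <= U)%VS.

Definition soc_iso M N : Prop :=
  exists2 U : {vspace M}, is_socle U & subquo_iso U 0 N.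

Definition hd_iso M N : Prop :=
  exists2 U : {vspace M}, is_radical U & subquo_iso fullv U N.

Definition projective_gmod P : Prop :=
  forall (M N : gmod gB) (p : 'Hom(M, N)) (f : 'Hom(P, N)),
    ghom p -> ghom f -> limg p = fullv ->
    exists2 g : 'Hom(P, M), ghom g & (p \o g)%VF = f.

Definition projective_cover P M : Prop :=
  projective_gmod P /\
  exists p : 'Hom(P, M), [/\ ghom p, limg p = fullv
    & forall U : {vspace P}, gsubmod U -> (U + lker p)%VS = fullv ->
        U = fullv].

(* 0 = F 0 <= F 1 <= ... <= F n = M, with subquotients isomorphic to modules
   in the class Q. *)
Definition gfiltration (Q : gmod gB -> Prop) M (n : nat)
    (F : nat -> {vspace M}) : Prop :=
  [/\ F 0 = 0%VS, F n = fullv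
    & forall i : nat, (i < n)%N ->
        [/\ gsubmod (F i.+1), (F i <= F i.+1)%VS
          & exists2 N, Q N & subquo_iso (F i.+1) (F i) N]].

(* The composition multiplicity [M : S]; by the Jordan-Hoelder theorem it does
   not depend on the composition series. *)
Definition mult M S : nat :=
  choose 0%N (fun m => exists (n : nat) (F : nat -> {vspace M}),
    gfiltration simple_gmod n F /\
    m = #|[set i : 'I_n | `[< subquo_iso (F i.+1) (F i) S >]]|).

Definition Irr : Type :=
  {C : gmod gB -> Prop | exists2 M, simple_gmod M & C = giso M}.

Definition irr_class M (simM : simple_gmod M) : Irr :=
  exist _ (giso M) (ex_intro2 _ _ M simM erefl).

Definition irr_rep (l : Irr) : gmod gB := s2val (cid2 (proj2_sig l)).

Lemma irr_rep_simple (l : Irr) : simple_gmod (irr_rep l).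
Proof. by rewrite /irr_rep; case: cid2. Qed.

End Category.

Section Precomp.
Variables (K : fieldType) (V : vectType K).

Definition precomp (p : 'End(V)) (f : 'Hom(V, K^o)) : 'Hom(V, K^o) :=
  (f \o p)%VF.

Fact precomp_linear p : linear (precomp p).
Proof. by move=> k f g; rewrite /precomp comp_lfunDl comp_lfunZl. Qed.
HB.instance Definition _ p := GRing.isLinear.Build K
  'Hom(V, K^o) 'Hom(V, K^o) _ (precomp p) (precomp_linear p).

End Precomp.

Section Dual.
Variables (K : fieldType) (B B' : falgType K).
Variables (gB : int -> {vspace B}) (gB' : int -> {vspace B'}).

Definition graded_antimorphism (phi : B' -> B) : Prop :=
  [/\ linear phi, phi 1 = 1, forall a b, phi (a * b) = phi b * phi a
    & forall i a, a \in gB' i -> phi a \in gB (- i)].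

Variables (phi : B' -> B) (phiP : graded_antimorphism phi) (M : gmod gB).

Definition dual_act (a : B') (f : 'Hom(M, K^o)) : 'Hom(M, K^o) :=
  (f \o linfun (gact M (phi a)))%VF.

Lemma dual_actE a f v : dual_act a f v = f (gact M (phi a) v).
Proof. by rewrite comp_lfunE lfunE. Qed.

Definition gsupp : seq int := undup (xchoose (proj1 (ggr_grading M))).

Lemma gsupp_uniq : uniq gsupp. Proof. exact: undup_uniq. Qed.

Lemma gsupp_full : fullv = (\sum_(i <- gsupp) ggr M i)%VS.
Proof.
apply/eqP; rewrite eq_sym eqEsubv subvf /=.
rewrite -(eqP (xchooseP (proj1 (ggr_grading M)))) /gsupp.
elim: (xchoose _) => [|i s IHs]; first by rewrite big_nil sub0v.
rewrite big_cons /= subv_add; case: ifP => [si|_]; last first.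
  by rewrite big_cons addvSl (subv_trans IHs) ?addvSr.
rewrite IHs andbT (big_rem i) ?mem_undup //=; exact: addvSl.
Qed.

Definition gcomp (i : int) : 'End(M) := sumv_pi_for gsupp_full i.

Lemma gcomp_in i v : gcomp i v \in ggr M i.
Proof. exact: memv_sum_pi. Qed.

Lemma gcomp_sum v : \sum_(i <- gsupp) gcomp i v = v.
Proof. by rewrite sumv_pi_uniq_sum ?memvf ?filter_predT ?gsupp_uniq. Qed.

Lemma ggr_indep (s : seq int) (u : int -> M) : uniq s ->
  (forall i, u i \in ggr M i) -> \sum_(i <- s) u i = 0 ->
  forall i, i \in s -> u i = 0.
Proof. exact: (proj2 (ggr_grading M)). Qed.

Lemma ggr_out j v : j \notin gsupp -> v \in ggr M j -> v = 0.
Proof.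
move=> sj vj; pose u i := if i == j then v else - gcomp i v.
have -> : v = u j by rewrite /u eqxx.
apply: (@ggr_indep (j :: gsupp)) (mem_head _ _).
- by rewrite /= sj gsupp_uniq.
- by move=> i; rewrite /u; case: eqP => [->|_] //; rewrite memvN gcomp_in.
rewrite big_cons {1}/u eqxx -[X in X + _](gcomp_sum v) -big_split /=.
by rewrite big1_seq // => i /andP[_ si]; rewrite /u ifN ?subrr //;
   apply: contraNneq sj => <-.
Qed.

(* The functionals vanishing on M_j for all j != i. *)
Definition dual_gr (i : int) : {vspace 'Hom(M, K^o)} :=
  lker (linfun (precomp (projv (\sum_(j <- gsupp | j != i) ggr M j)%VS))).

Lemma dual_grP i (f : 'Hom(M, K^o)) :
  reflect (forall j v, j != i -> v \in ggr M j -> f v = 0) (f \in dual_gr i).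
Proof.
rewrite /dual_gr memv_ker lfunE /= /precomp; set C := (\sum_(j <- _ | _) _)%VS.
apply: (iffP eqP) => [f0 j v ji vj | f0].
  have [sj|sj] := boolP (j \in gsupp); last by rewrite (ggr_out sj vj) linear0.
  have Cv : v \in C.
    by rewrite /C (big_rem j) //= ji; apply: subvP vj; exact: addvSl.
  by have := congr1 (fun h : 'Hom(M, K^o) => h v) f0;
     rewrite comp_lfunE projv_id // lfunE.
have sub : (C <= lker f)%VS.
  rewrite /C; elim: gsupp => [|j s IHs]; first by rewrite big_nil sub0v.
  rewrite big_cons; case: ifP => // ji; rewrite subv_add IHs andbT.
  by apply/subvP=> v vj; rewrite memv_ker (f0 j).
apply/lfunP=> v; rewrite comp_lfunE zero_lfunE.
by apply/eqP; rewrite -memv_ker (subvP sub) ?memv_proj.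
Qed.

Lemma gcomp_other i j v : v \in ggr M j -> j != i -> gcomp i v = 0.
Proof.
move=> vj ji.
have [sj|sj] := boolP (j \in gsupp); last by rewrite (ggr_out sj vj) linear0.
have [si|si] := boolP (i \in gsupp); last exact: ggr_out si (gcomp_in i v).
pose u k := gcomp k v - (if k == j then v else 0).
have <- : u i = gcomp i v by rewrite /u eq_sym (negPf ji) subr0.
apply: (@ggr_indep gsupp) si; first exact: gsupp_uniq.
  move=> k; rewrite /u memvB ?gcomp_in //.
  by case: eqP => [->|_] //; rewrite mem0v.
rewrite sumrB gcomp_sum -big_mkcond /= (big_rem j) //= eqxx /=.
rewrite big1_seq ?addr0 ?subrr // => k /andP[/eqP->].
by rewrite mem_rem_uniq ?gsupp_uniq // inE eqxx.
Qed.

Lemma memv_sum_seq (V : vectType K) (g : int -> {vspace V}) (u : int -> V) s :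
  (forall i, u i \in g i) -> \sum_(i <- s) u i \in (\sum_(i <- s) g i)%VS.
Proof.
move=> ug; elim: s => [|i s IHs]; first by rewrite !big_nil mem0v.
by rewrite !big_cons memv_add.
Qed.

Fact dual_grading : is_grading dual_gr.
Proof.
split=> [|s f us fgr f0 i si].
  exists gsupp; rewrite eqEsubv subvf; apply/subvP=> f _.
  have -> : f = \sum_(i <- gsupp) (f \o gcomp i)%VF.
    apply/lfunP=> v; rewrite sum_lfunE -[in LHS](gcomp_sum v) linear_sum.
    by apply: eq_bigr => i _; rewrite comp_lfunE.
  apply: memv_sum_seq => i; apply/dual_grP => j v ji vj.
  by rewrite comp_lfunE (gcomp_other vj ji) linear0.
apply/lfunP=> v; rewrite zero_lfunE -(gcomp_sum v) linear_sum big1_seq //=.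
move=> j sj; have [ij|ij] := eqVneq j i; last first.
  exact: (dual_grP i (f i) (fgr i)) ij (gcomp_in j v).
rewrite ij; have /(congr1 (fun h : 'Hom(M, K^o) => h (gcomp i v))) := f0.
rewrite sum_lfunE zero_lfunE (big_rem i) //= big1_seq ?addr0 //.
move=> k /andP[_]; rewrite mem_rem_uniq // inE => /andP[ki _].
by apply: (dual_grP k (f k) (fgr k)) (gcomp_in i v); rewrite eq_sym.
Qed.

Definition dualmod : gmod gB'.
Proof.
refine (@GMod K B' gB' 'Hom(M, K^o) dual_act dual_gr _ _ _ _ _ _).
- move=> f k a b; apply/lfunP=> v.
  rewrite add_lfunE scale_lfunE !dual_actE; case: phiP => -> _ _ _.
  by rewrite gact_linearl linearP.
- move=> a k f g; apply/lfunP=> v.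
  by rewrite add_lfunE scale_lfunE !dual_actE add_lfunE scale_lfunE.
- move=> f; apply/lfunP=> v.
  by rewrite dual_actE; case: phiP => _ -> _ _; rewrite gact1.
- move=> a b f; apply/lfunP=> v.
  by rewrite !dual_actE; case: phiP => _ _ -> _; rewrite gactM.
- exact: dual_grading.
move=> i j a f ai /dual_grP fj; apply/dual_grP=> k v kij vk.
rewrite dual_actE; apply: (fj (- i + k)).
  by apply: contraNneq kij => <-; rewrite addrA subrr add0r.
by apply: gact_graded => //; case: phiP => _ _ _; apply.
Defined.

End Dual.

Lemma gsubmod_gcomp (K : fieldType) (B : falgType K) (gB : int -> {vspace B})
    (M : gmod gB) (U : {vspace M}) i v :
  gsubmod U -> v \in U -> gcomp M i v \in U.
Proof.
case=> _ [s ->]; elim: s v => [|j s IHs] v.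
  by rewrite !big_nil memv0 => /eqP->; rewrite linear0 mem0v.
rewrite !big_cons => /memv_addP[u uj [w ws ->]].
rewrite linearD memv_add ?IHs //=; have /andP[uU uM] : (u \in U) && (u \in ggr M j).
  by rewrite -memv_cap.
have [ij|ij] := eqVneq j i; last by rewrite (gcomp_other uM ij) mem0v.
suff -> : gcomp M i u = u by [].
rewrite -[RHS](gcomp_sum u); have [sj|sj] := boolP (j \in gsupp M); last first.
  by rewrite (ggr_out sj uM) gcomp_sum linear0.
rewrite (big_rem j) //= -ij big1_seq ?addr0 // => k /andP[_].
rewrite mem_rem_uniq ?gsupp_uniq // inE => /andP[kj _].
by rewrite (gcomp_other uM) // eq_sym.
Qed.

Section DualSimple.
Variables (K : fieldType) (B B' : falgType K).
Variables (gB : int -> {vspace B}) (gB' : int -> {vspace B'}).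
Variables (phi : B' -> B) (phiP : graded_antimorphism gB gB' phi).
Variables (phi_surj : forall b, exists a, phi a = b) (M : gmod gB).

Lemma dual_gr_gcomp i (f : 'Hom(M, K^o)) v :
  f \in dual_gr M i -> f (gcomp M i v) = f v.
Proof.
move/dual_grP=> fi; rewrite -[in RHS](gcomp_sum v) linear_sum /=.
have [si|si] := boolP (i \in gsupp M).
  rewrite (big_rem i) //= big1_seq ?addr0 // => j /andP[_].
  rewrite mem_rem_uniq ?gsupp_uniq // inE => /andP[ji _].
  exact: fi ji (gcomp_in j v).
rewrite (ggr_out si (gcomp_in i v)) linear0 big1_seq // => j /andP[_ sj].
by apply: (fi j) (gcomp_in j v); apply: contraNneq si => <-.
Qed.

Lemma dim_bigcap_lker (s : seq 'Hom(M, K^o)) :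
  (\dim {:M} <= \dim (\bigcap_(f <- s) lker f)%VS + size s)%N.
Proof.
elim: s => [|f s IHs]; first by rewrite big_nil addn0.
rewrite big_cons /= capvC (leq_trans IHs) // addnS -addSn leq_add2r.
set W := (\bigcap_(f <- s) lker f)%VS.
rewrite -(limg_ker_dim f W) -addn1 leq_add2l.
by rewrite (leq_trans (dimvS (subvf _))) // dimvf.
Qed.

Lemma dual_simple : simple_gmod M -> simple_gmod (dualmod phiP M).
Proof.
have dimD : \dim {:dualmod phiP M} = \dim {:M} by rewrite !dimvf /dim /= muln1.
case=> M0 Msim; split; first by rewrite -dimv_eq0 dimD dimv_eq0.
move=> U Usub; have [Ustab _] := Usub.
pose Z : {vspace M} := (\bigcap_(f <- vbasis U) lker (f : 'Hom(M, K^o)))%VS.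
have ZP v : reflect (forall f : 'Hom(M, K^o), f \in U -> f v = 0) (v \in Z).
  apply: (iffP idP) => [vZ f fU | vU].
    have fv (h : 'Hom(M, K^o)) : h \in (vbasis U : seq _) -> h v = 0.
      move=> hU; apply/eqP; rewrite -memv_ker; apply: subvP vZ.
      by rewrite /Z (big_rem h) //=; exact: capvSl.
    rewrite (coord_vbasis fU) sum_lfunE big1 // => i _.
    by rewrite scale_lfunE fv ?scaler0 // mem_nth ?size_tuple.
  rewrite /Z big_seq; elim/big_ind: _ => [|V W vV vW|f fU].
  - by rewrite memvf.
  - by rewrite memv_cap vV.
  by rewrite memv_ker vU // vbasis_mem.
have Zsub : gsubmod Z.
  split=> [a v /ZP vZ|].
    apply/ZP=> f fU; have [b <-] := phi_surj a.
    by rewrite -(dual_actE phi b f v) vZ // (Ustab b f).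
  exists (gsupp M); apply/eqP; rewrite eqEsubv; apply/andP; split; last first.
    elim: (gsupp M) => [|i s IHs]; first by rewrite big_nil sub0v.
    by rewrite big_cons subv_add capvSl.
  apply/subvP=> v /ZP vZ; rewrite -(gcomp_sum v); apply: memv_sum_seq => i.
  rewrite memv_cap gcomp_in andbT; apply/ZP=> f fU.
  rewrite -(@gcomp_sum _ _ _ (dualmod phiP M) f) sum_lfunE big1 // => k _.
  have fk := @gcomp_in _ _ _ (dualmod phiP M) k f.
  have [ki|ki] := eqVneq i k; last first.
    by have /dual_grP fk0 := fk; exact: fk0 ki (gcomp_in i v).
  rewrite ki (dual_gr_gcomp v fk) vZ //.
  exact: (@gsubmod_gcomp _ _ _ (dualmod phiP M) U k f).
have [Z0|Zf] := Msim Z Zsub; [right | left]; last first.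
  apply/eqP; rewrite -subv0; apply/subvP=> f fU; rewrite memv0.
  apply/eqP/lfunP=> v; rewrite zero_lfunE.
  by have /ZP : v \in Z by [rewrite Zf memvf]; apply.
apply/eqP; rewrite eqEdim subvf dimD.
by have := dim_bigcap_lker (vbasis U); rewrite -/Z Z0 dimv0 size_tuple.
Qed.

End DualSimple.

Section Algebras.
Variable K : fieldType.

Definition simple_lmod (R : nzRingType) (S : lmodType R) : Prop :=
  (exists v : S, v != 0) /\
  forall U : {pred S}, GRing.submod_closed U ->
    (forall v, v \in U -> v = 0) \/ (forall v, v \in U).

Definition split_algebra (B : falgType K) : Prop :=
  forall (S : lmodType B) (f : {linear S -> S}), simple_lmod S ->
    exists k : K, forall v, f v = k%:A *: v.

Definition minimal_left_ideal (B : falgType K) (I : {vspace B}) : Prop :=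
  [/\ (fullv * I <= I)%VS, I != 0%VS
    & forall J : {vspace B}, (fullv * J <= J)%VS -> (J <= I)%VS ->
        J = 0%VS \/ J = I].

(* The left regular module is a sum of simple submodules. *)
Definition semisimple_algebra (B : falgType K) : Prop :=
  exists2 s : seq {vspace B},
    (forall I, I \in s -> minimal_left_ideal I) & (\sum_(I <- s) I)%VS = fullv.

Definition injective_lmod (R : nzRingType) (Q : lmodType R) : Prop :=
  forall (X Y : lmodType R) (i : {linear X -> Y}) (f : {linear X -> Q}),
    injective i -> exists g : {linear Y -> Q}, forall x, g (i x) = f x.

Definition self_injective (B : falgType K) : Prop := injective_lmod B^o.

End Algebras.

(* A finite-dimensional algebra A with the data (A^-, T, A^+). *)
Record triple (K : fieldType) := Triple {
  talg : falgType K;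
  tgr : int -> {vspace talg};
  tneg : {aspace talg};
  tmid : {aspace talg};
  tpos : {aspace talg}
}.

Section Triangular.
Variables (K : fieldType) (D : triple K).
Local Notation A := (talg D).
Local Notation gA := (tgr D).
Local Notation Am := (tneg D).
Local Notation T := (tmid D).
Local Notation Ap := (tpos D).

Definition triangular_decomposition : Prop :=
  [/\ [/\ graded_subalgebra gA Am, graded_subalgebra gA T
        & graded_subalgebra gA Ap],
      (* multiplication maps the pure tensors of basis vectors, which form a
         basis of the tensor product of A^-, T and A^+, to a basis of A *)
      basis_of fullv [seq x * y | x <- [seq a * t | a <- vbasis Am,
                                                    t <- vbasis T],
                                  y <- vbasis Ap],
      [/\ (T <= gA 0)%VS, forall i, i < 0 -> (Ap :&: gA i)%VS = 0%VS
        & forall i, 0 < i -> (Am :&: gA i)%VS = 0%VS],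
      (Am :&: gA 0)%VS = 1%VS /\ (Ap :&: gA 0)%VS = 1%VS
    & [/\ (Ap * T)%VS = (T * Ap)%VS, (Am * T)%VS = (T * Am)%VS
        & split_algebra (subvs_of T)]].

Definition converse_triple : triple K :=
  Triple (opp_grading gA) (converse_aspace Ap) (converse_aspace T)
    (converse_aspace Am).

Definition modA := gmod gA.
Definition modT := gmod (sub_grading gA T).
Definition IrrT := Irr (sub_grading gA T).

Definition deg (l : IrrT) : int :=
  choose 0 (fun d => ggr (irr_rep l) d = fullv).

(* A map sigma : A x l -> W is balanced over B^+ = A^+ T if it factors through
   A (x)_{B^+} l.  The algebra B^+ acts on l through its quotient T: elements
   of T act as given, elements of B^+ of nonzero degree act by zero. *)
Definition balanced (l : modT) (W : vectType K) (sigma : A -> l -> W) : Prop :=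
  [/\ forall v, linear (fun a => sigma a v), forall a, linear (sigma a),
      forall a (t : subvs_of T) v,
        sigma (a * vsval t) v = sigma a (gact l t v)
    & forall a b i v, i != 0 -> b \in (Ap * T)%VS -> b \in gA i ->
        sigma (a * b) v = 0].

(* M is the graded A-module A (x)_{B^+} l, with tau a v = a (x) v. *)
Definition is_Delta (l : modT) (M : modA) : Prop :=
  exists tau : A -> l -> M,
    [/\ balanced tau,
        forall a b v, tau (a * b) v = gact M a (tau b v),
        forall i j a v, a \in gA i -> v \in ggr l j -> tau a v \in ggr M (i + j)
      & forall (W : vectType K) (sigma : A -> l -> W), balanced sigma ->
          exists! f : 'Hom(M, W), forall a v, f (tau a v) = sigma a v].

Definition Delta (l : modT) : modA := choose (gmod0 gA) (is_Delta l).

End Triangular.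

Section Weights.
Variables (K : fieldType) (D : triple K).
Local Notation A := (talg D).
Local Notation gA := (tgr D).
Local Notation T := (tmid D).

Fact converse_antimorphism : graded_antimorphism (opp_grading gA) gA
  (fun a : A => a : A^c).
Proof. by split=> // i a ai; rewrite /opp_grading opprK. Qed.

Definition converse_sub (t : subvs_of (tmid (converse_triple D))) :
  subvs_of T := vsproj T (vsval t : A).

Lemma val_converse_sub t : vsval (converse_sub t) = vsval t :> A.
Proof. by rewrite vsprojK //; exact: (subvsP t). Qed.

Lemma converse_sub_surj t : exists t', converse_sub t' = t.
Proof.
exists (vsproj (tmid (converse_triple D)) (vsval t : A^c)).
apply: val_inj; rewrite /= val_converse_sub.
exact: (@vsprojK _ _ (converse_vspace T) (vsval t) (subvsP t)).
Qed.

Lemma memv_sub_grading (B : falgType K) (g : int -> {vspace B})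
    (U : {aspace B}) i (t : subvs_of U) :
  (t \in sub_grading g U i) = (vsval t \in g i).
Proof. by rewrite -memv_preim lfunE. Qed.

Fact converse_sub_antimorphism : graded_antimorphism
  (sub_grading gA T)
  (sub_grading (tgr (converse_triple D)) (tmid (converse_triple D)))
  converse_sub.
Proof.
split.
- by move=> k a b; apply: val_inj; rewrite /= !val_converse_sub.
- apply: val_inj; rewrite /= val_converse_sub /=.
  exact: algid_converse.
- by move=> a b; apply: val_inj; rewrite /= !val_converse_sub.
move=> i a; rewrite !memv_sub_grading val_converse_sub; exact.
Qed.

Definition dualA : modA (converse_triple D) -> modA D :=
  dualmod converse_antimorphism.

Definition dualT : modT D -> modT (converse_triple D) :=
  dualmod converse_sub_antimorphism.

Definition dual_IrrT (l : IrrT D) : IrrT (converse_triple D) :=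
  irr_class (dual_simple converse_sub_antimorphism converse_sub_surj
    (irr_rep_simple l)).

Definition nabla (l : modT D) : modA D :=
  dualA (Delta (dualT l)).

Definition Lmod (l : IrrT D) : modA D :=
  choose (gmod0 gA) (hd_iso (Delta (irr_rep l))).

Definition Pmod (l : IrrT D) : modA D :=
  choose (gmod0 gA) (fun P => projective_cover P (Lmod l)).

Definition has_highest_weight (M : modA D) (l : IrrT D) : Prop :=
  mult M (Lmod l) = 1%N /\
  forall m : IrrT D, mult M (Lmod m) <> 0%N -> m = l \/ deg m < deg l.

Definition highest_weight_object (M : modA D) : Prop :=
  exists l : IrrT D, has_highest_weight M l.

Definition hw (l : IrrT D) : IrrT D :=
  choose l (has_highest_weight (Pmod l)).

Definition nakayama (l : IrrT D) : IrrT D :=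
  choose l (fun m => soc_iso (Pmod l) (Lmod m)).

Definition standard_filtration (M : modA D) :=
  gfiltration (fun N => exists l : IrrT D, N = Delta (irr_rep l)) (M := M).

Definition costandard_filtration (M : modA D) :=
  gfiltration (fun N => exists l : IrrT D, N = nabla (irr_rep l)) (M := M).

End Weights.

(* Main.v *)
Require Import Defs.
From HB Require Import structures.
From mathcomp Require Import all_boot all_order all_algebra all_field.
From mathcomp.classical Require Import boolp.
From mathcomp Require Import zify.

Set Implicit Arguments.
Unset Strict Implicit.
Unset Printing Implicit Defensive.

Import Order.TTheory GRing.Theory Num.Theory.
Local Open Scope ring_scope.

(** Let d be the largest degree of a projective cover P = P(l).  The argument
    rests on three facts about the top component P_d.

    First, P is a direct summand of a shift of A, and A is free as a left module
    over A^-, on a basis of T A^+ (neg_free).  Working modulo elements of A of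
    degree too large for P to see them, this yields that A^- acts freely on P_d
    (top_free): A^- (x) P_d -> P is injective.  In particular disjoint
    T-submodules of P_d generate disjoint graded submodules of P, and when P_d
    is a simple T-module m the canonical map Delta(m) -> P is injective
    (Delta_embeds).

    Secondly, self-injectivity makes P injective among the graded modules
    (self_injective_greg).  As P has a simple head it is indecomposable, so by
    Fitting's lemma any two nonzero graded submodules meet (injective_uniform):
    P has a simple socle, and by the first fact and the semisimplicity of T the
    T-module P_d is simple (cover_top_weight), say P_d = m.

    Thirdly, every simple graded module L(y) has the top component y in degree
    deg y.  Hence in any composition series of P a single factor meets P_d, it
    is L(m), and all others have smaller degree (composition_factors): P(l) has
    highest weight m.  Since the count works for every composition series, no
    Jordan-Hoelder theorem enters.

    Now Delta(m) lies in P(l), so its socle is Soc P(l) = L(nu l).  As P(l) is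
    the injective hull of its socle, nu is injective, and then so is the map
    sending l to m.  Both maps commute with shifts, and there are finitely many
    simple T-modules up to shift, so both are bijective
    (equivariant_surjective).  Every standard module is therefore some Delta(m),
    and its socle determines l and m.  The bottom of a standard filtration of
    P(l) is a standard module with the socle of P(l), that is, Delta(m).

    The dual of P(l) is the projective cover of the dual of L(nu l) over the
    opposite algebra (dual_Pmod_cover), and dualizing preserves degrees, so its
    top component is the dual of m (dual_hw).  The embedding of the standard
    module of the opposite algebra into the dual of P(l) dualizes to a
    surjection of P(l) onto nabla(m), so that nabla(m) has head L(l)
    (nabla_head).  The top of a costandard filtration of P(l) is a costandard
    module with the head of P(l), that is, nabla(m). *)

(** * Graded modules and their homomorphisms *)

Lemma chooseP (X : Type) (x0 : X) (P : X -> Prop) :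
  (exists x, P x) -> P (Defs.choose x0 P).
Proof.
by rewrite /Defs.choose; case: pselect => // exP _; exact: projT2 (cid exP).
Qed.

(** A grading is determined by its projections: applying the i-th one to a
    vanishing sum of homogeneous vectors isolates the term of degree i. *)
Lemma grading_of_comp (K : fieldType) (V : vectType K) (g : int -> {vspace V})
    (c : int -> V -> V) (s : seq int) :
  (forall i v, c i v \in g i) ->
  (forall v, \sum_(i <- s) c i v = v) ->
  (forall i, {morph c i : x y / x + y}) ->
  (forall i j v, v \in g j -> j != i -> c i v = 0) ->
  uniq s -> is_grading g.
Proof.
move=> cin csum cD cout us.
have c0 i : c i 0 = 0 by apply: (addrI (c i 0)); rewrite -cD !addr0.
have cid i v : v \in g i -> c i v = v.
  move=> vi; have [si|si] := boolP (i \in s).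
    rewrite -[RHS](csum v) (big_rem i) //= big1_seq ?addr0 // => j /andP[_].
    by rewrite mem_rem_uniq // inE => /andP[ji _]; apply: cout vi _;
      rewrite eq_sym.
  suff -> : v = 0 by [].
  rewrite -(csum v) big1_seq // => j /andP[_ js]; apply: cout vi _.
  by apply: contraNneq si => ->.
split=> [|r u ur ug u0 i ir].
  exists s; rewrite eqEsubv subvf; apply/subvP=> v _.
  by rewrite -(csum v); apply: memv_sum_seq.
rewrite -(cid i (u i)) //; move/(congr1 (c i)): u0;
  rewrite c0 (big_morph _ (cD i) (c0 i)).
rewrite (big_rem i) //= [X in _ + X]big1_seq ?addr0 // => j /andP[_].
by rewrite mem_rem_uniq // inE => /andP[ji _]; exact: cout (ug j) ji.
Qed.


Section GradedModules.
Variables (K : fieldType) (B : falgType K) (gB : int -> {vspace B}).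
Implicit Types M N P Q S : gmod gB.

Lemma gactDl M a b v : gact M (a + b) v = gact M a v + gact M b v.
Proof. by have := gact_linearl (g := M) v 1 a b; rewrite !scale1r. Qed.

Lemma gact0l M v : gact M 0 v = 0.
Proof. by apply: (addrI (gact M 0 v)); rewrite -gactDl !addr0. Qed.

Lemma gactZl M k a v : gact M (k *: a) v = k *: gact M a v.
Proof.
by have := gact_linearl (g := M) v k a 0; rewrite !addr0 gact0l addr0.
Qed.

Lemma gact_suml M I (r : seq I) (P : pred I) (F : I -> B) v :
  gact M (\sum_(i <- r | P i) F i) v = \sum_(i <- r | P i) gact M (F i) v.
Proof.
exact: (big_morph (gact M ^~ v) (fun a b => gactDl a b v) (gact0l v)).
Qed.

(** A named function, which can carry the linear structure of the action in
    the algebra variable. *)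
Definition orbit_map M (v : M) (a : B) : M := gact M a v.

HB.instance Definition _ M v :=
  GRing.isLinear.Build K B M _ (@orbit_map M v) (gact_linearl (g := M) v).

Lemma gact_scalar M k v : gact M k%:A v = k *: v.
Proof. by rewrite gactZl gact1. Qed.

Lemma gcomp_id M i v : v \in ggr M i -> gcomp M i v = v.
Proof.
move=> vi; rewrite -[RHS](gcomp_sum v).
have [si|si] := boolP (i \in gsupp M); last first.
  by rewrite (ggr_out si vi) linear0 big1 // => j _; rewrite linear0.
rewrite (big_rem i) //= big1_seq ?addr0 // => j /andP[_].
rewrite mem_rem_uniq ?gsupp_uniq // inE => /andP[ji _].
by rewrite (gcomp_other vi) // eq_sym.
Qed.

Lemma ggr_disjoint M i j v : v \in ggr M i -> v \in ggr M j -> i != j -> v = 0.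
Proof. by move=> vi vj ij; rewrite -(gcomp_id vj) (gcomp_other vi ij). Qed.

Lemma gcomp_act M i j a v :
  a \in gB i -> gcomp M (i + j) (gact M a v) = gact M a (gcomp M j v).
Proof.
move=> ai; rewrite -[in LHS](gcomp_sum v) !linear_sum.
have [sj|sj] := boolP (j \in gsupp M); last first.
  rewrite (ggr_out sj (gcomp_in j v)) linear0 big1_seq // => k /andP[_ sk].
  apply: gcomp_other (gact_graded (g := M) ai (gcomp_in k v)) _.
  by rewrite (inj_eq (addrI i)); apply: contraNneq sj => <-.
rewrite (big_rem j) //= big1_seq ?addr0 => [|k /andP[_]].
  by rewrite gcomp_id // gact_graded // gcomp_in.
rewrite mem_rem_uniq ?gsupp_uniq // inE => /andP[kj _].
apply: gcomp_other (gact_graded (g := M) ai (gcomp_in k v)) _.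
by rewrite (inj_eq (addrI i)).
Qed.

Lemma homogeneous_gcomp M (U : {vspace M}) :
  homogeneous_sub (ggr M) U <-> forall i v, v \in U -> gcomp M i v \in U.
Proof.
split=> [[s eU] i v|gU].
  have /subvP sU : (U <= gcomp M i @^-1: U)%VS; last by move/sU;
    rewrite -memv_preim.
  rewrite {1}eU; apply: (big_ind (fun X => X <= _)%VS) => [|X Y sX sY|j _].
  - exact: sub0v.
  - by rewrite subv_add sX.
  apply/subvP=> u; rewrite memv_cap -memv_preim => /andP[uU uj].
  have [<-|ji] := eqVneq j i; first by rewrite gcomp_id.
  by rewrite (gcomp_other uj ji) mem0v.
exists (gsupp M); apply/eqP; rewrite eqEsubv; apply/andP; split.
  apply/subvP=> v vU; rewrite -(gcomp_sum v); apply: memv_sum_seq => i.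
  by rewrite memv_cap gU // gcomp_in.
apply: (big_ind (fun X => X <= U)%VS) => [|X Y sX sY|j _]; first exact: sub0v.
  by rewrite subv_add sX.
exact: capvSl.
Qed.

Lemma gsubmodP M (U : {vspace M}) :
  (forall a v, v \in U -> gact M a v \in U) ->
  (forall i v, v \in U -> gcomp M i v \in U) -> gsubmod U.
Proof. by move=> aU gU; split=> //; apply/homogeneous_gcomp. Qed.

Lemma gsubmod_act M (U : {vspace M}) a v :
  gsubmod U -> v \in U -> gact M a v \in U.
Proof. by case=> aU _; exact: aU. Qed.

Lemma gsubmod0 M : gsubmod (0%VS : {vspace M}).
Proof.
by apply: gsubmodP => [a|i] v; rewrite !memv0 => /eqP->; rewrite linear0.
Qed.

Lemma gsubmodT M : gsubmod (fullv : {vspace M}).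
Proof. by apply: gsubmodP => *; rewrite memvf. Qed.

Lemma gsubmodD M (U V : {vspace M}) :
  gsubmod U -> gsubmod V -> gsubmod (U + V)%VS.
Proof.
move=> sU sV; apply: gsubmodP => [a|i] _ /memv_addP[u uU [v vV ->]];
  by rewrite linearD memv_add // (gsubmod_act, gsubmod_gcomp).
Qed.

Lemma gsubmodI M (U V : {vspace M}) :
  gsubmod U -> gsubmod V -> gsubmod (U :&: V)%VS.
Proof.
move=> sU sV; apply: gsubmodP => [a|i] v; rewrite !memv_cap => /andP[uU uV].
  by rewrite !gsubmod_act.
by rewrite !gsubmod_gcomp.
Qed.

(** Relative to a submodule, because the maps that exhibit subquotients
    respect the degrees only there. *)
Lemma gcomp_graded_on M N (f : 'Hom(M, N)) (U : {vspace M}) i v :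
  gsubmod U -> (forall i v, v \in U -> v \in ggr M i -> f v \in ggr N i) ->
  v \in U -> f (gcomp M i v) = gcomp N i (f v).
Proof.
move=> sU fg vU; have {}fg k : f (gcomp M k v) \in ggr N k.
  by rewrite fg ?gcomp_in // gsubmod_gcomp.
rewrite -[in RHS](gcomp_sum v) !linear_sum.
have [si|si] := boolP (i \in gsupp M); last first.
  rewrite (ggr_out si (gcomp_in i v)) linear0 big1_seq // => k /andP[_ sk].
  by apply: gcomp_other (fg k) _; apply: contraNneq si => <-.
rewrite (big_rem i) //= big1_seq ?addr0 => [|k /andP[_]].
  by rewrite (gcomp_id (fg i)).
rewrite mem_rem_uniq ?gsupp_uniq // inE => /andP[ki _].
exact: gcomp_other (fg k) ki.
Qed.

Lemma ghom_gcomp M N (f : 'Hom(M, N)) i v :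
  ghom f -> f (gcomp M i v) = gcomp N i (f v).
Proof.
case=> _ fg; apply: (gcomp_graded_on (U := fullv)); rewrite ?memvf //.
  exact: gsubmodT.
by move=> k w _; exact: fg.
Qed.

Lemma ghomP M N (f : 'Hom(M, N)) :
  (forall a v, f (gact M a v) = gact N a (f v)) ->
  (forall i v, f (gcomp M i v) = gcomp N i (f v)) -> ghom f.
Proof.
by move=> fa fg; split=> // i v vi; rewrite -(gcomp_id vi) fg gcomp_in.
Qed.

Lemma ghom_id M : ghom (\1%VF : 'Hom(M, M)).
Proof. by split=> *; rewrite !lfunE. Qed.

Lemma ghom_comp M N P (f : 'Hom(N, P)) (g : 'Hom(M, N)) :
  ghom f -> ghom g -> ghom (f \o g)%VF.
Proof.
move=> [fa fg] [ga gg]; split=> [a v|i v vi]; rewrite !comp_lfunE ?ga ?fa //.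
exact/fg/gg.
Qed.

Lemma gsubmod_img M N (f : 'Hom(M, N)) (U : {vspace M}) :
  ghom f -> gsubmod U -> gsubmod (f @: U)%VS.
Proof.
move=> hf sU; have [fa _] := hf.
apply: gsubmodP => [a|i] _ /memv_imgP[u uU ->].
  by rewrite -fa memv_img // gsubmod_act.
by rewrite -ghom_gcomp // memv_img // gsubmod_gcomp.
Qed.

Lemma gsubmod_preim M N (f : 'Hom(M, N)) (U : {vspace N}) :
  ghom f -> gsubmod U -> gsubmod (f @^-1: U)%VS.
Proof.
move=> hf sU; have [fa _] := hf.
apply: gsubmodP => [a|i] v; rewrite -!memv_preim => fv.
  by rewrite fa gsubmod_act.
by rewrite ghom_gcomp // gsubmod_gcomp.
Qed.

Lemma gsubmod_ker M N (f : 'Hom(M, N)) : ghom f -> gsubmod (lker f).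
Proof. by move=> hf; rewrite -lpreim0; apply: gsubmod_preim (gsubmod0 N). Qed.

Lemma gsubmod_limg M N (f : 'Hom(M, N)) : ghom f -> gsubmod (limg f).
Proof. by move=> hf; apply: gsubmod_img hf (gsubmodT M). Qed.

Lemma ghom_inv M N (f : 'Hom(M, N)) :
  ghom f -> lker f = 0%VS -> limg f = fullv ->
  [/\ ghom (f^-1)%VF, cancel f (f^-1)%VF & cancel (f^-1)%VF f].
Proof.
move=> hf kf imf; have fK : cancel f (f^-1)%VF by apply: lker0_lfunK;
  rewrite kf.
have fVK : cancel (f^-1)%VF f by move=> v; rewrite limg_lfunVK // imf memvf.
split=> //; have [fa _] := hf; apply: ghomP => [a|i] v; apply: (can_inj fK).
  by rewrite fa !fVK.
by rewrite (ghom_gcomp _ _ hf) !fVK.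
Qed.

Lemma giso_bij M N (f : 'Hom(M, N)) :
  ghom f -> lker f = 0%VS -> limg f = fullv -> giso M N.
Proof. by move=> hf kf /(ghom_inv hf kf)[hg fK gK]; exists f, (f^-1)%VF. Qed.

Lemma gisoW M N : giso M N ->
  exists2 f : 'Hom(M, N), ghom f & lker f = 0%VS /\ limg f = fullv.
Proof.
case=> f [g [hf hg fK gK]]; exists f => //; split.
  by apply/eqP/lker0P; exact: can_inj fK.
by apply/vspaceP=> v; rewrite memvf -(gK v) memv_img ?memvf.
Qed.

Lemma giso_refl M : giso M M.
Proof.
by exists \1%VF, \1%VF; split; try exact: ghom_id; move=> v; rewrite !lfunE.
Qed.

Lemma giso_sym M N : giso M N -> giso N M.
Proof. by case=> f [g [hf hg fK gK]]; exists g, f. Qed.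

Lemma giso_trans M N P : giso M N -> giso N P -> giso M P.
Proof.
case=> f [g [hf hg fK gK]] [f' [g' [hf' hg' fK' gK']]].
exists (f' \o f)%VF, (g \o g')%VF; split; try exact: ghom_comp.
  by move=> v; rewrite !comp_lfunE fK' fK.
by move=> v; rewrite !comp_lfunE gK gK'.
Qed.

End GradedModules.

(** * Subquotients and composition series *)

Lemma ex_minf (T : Type) (P : T -> Prop) (f : T -> nat) :
  (exists x, P x) -> exists x, P x /\ forall y, P y -> (f x <= f y)%N.
Proof.
move=> [x0 Px0]; pose Q n := `[< exists x, P x /\ f x = n >].
have exQ : exists n, Q n by exists (f x0); apply/asboolP; exists x0.
case: (ex_minnP exQ) => n /asboolP[x [Px fx]] minn; exists x; split=> // y Py.
by rewrite fx minn //; apply/asboolP; exists y.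
Qed.

Lemma ex_maxf (T : Type) (P : T -> Prop) (f : T -> nat) (m : nat) :
  (exists x, P x) -> (forall x, P x -> (f x <= m)%N) ->
  exists x, P x /\ forall y, P y -> (f y <= f x)%N.
Proof.
move=> exP lem; have [x [Px minx]] := ex_minf (fun x => m - f x)%N exP.
by exists x; split=> // y Py; have := minx y Py; have := lem y Py; lia.
Qed.

Section SubQuotients.
Variables (K : fieldType) (B : falgType K) (gB : int -> {vspace B}).
Implicit Types M N P Q S : gmod gB.

(** The idempotent f = 1 - projv V has kernel V and preserves U, so f(U) is a
    space of coset representatives;
      the action on it is that of M followed by f. *)
Lemma subquo_exists M (U V : {vspace M}) :
  gsubmod U -> gsubmod V -> (V <= U)%VS -> exists N, subquo_iso U V N.
Proof.
move=> sU sV VU; pose f : 'End(M) := (\1 - projv V)%VF.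
have fE v : f v = v - projv V v by rewrite add_lfunE opp_lfunE id_lfunE.
clearbody f; have fV v : v \in V -> f v = 0 by move=> vV;
  rewrite fE projv_id ?subrr.
have Vf v : v - f v \in V by rewrite fE opprB addrC subrK memv_proj.
have ff v : f (f v) = f v.
  by apply/eqP; rewrite eq_sym -subr_eq0 -linearB /= (fV _ (Vf v)).
have fU v : v \in U -> f v \in U.
  by move=> vU; rewrite fE memvB // (subvP VU) ?memv_proj.
pose W := (f @: U)%VS.
have WU (w : subvs_of W) : vsval w \in U.
  by have /memv_imgP[u uU ->] := subvsP w; exact: fU.
have fW (w : subvs_of W) : f (vsval w) = vsval w.
  by have /memv_imgP[u uU ->] := subvsP w; exact: ff.
pose act a (w : subvs_of W) : subvs_of W := vsproj W (f (gact M a (vsval w))).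
have actE a w : vsval (act a w) = f (gact M a (vsval w)).
  by rewrite vsprojK // memv_img // gsubmod_act.
pose gr i := (linfun vsval @^-1: (f @: (U :&: ggr M i)))%VS : {vspace subvs_of
  W}.
pose c i (w : subvs_of W) : subvs_of W := vsproj W (f (gcomp M i (vsval w))).
have cE i w : vsval (c i w) = f (gcomp M i (vsval w)).
  by rewrite vsprojK // memv_img // gsubmod_gcomp.
have grP i w : reflect (exists2 u,
  u \in (U :&: ggr M i)%VS & vsval w = f u) (w \in gr i).
  rewrite /gr -memv_preim lfunE /=.
  by apply: (iffP memv_imgP) => -[u ? ?]; exists u.
have factV a u : f (gact M a (f u)) = f (gact M a u).
  apply/eqP; rewrite -subr_eq0 -!linearB /= -opprB !linearN oppr_eq0 /=.
  by apply/eqP/fV; rewrite gsubmod_act.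
have g_lin v : linear (fun a => act a v).
  move=> k a b; apply: val_inj; rewrite /= !actE.
  by rewrite gactDl gactZl linearP.
have g_linr a : linear (act a).
  by move=> k v w; apply: val_inj; rewrite /= !actE !linearP.
have g_1 v : act 1 v = v by apply: val_inj; rewrite /= actE gact1 fW.
have g_M a b v : act (a * b) v = act a (act b v).
  by apply: val_inj; rewrite /= !actE gactM factV.
have g_gr : is_grading gr.
  apply: (@grading_of_comp _ _ gr c (gsupp M)).
  - move=> i w; apply/grP; exists (gcomp M i (vsval w)) => //.
    by rewrite memv_cap gcomp_in gsubmod_gcomp.
  - move=> w; apply: subvs_inj; rewrite -[RHS]fW -[in RHS](gcomp_sum (vsval w)).
    by rewrite !linear_sum; apply: eq_bigr => i _; exact: cE.
  - by move=> i v w; apply: val_inj; rewrite /= !cE !linearD.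
  - move=> i j v /grP[u uU vu] ji; apply: val_inj; rewrite /= cE vu.
    move: uU; rewrite memv_cap => /andP[uU uj].
    have -> : gcomp M i (f u) = - gcomp M i (u - f u).
      by rewrite linearB /= (gcomp_other uj ji) sub0r opprK.
    have /fV fV0 := gsubmod_gcomp i sV (Vf u).
    by rewrite linearN /= fV0 oppr0.
  exact: gsupp_uniq.
have g_act i j a v : a \in gB i -> v \in gr j -> act a v \in gr (i + j).
  move=> ai /grP[u]; rewrite memv_cap => /andP[uU uj] vu.
  apply/grP; exists (gact M a u); last by rewrite actE vu factV.
  by rewrite memv_cap gsubmod_act // gact_graded.
pose N := @GMod K B gB (subvs_of W) act gr g_lin g_linr g_1 g_M g_gr g_act.
exists N; exists (linfun (vsproj W) \o f)%VF; split.
- move=> a v vU; apply: val_inj; rewrite /= actE !comp_lfunE !lfunE /=.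
  by rewrite !vsprojK ?memv_img ?gsubmod_act // factV.
- move=> i v vU vi; apply/grP; exists v; first by rewrite memv_cap vU.
  by rewrite !comp_lfunE !lfunE /= vsprojK // memv_img.
- apply/vspaceP=> w; rewrite memvf; apply/memv_imgP; exists (vsval w);
  first exact: WU.
  by rewrite comp_lfunE lfunE /= fW vsvalK.
apply/vspaceP=> v; rewrite memv_cap memv_ker comp_lfunE lfunE /=.
apply/andP/idP=> [[vU /eqP/(congr1 vsval)]|vV].
  by rewrite vsprojK ?memv_img // => fv0; rewrite -[v]subr0 -[X in _ - X]fv0 Vf.
by rewrite (subvP VU) // fV // linear0.
Qed.

(** Both maps have the kernel V on U, so each factors through the other. *)
Lemma subquo_giso M (U V : {vspace M}) N N' : gsubmod U ->
  subquo_iso U V N -> subquo_iso U V N' -> giso N N'.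
Proof.
move=> sU [f [fa fg fU kf]] [f' [fa' fg' fU' kf']].
have onU (g : 'Hom(M, N)) : (g @: U = fullv)%VS ->
    forall n, exists2 u, u \in U & n = g u.
  by move=> gU n; apply/memv_imgP; rewrite gU memvf.
pose s := (projv U \o (f \o projv U)^-1)%VF.
have sP n : s n \in U /\ f (s n) = n.
  rewrite comp_lfunE memv_proj; split=> //.
  rewrite -[f _]comp_lfunE limg_lfunVK // limg_comp limg_proj fU memvf //.
pose h : 'Hom(N, N') := (f' \o s)%VF.
have hf u : u \in U -> h (f u) = f' u.
  move=> uU; rewrite comp_lfunE; have [sU' fs] := sP (f u).
  apply/eqP; rewrite -subr_eq0 -linearB -memv_ker /=.
  have : s (f u) - u \in V
    by rewrite -kf memv_cap memvB // memv_ker linearB /= fs subrr.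
  by rewrite -kf' memv_cap => /andP[].
have hh : ghom h.
  apply: ghomP => [a|i] n; have [u uU ->] := onU f fU n.
    by rewrite -fa // !hf ?fa' // gsubmod_act.
  rewrite -(gcomp_graded_on i sU fg uU) !hf // ?gsubmod_gcomp //.
  exact: gcomp_graded_on sU fg' uU.
apply: giso_bij hh _ _.
  apply/eqP; rewrite -subv0; apply/subvP=> n; have [u uU ->] := onU f fU n.
  rewrite memv_ker memv0 hf // => fu0.
  have : u \in V by rewrite -kf' memv_cap uU memv_ker.
  by rewrite -kf memv_cap memv_ker => /andP[_].
apply/vspaceP=> n; rewrite memvf;
  have : n \in (f' @: U)%VS by rewrite fU' memvf.
by case/memv_imgP=> u uU ->; rewrite -hf // memv_img ?memvf.
Qed.

Lemma subquo_giso_r M (U V : {vspace M}) N N' :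
  subquo_iso U V N -> giso N N' -> subquo_iso U V N'.
Proof.
move=> [f [fa fg fU kf]] /gisoW[h [ha hg] [kh imh]]; exists (h \o f)%VF; split.
- by move=> a v vU; rewrite !comp_lfunE fa ?ha.
- by move=> i v vU vi; rewrite comp_lfunE hg ?fg.
- by rewrite limg_comp fU.
have injh : injective h by apply/lker0P; rewrite kh.
rewrite -kf; apply/vspaceP=> v; rewrite !memv_cap !memv_ker comp_lfunE.
by rewrite -[X in _ == X](linear0 h) (inj_eq injh).
Qed.

Lemma subquo_of_inj M N (j : 'Hom(N, M)) :
  ghom j -> lker j = 0%VS -> subquo_iso (limg j) 0%VS N.
Proof.
move=> hj kj; have [ja _] := hj.
have jK : cancel j (j^-1)%VF by apply: lker0_lfunK; rewrite kj.
exists (j^-1)%VF; split.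
- by move=> a _ /memv_imgP[u _ ->]; rewrite -ja !jK.
- move=> i _ /memv_imgP[u _ ->] jui; rewrite jK.
  by rewrite -(jK u) -(gcomp_id jui) -ghom_gcomp // jK gcomp_in.
- apply/vspaceP=> u; rewrite memvf; apply/memv_imgP; exists (j u) => //.
  by rewrite memv_img ?memvf.
apply/eqP; rewrite -subv0; apply/subvP=> v;
  rewrite memv_cap => /andP[/memv_imgP[u _ ->]].
by rewrite memv_ker memv0 jK => /eqP->; rewrite linear0.
Qed.

Lemma subquo_of_surj M N (q : 'Hom(M, N)) :
  ghom q -> limg q = fullv -> subquo_iso fullv (lker q) N.
Proof.
move=> [qa qg] imq; exists q; split=> //; last by rewrite capfv.
by move=> i v _; exact: qg.
Qed.

Lemma subquo_inj M N (U : {vspace M}) : gsubmod U -> subquo_iso U 0%VS N ->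
  exists j : 'Hom(N, M), [/\ ghom j, lker j = 0%VS & limg j = U].
Proof.
move=> sU [f [fa fg fU kf]].
pose s := (projv U \o (f \o projv U)^-1)%VF : 'Hom(N, M).
have sP n : s n \in U /\ f (s n) = n.
  rewrite comp_lfunE memv_proj; split=> //.
  by rewrite -[f _]comp_lfunE limg_lfunVK // limg_comp limg_proj fU memvf.
have injU u v : u \in U -> v \in U -> f u = f v -> u = v.
  move=> uU vU fuv; apply/eqP; rewrite -subr_eq0 -memv0 -kf memv_cap memvB //.
  by rewrite memv_ker linearB /= fuv subrr.
have sU' n : s n \in U by case: (sP n).
have fs n : f (s n) = n by case: (sP n).
exists s; split.
- apply: ghomP => [a|i] n; apply: injU;
  rewrite ?gsubmod_act ?gsubmod_gcomp ?sU' //.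
    by rewrite fa ?fs ?sU'.
  by rewrite (gcomp_graded_on i sU fg) ?fs ?sU'.
- by apply/eqP/lker0P; exact: can_inj fs.
apply/eqP; rewrite eqEsubv; apply/andP; split.
  by apply/subvP=> _ /memv_imgP[n _ ->].
by apply/subvP=> u uU; rewrite (injU u (s (f u))) ?memv_img ?memvf.
Qed.

Lemma subquo_surj M N (V : {vspace M}) : subquo_iso fullv V N ->
  exists q : 'Hom(M, N), [/\ ghom q, lker q = V & limg q = fullv].
Proof.
case=> q [qa qg imq]; rewrite capfv => kq; exists q; split=> //.
by split=> *; [apply: qa | apply: qg]; rewrite ?memvf.
Qed.

Lemma gsub_exists M (U : {vspace M}) : gsubmod U ->
  exists N (j : 'Hom(N, M)), [/\ ghom j, lker j = 0%VS & limg j = U].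
Proof.
move=> sU; have [N isoN] := subquo_exists sU (gsubmod0 M) (sub0v U).
by have [j jP] := subquo_inj sU isoN; exists N, j.
Qed.

Lemma gquo_exists M (V : {vspace M}) : gsubmod V ->
  exists N (q : 'Hom(M, N)), [/\ ghom q, lker q = V & limg q = fullv].
Proof.
move=> sV; have [N isoN] := subquo_exists (gsubmodT M) sV (subvf V).
by have [q qP] := subquo_surj isoN; exists N, q.
Qed.

Lemma ghom_lift_inj M N Q (j : 'Hom(N, M)) (f : 'Hom(Q, M)) :
  ghom j -> lker j = 0%VS -> ghom f -> (limg f <= limg j)%VS ->
  exists2 g : 'Hom(Q, N), ghom g & forall v, j (g v) = f v.
Proof.
move=> hj kj hf sfj; have [[ja _] [fa _]] := (hj, hf).
have jK : cancel j (j^-1)%VF by apply: lker0_lfunK; rewrite kj.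
have jVf v : j ((j^-1)%VF (f v)) = f v.
  by rewrite limg_lfunVK // (subvP sfj) ?memv_img ?memvf.
exists (j^-1 \o f)%VF => [|v]; last by rewrite comp_lfunE.
apply: ghomP => [a|i] v; apply: (can_inj jK); rewrite !comp_lfunE.
  by rewrite ja !jVf fa.
by rewrite (ghom_gcomp _ _ hj) !jVf (ghom_gcomp _ _ hf).
Qed.

Lemma ghom_factor_surj M N Q (q : 'Hom(M, N)) (f : 'Hom(M, Q)) :
  ghom q -> limg q = fullv -> ghom f -> (lker q <= lker f)%VS ->
  exists2 g : 'Hom(N, Q), ghom g & forall v, g (q v) = f v.
Proof.
move=> hq imq hf kqf; have [[qa _] [fa _]] := (hq, hf).
pose g := (f \o q^-1)%VF.
have gq v : g (q v) = f v.
  apply/eqP; rewrite comp_lfunE -subr_eq0 -linearB -memv_ker (subvP kqf) //.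
  by rewrite memv_ker linearB /= limg_lfunVK ?subrr // imq memvf.
have onN n : exists v, n = q v.
  by have /memv_imgP[v _ ->] : n \in limg q; [rewrite imq memvf | exists v].
exists g => //; apply: ghomP => [a|i] n; have [v ->] := onN n.
  by rewrite -qa !gq fa.
by rewrite -ghom_gcomp // !gq ghom_gcomp.
Qed.

Lemma giso_simple M N : giso M N -> simple_gmod M -> simple_gmod N.
Proof.
move=> /gisoW[f hf [kf imf]] [M0 sM]; split.
  by rewrite -imf -dimv_eq0 limg_dim_eq ?kf ?capv0 // dimv_eq0.
move=> U sU; have := sM _ (gsubmod_preim hf sU).
have eU : (f @: (f @^-1: U) = U)%VS by rewrite lpreimK // imf subvf.
by case=> e; [left|right]; rewrite -eU e ?limg0.
Qed.

Lemma simple_subquo M (U V : {vspace M}) N : gsubmod U -> gsubmod V ->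
  U <> V ->
  (forall X : {vspace M}, gsubmod X -> (V <= X <= U)%VS -> X = V \/ X = U) ->
  subquo_iso U V N -> simple_gmod N.
Proof.
move=> sU sV UV maxV [f [fa fg fU kf]].
have VU : (V <= U)%VS by rewrite -kf capvSl.
split.
  apply/negP=> /eqP N0; apply: UV; rewrite -kf; apply/esym/capv_idPl.
  apply/subvP=> u uU; rewrite memv_ker -memv0.
  by have := memvf (f u); rewrite N0.
move=> X sX; pose Y := (U :&: f @^-1: X)%VS.
have sY : gsubmod Y.
  apply: gsubmodP => [a|i] v; rewrite !memv_cap -!memv_preim => /andP[vU fv].
    by rewrite fa // !gsubmod_act.
  by rewrite (gcomp_graded_on i sU fg) // !gsubmod_gcomp.
have eX : X = (f @: Y)%VS.
  apply/vspaceP=> n; apply/idP/memv_imgP=> [nX|[v]].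
    have /memv_imgP[u uU en] : n \in (f @: U)%VS by rewrite fU memvf.
    by exists u => //; rewrite memv_cap uU -memv_preim -en.
  by rewrite memv_cap -memv_preim => /andP[_ ?] ->.
have VY : (V <= Y <= U)%VS.
  rewrite capvSl andbT subv_cap VU; apply/subvP=> v.
  by rewrite -kf memv_cap memv_ker -memv_preim => /andP[_ /eqP->];
    rewrite mem0v.
have [eY|eY] := maxV Y sY VY; rewrite eX eY; [left|by right].
apply/eqP; rewrite -subv0; apply/subvP=> _ /memv_imgP[v vV ->].
by move: vV; rewrite -kf memv_cap memv_ker memv0 => /andP[].
Qed.

(** Induction on the dimension: a proper graded submodule of largest
    dimension has a simple quotient. *)
Lemma composition_series_exists M :
  exists (n : nat) (F : nat -> {vspace M}),
    gfiltration (@simple_gmod K B gB) n F.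
Proof.
suff H d (U : {vspace M}) : gsubmod U -> (\dim U <= d)%N ->
    exists (n : nat) (F : nat -> {vspace M}), [/\ F 0%N = 0%VS, F n = U
    & forall i : nat, (i < n)%N ->
        [/\ gsubmod (F i.+1), (F i <= F i.+1)%VS
          & exists2 N, simple_gmod N & subquo_iso (F i.+1) (F i) N]].
  by have [n [F FP]] := H _ _ (gsubmodT M) (leqnn _); exists n, F.
elim: d U => [|d IHd] U sU dU.
  by exists 0%N, (fun=> 0%VS); split=> //; apply/esym/eqP;
    rewrite -dimv_eq0 -leqn0.
have [U0|U0] := eqVneq U 0%VS; first by exists 0%N, (fun=> 0%VS).
pose P (V : {vspace M}) := [/\ gsubmod V, (V <= U)%VS & V != U].
have [||V [[sV VU VnU] maxV]] := @ex_maxf _ P (fun V => \dim V) (\dim U).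
- by exists 0%VS; split; [exact: gsubmod0 | exact: sub0v | rewrite eq_sym].
- by move=> V [_ VU _]; exact: dimvS.
have ltVU : (\dim V < \dim U)%N.
  by rewrite ltn_neqAle dimvS // andbT; apply: contra VnU => /eqP e;
    rewrite eqEdim VU e /=.
have [|n [F [F0 Fn FP]]] := IHd V sV; first by rewrite -ltnS (leq_trans ltVU).
exists n.+1, (fun i => if (i <= n)%N then F i else U); split=> //.
  by rewrite ltnn.
move=> i; rewrite ltnS => lein; rewrite lein.
case: ltnP => [ltin|leni]; first exact: FP.
have -> : i = n by apply/eqP; rewrite eqn_leq lein.
rewrite Fn; split=> //; have [N isoN] := subquo_exists sU sV VU; exists N => //.
apply: simple_subquo isoN => //; first by apply/eqP; rewrite eq_sym.
move=> X sX /andP[VX XU]; have [->|XnU] := eqVneq X U; [by right|left].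
by apply/esym/eqP; rewrite eqEdim VX maxV.
Qed.

End SubQuotients.

(** * Shifts and regular modules *)

Section Shift.
Variables (K : fieldType) (B : falgType K) (gB : int -> {vspace B}).
Implicit Types M N : gmod gB.

Lemma shift_grading (V : vectType K) (g : int -> {vspace V}) (e : int) :
  is_grading g -> is_grading (fun i => g (i - e)).
Proof.
move=> [[s sP] indep]; split.
  exists [seq i + e | i <- s]; rewrite big_map.
  by under eq_bigr => i _ do rewrite addrK.
move=> r u ur ug u0 i ir.
have := indep [seq i - e | i <- r] (fun j => u (j + e)).
rewrite map_inj_uniq ?big_map; last exact: addIr.
rewrite (eq_bigr u) => [|j _]; last by rewrite subrK.
move/(_ ur _ u0 (i - e)); rewrite subrK; apply; last exact: map_f.
by move=> j; rewrite -{2}(addrK e j).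
Qed.

Definition gshift M (e : int) : gmod gB.
Proof.
refine (@GMod K B gB M (gact M) (fun i => ggr M (i - e)) (gact_linearl (g := M))
  (gact_linearr (g := M)) (gact1 (g := M)) (gactM (g := M))
  (shift_grading e (ggr_grading M)) _).
by move=> i j a v ai vj; rewrite -addrA gact_graded.
Defined.

Lemma ghom_shift M N e (f : 'Hom(M, N)) :
  ghom f <-> @ghom K B gB (gshift M e) (gshift N e) f.
Proof.
split=> -[fa fg]; split=> // i v; first exact: fg.
by have := fg (i + e) v; rewrite /= addrK.
Qed.

Lemma gsubmod_shift M e (U : {vspace M}) :
  gsubmod U <-> @gsubmod K B gB (gshift M e) U.
Proof.
split=> -[Ua [s sU]]; split=> //.
  exists [seq i + e | i <- s]; rewrite {1}sU big_map.
  by apply: eq_bigr => i _ /=; rewrite addrK.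
by exists [seq i - e | i <- s]; rewrite {1}sU big_map.
Qed.

Lemma simple_shift M e : simple_gmod M -> simple_gmod (gshift M e).
Proof.
by case=> M0 sM; split=> // U sU; exact: sM U (iffRL (@gsubmod_shift M e U) sU).
Qed.

Lemma projective_shift M e : projective_gmod M -> projective_gmod (gshift M e).
Proof.
move=> pM N N' p f hp [fa fg] imp.
have hp' : @ghom K B gB (gshift N (- e)) (gshift N' (- e)) p.
  exact: (iffLR (@ghom_shift N N' (- e) p) hp).
have hf' : @ghom K B gB M (gshift N' (- e)) f.
  by split=> // i v vi; rewrite /= opprK; apply: fg; rewrite /= addrK.
have [g [ga gg] pg] := pM (gshift N (- e)) (gshift N' (- e)) p f hp' hf' imp;
  exists g => //; split=> // i v vi.
by have := gg _ _ vi; rewrite /= opprK subrK.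
Qed.

Lemma projective_cover_shift P M e :
  projective_cover P M -> projective_cover (gshift P e) (gshift M e).
Proof.
move=> [pP [p [hp imp ess]]]; split; first exact: projective_shift.
exists p; split=> //; first exact: (iffLR (@ghom_shift P M e p) hp).
by move=> U sU; exact: ess U (iffRL (@gsubmod_shift P e U) sU).
Qed.

End Shift.

Section Regular.
Variables (K : fieldType) (B : falgType K) (gB : int -> {vspace B}).
Hypothesis hB : graded_algebra gB.
Implicit Types M N : gmod gB.

Definition greg0 : gmod gB.
Proof.
refine (@GMod K B gB B *%R gB _ _ (@mul1r B) (fun a b c =>
  esym (mulrA a b c)) _ _).
- by move=> v k a b; rewrite mulrDl scalerAl.
- by move=> a k v w; rewrite mulrDr scalerAr.
- by case: hB.
by move=> i j a v ai vj; case: hB => _ _ /(_ i j)/prodvP; exact.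
Defined.

Definition greg (e : int) : gmod gB := gshift greg0 e.

Definition greg_map (e : int) M (m : M) : 'Hom(greg e, M) :=
  linfun (orbit_map m).

Lemma greg_mapE e M (m : M) (a : B) : greg_map e m a = gact M a m.
Proof. exact: lfunE. Qed.

Lemma greg_map_ghom e M (m : M) : m \in ggr M e -> ghom (greg_map e m).
Proof.
move=> me; split=> [a v|i v vi]; rewrite !greg_mapE ?gactM //.
by rewrite -[i](subrK e) gact_graded.
Qed.

Lemma greg_one e : (1 : greg e) \in ggr (greg e) e.
Proof. by rewrite /= subrr; case: hB. Qed.

Lemma greg_hom e M (f : 'Hom(greg e, M)) (a : B) :
  ghom f -> f a = gact M a (f 1).
Proof. by case=> fa _; rewrite -[in LHS](mulr1 a); exact: fa. Qed.

Lemma greg_projective e : projective_gmod (greg e).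
Proof.
move=> M N p f hp hf imp; have [_ fg] := hf.
have /memv_imgP[m _ em] : f 1 \in limg p by rewrite imp memvf.
exists (greg_map e (gcomp M e m)); first exact/greg_map_ghom/gcomp_in.
apply/lfunP=> a; rewrite comp_lfunE greg_mapE; have [pa _] := hp.
by rewrite pa (ghom_gcomp _ _ hp) -em (gcomp_id (fg _ _ (greg_one e)))
  -greg_hom.
Qed.

Lemma homogeneous_vector M : (fullv : {vspace M}) != 0%VS ->
  exists e (x : M), x \in ggr M e /\ x != 0.
Proof.
move=> M0; have /eqP x0 : vpick (fullv : {vspace M}) != 0 by rewrite vpick0.
have [[e xe]|no] := pselect (exists e, gcomp M e (vpick fullv) <> 0).
  by exists e, (gcomp M e (vpick fullv)); split; [exact: gcomp_in | apply/eqP].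
case: x0; rewrite -(gcomp_sum (vpick _)) big1 // => i _.
by apply: contrapT => xi; apply: no; exists i.
Qed.

End Regular.

(** * Heads, socles and injective modules *)

Section LinearMaps.
Variable K : fieldType.

Lemma limg_neq0 (V W : vectType K) (f : 'Hom(V, W)) :
  fullv != 0%VS :> {vspace V} -> lker f = 0%VS -> limg f != 0%VS.
Proof.
by move=> M0 kf; rewrite -dimv_eq0 limg_dim_eq ?kf ?capv0 // dimv_eq0.
Qed.

Lemma lker_neqT (V W : vectType K) (f : 'Hom(V, W)) :
  fullv != 0%VS :> {vspace W} -> limg f = fullv -> lker f != fullv.
Proof.
move=> N0 imf; apply: contra N0 => /eqP kf; rewrite -imf -subv0.
apply/subvP=> _ /memv_imgP[v _ ->]; rewrite memv0 -memv_ker kf memvf //.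
Qed.

End LinearMaps.

Section HeadsAndSocles.
Variables (K : fieldType) (B : falgType K) (gB : int -> {vspace B}).
Implicit Types M N P Q L S : gmod gB.

Lemma simple_surj M L (f : 'Hom(M, L)) v :
  simple_gmod L -> ghom f -> f v != 0 -> limg f = fullv.
Proof.
move=> [_ sL] hf fv; case: (sL _ (gsubmod_limg hf)) => // e.
by case/negP: fv; rewrite -memv0 -e memv_img ?memvf.
Qed.

(** The head of M is L and simple: the kernel of a surjection onto L contains
    all proper graded submodules, hence is the radical. *)
Definition simple_head M L : Prop := exists p : 'Hom(M, L),
  [/\ ghom p, limg p = fullv
    & forall U : {vspace M}, gsubmod U -> U = fullv \/ (U <= lker p)%VS].

(** The socle of M is L and simple: the image of an embedding of L is
    contained in all nonzero graded submodules. *)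
Definition simple_soc M L : Prop := exists j : 'Hom(L, M),
  [/\ ghom j, lker j = 0%VS
    & forall U : {vspace M}, gsubmod U -> U = 0%VS \/ (limg j <= U)%VS].

Lemma simple_head_hd M L : simple_gmod L -> simple_head M L -> hd_iso M L.
Proof.
move=> [L0 _] [p [hp imp maxp]]; have kT := lker_neqT L0 imp.
have kermax V : gsubmod V -> (lker p <= V)%VS -> V = lker p \/ V = fullv.
  move=> sV kV; case: (maxp V sV) => [->|Vk]; [by right|left].
  by apply/eqP; rewrite eqEsubv Vk.
exists (lker p); last exact: subquo_of_surj.
split=> [W [sW WT maxW]|V]; last by apply; split=> //; exact: gsubmod_ker.
have [eW|Wk] := maxp W sW; first by rewrite eW eqxx in WT.
by case: (maxW _ (gsubmod_ker hp) Wk) => [->|e] //; rewrite e eqxx in kT.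
Qed.

Lemma hd_iso_giso M L L' : hd_iso M L -> hd_iso M L' -> giso L L'.
Proof.
move=> [U [lowU maxU] isoL] [U' [lowU' maxU'] isoL'].
have eU : U = U' by apply/eqP; rewrite eqEsubv maxU' // maxU.
by rewrite -eU in isoL'; exact: subquo_giso (gsubmodT M) isoL isoL'.
Qed.

(** Kernels of surjections onto nonzero modules are proper, hence contained
    in the largest proper submodule. *)
Lemma simple_head_quo M N L (q : 'Hom(M, N)) : simple_gmod L ->
  simple_head M L -> ghom q -> limg q = fullv -> fullv != 0%VS :> {vspace N} ->
  simple_head N L.
Proof.
move=> sL [p [hp imp maxp]] hq imq N0.
have [e|kqp] := maxp _ (gsubmod_ker hq).
  by have := lker_neqT N0 imq; rewrite e eqxx.
have [p' hp' p'q] := ghom_factor_surj hq imq hp kqp.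
exists p'; split=> //.
  apply/vspaceP=> v; rewrite memvf; have : v \in limg p by rewrite imp memvf.
  by case/memv_imgP=> u _ ->; rewrite -p'q memv_img ?memvf.
move=> U sU; have onN n : exists v, n = q v.
  by have /memv_imgP[v _ ->] : n \in limg q; [rewrite imq memvf | exists v].
case: (maxp _ (gsubmod_preim hq sU)) => [e|Uk]; [left|right].
  apply/vspaceP=> n; rewrite memvf; have [v ->] := onN n.
  by rewrite memv_preim e memvf.
apply/subvP=> n nU; have [v en] := onN n; rewrite en memv_ker p'q -memv_ker.
by rewrite (subvP Uk) // -memv_preim -en.
Qed.

Lemma simple_soc_soc M L : simple_gmod L -> simple_soc M L -> soc_iso M L.
Proof.
move=> [L0 sL] [j [hj kj minj]]; have j0 := limg_neq0 L0 kj.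
exists (limg j); last exact: subquo_of_inj.
have minW V : gsubmod V -> (V <= limg j)%VS -> V = 0%VS \/ V = limg j.
  move=> sV Vj; case: (minj V sV) => [->|jV]; [by left|right].
  by apply/eqP; rewrite eqEsubv Vj.
split=> [W [sW W0 minW']|V]; last by apply; split=> //; exact: gsubmod_limg.
have [e|jW] := minj W sW; first by rewrite e eqxx in W0.
by case: (minW' _ (gsubmod_limg hj) jW) => [e|->] //; rewrite e eqxx in j0.
Qed.

Lemma simple_soc_giso M L L' : simple_gmod L ->
  simple_soc M L -> soc_iso M L' -> giso L L'.
Proof.
move=> sL; move=> socL [U' [lowU' minU'] isoL'].
have [U [lowU minU] isoL] := simple_soc_soc sL socL.
have eU : U = U' by apply/eqP; rewrite eqEsubv minU // minU'.
have [j [hj kj minj]] := socL.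
have [L0 Lsim] := sL.
have simj : simple_gsubmod (limg j).
  split; [exact: gsubmod_limg | exact: limg_neq0 | move=> V sV Vj].
  by case: (minj V sV) => [->|jV]; [left|right; apply/eqP; rewrite eqEsubv Vj].
have eUj : U = limg j.
  apply/eqP; rewrite eqEsubv lowU // andbT minU // => W [sW W0 minW].
  have [e|jW] := minj W sW; first by rewrite e eqxx in W0.
  by case: (minW _ (gsubmod_limg hj) jW) => [e|->] //; case: simj => _;
    rewrite e eqxx.
rewrite -eU in isoL'; apply: subquo_giso isoL isoL'.
by rewrite eUj; exact: gsubmod_limg.
Qed.

Lemma simple_soc_sub M N L (i : 'Hom(N, M)) : simple_gmod L ->
  simple_soc M L -> ghom i -> lker i = 0%VS -> fullv != 0%VS :> {vspace N} ->
  simple_soc N L.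
Proof.
move=> [L0 _] [j [hj kj minj]] hi ki N0; have iN0 := limg_neq0 N0 ki.
have [e|ji] := minj _ (gsubmod_limg hi); first by rewrite e eqxx in iN0.
have [j' hj' ij'] := ghom_lift_inj hi ki hj ji.
exists j'; split=> //.
  apply/eqP; rewrite -subv0 -kj; apply/subvP=> v.
  by rewrite !memv_ker -ij' => /eqP->; rewrite linear0.
move=> U sU; have [U0|U0] := eqVneq U 0%VS; [by left|right].
have [e|jU] := minj _ (gsubmod_img hi sU).
  by case/eqP: U0; apply/eqP;
    rewrite -(eq_limg_ker0 _ _ (f := i)) ?ki // e limg0.
rewrite -(limg_ker0 _ _ (f := i)) ?ki //;
  apply/subvP=> _ /memv_imgP[_ /memv_imgP[v _ ->] ->].
by rewrite ij' (subvP jU) // memv_img ?memvf.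
Qed.

Lemma simple_soc_r M L L' : simple_soc M L -> giso L' L -> simple_soc M L'.
Proof.
move=> [j [hj kj minj]] /gisoW[f hf [kf imf]]; exists (j \o f)%VF; split.
- exact: ghom_comp.
- apply/eqP/lker0P; have injf : injective f by apply/lker0P; rewrite kf.
  have injj : injective j by apply/lker0P; rewrite kj.
  by move=> u v; rewrite !comp_lfunE => /injj/injf.
by move=> U sU; rewrite limg_comp imf; exact: minj.
Qed.

(** An iterate of g of smallest rank is injective on its own image, which is
    therefore a complement of its kernel. *)
Lemma fitting P (g : 'End(P)) : ghom g -> exists h : 'End(P),
  [/\ ghom h, exists m, forall v, h v = iter m.+1 g v,
      (limg h :&: lker h = 0)%VS & (limg h + lker h = fullv)%VS].
Proof.
move=> hg; pose X (h : 'End(P)) := ghom h /\ exists m, forall v,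
  h v = iter m.+1 g v.
have [|h [[hh [m hm]] minh]] := @ex_minf _ X (fun h => \dim (limg h)).
  by exists g; split=> //; exists 0%N.
exists h.
have injh : (limg h :&: lker h = 0)%VS.
  apply/eqP; rewrite -dimv_eq0 -leqn0 -(leq_add2r (\dim (h @: limg h))%VS).
  rewrite limg_ker_dim add0n -limg_comp; apply: minh.
  split; first exact: ghom_comp.
  by exists (m.+1 + m)%N => v; rewrite comp_lfunE !hm -iterD addnS.
split=> //; first by exists m.
apply/eqP; rewrite eqEdim subvf dimv_disjoint_sum //=.
by rewrite addnC -{1}(capfv (lker h)) limg_ker_dim.
Qed.

Lemma retract_projective N P (j : 'Hom(N, P)) (r : 'Hom(P, N)) :
  ghom j -> ghom r -> cancel j r -> projective_gmod P -> projective_gmod N.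
Proof.
move=> hj hr jK pP M Q p f hp hf imp.
have [g hg pg] := pP M Q p (f \o r)%VF hp (ghom_comp hf hr) imp.
exists (g \o j)%VF; first exact: ghom_comp.
by rewrite comp_lfunA pg; apply/lfunP=> v; rewrite !comp_lfunE jK.
Qed.

(** The map h restricts to an automorphism of its image, whose inverse makes it
    a retraction. *)
Lemma limg_fitting_retract P N (h : 'End(P)) (j : 'Hom(N, P)) :
  ghom h -> (limg h :&: lker h = 0)%VS -> (limg h + lker h = fullv)%VS ->
  ghom j -> lker j = 0%VS -> limg j = limg h ->
  exists2 r : 'Hom(P, N), ghom r & cancel j r.
Proof.
move=> hh hI hS hj kj imj.
have [k hk jk] : exists2 k : 'Hom(P, N), ghom k & forall v, j (k v) = h v.
  by apply: ghom_lift_inj; rewrite ?imj.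
have hkj : ghom (k \o j)%VF by exact: ghom_comp.
have kkj : lker (k \o j) = 0%VS.
  apply/eqP; rewrite -subv0; apply/subvP=> v;
    rewrite memv_ker comp_lfunE => /eqP kjv.
  have : j v \in (limg h :&: lker h)%VS.
    by rewrite memv_cap -imj memv_img ?memvf //= memv_ker -jk kjv linear0.
  by rewrite hI !memv0 -memv_ker kj memv0.
have imkj : limg (k \o j) = fullv.
  by apply/eqP; rewrite eqEdim subvf limg_dim_eq ?kkj ?capv0 /=.
have [hs sK _] := ghom_inv hkj kkj imkj.
exists ((k \o j)^-1 \o k)%VF; first exact: ghom_comp.
by move=> v; rewrite comp_lfunE -[k (j v)]comp_lfunE sK.
Qed.

Lemma cover_simple_head P L :
  simple_gmod L -> projective_cover P L -> simple_head P L.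
Proof.
move=> [_ sL] [_ [p [hp imp ess]]]; exists p; split=> // U sU.
have [pU|pU] := sL _ (gsubmod_img hp sU); [right|left].
  by rewrite lkerE pU.
apply: ess => //; apply/eqP; rewrite eqEsubv subvf; apply/subvP=> v _.
have /memv_imgP[u uU pvu] : p v \in (p @: U)%VS by rewrite pU memvf.
rewrite -[v](subrK u) addrC memv_add // memv_ker linearB /= pvu subrr //.
Qed.

(** The two lifts between P and P' are surjective because the kernels of the
    covering maps are superfluous. *)
Lemma cover_unique P P' L L' : projective_cover P L -> projective_cover P' L' ->
  giso L L' -> giso P P'.
Proof.
move=> [pP [p [hp imp ess]]] [pP' [p' [hp' imp' ess']]] /gisoW[t ht [kt imt]].
have htp := ghom_comp ht hp.
have imtp : limg (t \o p) = fullv by rewrite limg_comp imp.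
have [f hf p'f] := pP _ _ p' (t \o p)%VF hp' htp imp'.
have surjf : limg f = fullv.
  apply: ess'; first exact: gsubmod_limg.
  apply/eqP; rewrite eqEsubv subvf; apply/subvP=> v _.
  have /memv_imgP[u _ pvu] : p' v \in limg (t \o p) by rewrite imtp memvf.
  rewrite -[v](subrK (f u)) addrC memv_add ?memv_img ?memvf //.
  by rewrite memv_ker linearB /= pvu -p'f comp_lfunE subrr.
have [g hg fg] := pP' _ _ f \1%VF hf (ghom_id P') surjf.
have gK : cancel g f by move=> v; rewrite -comp_lfunE fg id_lfunE.
have surjg : limg g = fullv.
  apply: ess; first exact: gsubmod_limg.
  apply/eqP; rewrite eqEsubv subvf; apply/subvP=> v _.
  rewrite -[v](subrK (g (f v))) addrC memv_add ?memv_img ?memvf // memv_ker.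
  rewrite -memv0 -kt memv_ker -[t _]comp_lfunE -p'f comp_lfunE linearB /= gK
    subrr.
  by rewrite linear0.
by apply/giso_sym/(giso_bij hg _ surjg)/eqP/lker0P; exact: can_inj gK.
Qed.

Lemma simple_head_indecomposable P L (U V : {vspace P}) : simple_gmod L ->
  simple_head P L -> gsubmod U -> gsubmod V -> (U + V = fullv)%VS ->
  U = fullv \/ V = fullv.
Proof.
move=> [L0 _] [p [_ imp maxp]] sU sV UV.
have [|Uk] := maxp U sU; first by left.
have [|Vk] := maxp V sV; first by right.
have := lker_neqT L0 imp; rewrite eqEsubv subvf -UV.
by rewrite subv_add Uk Vk.
Qed.

Definition injective_gmod Q : Prop :=
  forall M N (j : 'Hom(M, N)) (f : 'Hom(M, Q)),
    ghom j -> ghom f -> lker j = 0%VS ->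
    exists2 g : 'Hom(N, Q), ghom g & (g \o j)%VF = f.

Lemma retract_injective N Q (j : 'Hom(N, Q)) (r : 'Hom(Q, N)) :
  ghom j -> ghom r -> cancel j r -> injective_gmod Q -> injective_gmod N.
Proof.
move=> hj hr jK iQ M M' i f hi hf ki.
have [g hg gi] := iQ M M' i (j \o f)%VF hi (ghom_comp hj hf) ki.
exists (r \o g)%VF; first exact: ghom_comp.
by rewrite -comp_lfunA gi; apply/lfunP=> v; rewrite !comp_lfunE jK.
Qed.

(** If X and Y are disjoint, the projection of X + Y onto X extends to an
    endomorphism, which by Fitting's lemma splits P into a part containing X
    and a part containing Y. *)
Lemma injective_uniform P L (X Y : {vspace P}) : simple_gmod L ->
  simple_head P L -> injective_gmod P -> gsubmod X -> gsubmod Y ->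
  (X :&: Y = 0)%VS -> X = 0%VS \/ Y = 0%VS.
Proof.
move=> sL hdP iP sX sY XY.
have [N [j [hj kj imj]]] := gsub_exists (gsubmodD sX sY).
pose pr := daddv_pi X Y.
have prX x : x \in X -> pr x = x by exact: daddv_pi_id.
have prY y : y \in Y -> pr y = 0.
  move=> yY; have := daddv_pi_add XY (subvP (addvSr X Y) _ yY).
  rewrite (daddv_pi_id _ yY); last by rewrite capvC.
  by move/eqP; rewrite -subr_eq0 addrK => /eqP.
have prE x y : x \in X -> y \in Y -> pr (x + y) = x.
  by move=> xX yY; rewrite linearD /= prX // prY // addr0.
have jXY n : exists x y, [/\ x \in X, y \in Y & j n = x + y].
  have : j n \in (X + Y)%VS by rewrite -imj memv_img ?memvf.
  by case/memv_addP=> x xX [y yY e]; exists x, y.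
have hprj : ghom (pr \o j)%VF.
  have [ja _] := hj; apply: ghomP => [a|i] n; rewrite !comp_lfunE.
    rewrite ja; have [x [y [xX yY ->]]] := jXY n.
    by rewrite linearD !prE // gsubmod_act.
  rewrite (ghom_gcomp _ _ hj); have [x [y [xX yY ->]]] := jXY n.
  by rewrite linearD !prE // gsubmod_gcomp.
have [g hg gj] := iP _ _ j (pr \o j)%VF hj hprj kj.
have gE v : v \in (X + Y)%VS -> g v = pr v.
  by rewrite -imj => /memv_imgP[n _ ->]; rewrite -comp_lfunE gj comp_lfunE.
(* Being an iterate of g, h still is the identity on X and vanishes on Y. *)
have [h [hh [m hm] hI hS]] := fitting hg.
have gX x : x \in X -> g x = x by move=> xX;
  rewrite gE ?prX // (subvP (addvSl X Y)).
have hX x : x \in X -> h x = x.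
  by move=> xX; rewrite hm; elim: m {hm} => [|m IHm]; rewrite iterS ?IHm gX.
have hY y : y \in Y -> h y = 0.
  move=> yY; rewrite hm iterSr gE ?prY ?(subvP (addvSr X Y)) //.
  by elim: m {hm} => //= m ->; rewrite linear0.
have XI : (X <= limg h)%VS.
  by apply/subvP=> x xX; rewrite -(hX x) // memv_img ?memvf.
have YK : (Y <= lker h)%VS.
  by apply/subvP=> y yY; rewrite memv_ker hY.
have [e|e] := simple_head_indecomposable sL hdP (gsubmod_limg hh) (gsubmod_ker
  hh) hS.
  by right; apply/eqP; rewrite -subv0 -hI e capfv.
by left; apply/eqP; rewrite -subv0 -hI e capvf.
Qed.

(** A graded submodule of smallest positive dimension meets every nonzero
    one, hence is contained in it. *)
Lemma uniform_simple_soc P : fullv != 0%VS :> {vspace P} ->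
  (forall X Y : {vspace P}, gsubmod X -> gsubmod Y -> (X :&: Y = 0)%VS ->
     X = 0%VS \/ Y = 0%VS) ->
  exists2 S, simple_gmod S & simple_soc P S.
Proof.
move=> P0 uni; pose R (U : {vspace P}) := gsubmod U /\ U != 0%VS.
have [|U [[sU U0] minU]] := @ex_minf _ R (fun U => \dim U).
  by exists fullv; split=> //; exact: gsubmodT.
have minU' V : gsubmod V -> V = 0%VS \/ (U <= V)%VS.
  move=> sV; have [|VU0] := eqVneq (U :&: V)%VS 0%VS.
    by case/(uni _ _ sU sV) => e; [rewrite e eqxx in U0 | left].
  right; apply/capv_idPl/eqP; rewrite eqEdim capvSl minU //.
  by split=> //; exact: gsubmodI.
have [S [j [hj kj imj]]] := gsub_exists sU.
exists S; last by exists j; split=> // V sV; rewrite imj; exact: minU'.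
split; first by rewrite -dimv_eq0 -(limg_dim_eq (f := j)) ?kj ?capv0 // imj
  dimv_eq0.
have injj : injective j by apply/lker0P; rewrite kj.
move=> V sV; have [e|jV] := minU' _ (gsubmod_img hj sV); [left|right].
  by apply/eqP; rewrite -(eq_limg_ker0 _ _ (f := j)) ?kj // e limg0.
by apply/eqP; rewrite eqEsubv subvf -(limg_ker0 _ _ (f := j)) ?kj // imj.
Qed.

(** An extension of the inclusion of the socle is injective, since its kernel
    would otherwise contain the socle; such maps exist in both directions. *)
Lemma injective_hull_unique P P' S : simple_gmod S ->
  injective_gmod P -> injective_gmod P' -> simple_soc P S -> simple_soc P' S ->
  giso P P'.
Proof.
move=> [S0 _] iP iP' [j [hj kj minj]] [j' [hj' kj' minj']].
have emb Q Q' (i : 'Hom(S, Q)) (i' : 'Hom(S, Q')) : injective_gmod Q' ->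
    ghom i -> lker i = 0%VS -> ghom i' -> lker i' = 0%VS ->
    (forall U : {vspace Q}, gsubmod U -> U = 0%VS \/ (limg i <= U)%VS) ->
    exists2 g : 'Hom(Q, Q'), ghom g & lker g = 0%VS.
  move=> iQ' hi ki hi' ki' mini; have [g hg gi] := iQ' _ _ i i' hi hi' ki.
  exists g => //; case: (mini _ (gsubmod_ker hg)) => // sik; case/eqP: S0.
  apply/eqP; rewrite -subv0 -ki'; apply/subvP=> v _.
  by rewrite memv_ker -gi comp_lfunE -memv_ker (subvP sik) ?memv_img ?memvf.
have [g hg kg] := emb _ _ j j' iP' hj kj hj' kj' minj.
have [g' hg' kg'] := emb _ _ j' j iP hj' kj' hj kj minj'.
have dimg : \dim (limg g) = \dim (fullv : {vspace P}).
  by apply: limg_dim_eq; rewrite kg capv0.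
have dimg' : \dim (limg g') = \dim (fullv : {vspace P'}).
  by apply: limg_dim_eq; rewrite kg' capv0.
apply: giso_bij hg kg _; apply/eqP; rewrite eqEdim subvf dimg -dimg'.
exact: dimvS (subvf _).
Qed.

End HeadsAndSocles.

(** * Projective covers *)

Section Covers.
Variables (K : fieldType) (B : falgType K) (gB : int -> {vspace B}).
Hypothesis hB : graded_algebra gB.
Implicit Types M N P Q L S : gmod gB.

Lemma simple_cyclic L : simple_gmod L ->
  exists e (f : 'Hom(greg hB e, L)), ghom f /\ limg f = fullv.
Proof.
move=> sL; have [e [x [xe x0]]] := homogeneous_vector (proj1 sL).
exists e, (greg_map hB e x).
have hx : ghom (greg_map hB e x) by exact: greg_map_ghom.
by split=> //; apply: (@simple_surj _ _ _ (greg hB e) L (greg_map hB e x) (1 :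
  B) sL hx); rewrite greg_mapE gact1.
Qed.

(** A projective module of smallest dimension among those mapping onto L is
    its projective cover: a proper submodule that still maps onto L yields an
    endomorphism over L with image in it, and by Fitting's lemma a smaller
    projective summand mapping onto L. *)
Lemma projective_cover_exists L :
  simple_gmod L -> exists P, projective_cover P L.
Proof.
move=> sL; pose X (Pp : sigT (fun P : gmod gB => 'Hom(P, L))) :=
  [/\ projective_gmod (projT1 Pp), ghom (projT2 Pp) & limg (projT2 Pp) = fullv].
have [|[P p] /= [[/= pP hp imp] minP]] :=
    @ex_minf _ X (fun Pp => \dim (fullv : {vspace projT1 Pp})).
  have [e [f [hf imf]]] := simple_cyclic sL.
  by exists (existT (fun P : gmod gB => 'Hom(P, L)) (greg hB e) f); split=> //;
    exact: greg_projective.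
exists P; split=> //; exists p; split=> // U sU UpT.
have [N [i [hi ki imi]]] := gsub_exists sU.
have impi : limg (p \o i) = fullv.
  apply/vspaceP=> v; rewrite memvf limg_comp imi.
  have /memv_imgP[w _ ->] : v \in limg p by rewrite imp memvf.
  have /memv_addP[u uU [k kk ->]] : w \in (U + lker p)%VS by rewrite UpT memvf.
  by move: kk; rewrite linearD memv_ker /= => /eqP->; rewrite addr0 memv_img.
(* The lift t of p through U gives an endomorphism g over L with image in U. *)
have [t ht pit] := pP _ _ (p \o i)%VF p (ghom_comp hp hi) hp impi.
pose g := (i \o t)%VF; have hg : ghom g by exact: ghom_comp.
have pg v : p (g v) = p v by rewrite -[in RHS]pit !comp_lfunE.
have [h [hh [m hm] hI hS]] := fitting hg.
have ph v : p (h v) = p v by rewrite hm; elim: m.+1 => //= k; rewrite pg.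
have hU : (limg h <= U)%VS.
  apply/subvP=> _ /memv_imgP[v _ ->]; rewrite hm iterS comp_lfunE -imi.
  by rewrite memv_img ?memvf.
have [N' [j [hj kj imj]]] := gsub_exists (gsubmod_limg hh).
have [r hr jK] := limg_fitting_retract hh hI hS hj kj imj.
have := minP (existT (fun P : gmod gB => 'Hom(P, L)) N' (p \o j)%VF) => /=;
  rewrite -(limg_dim_eq (f := j)) ?kj ?capv0 //.
rewrite imj => leP; apply/eqP; rewrite eqEdim subvf;
  apply: leq_trans (dimvS hU).
apply: leP; split; [exact: retract_projective hj hr jK pP | exact: ghom_comp |].
apply/vspaceP=> v; rewrite memvf limg_comp imj.
have /memv_imgP[w _ ->] : v \in limg p by rewrite imp memvf.
by rewrite -ph memv_img // memv_img ?memvf.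
Qed.

(** The shift of B that maps onto L also maps onto its projective cover, and
    this surjection splits. *)
Lemma cover_retract P L : simple_gmod L -> projective_cover P L ->
  exists e (i : 'Hom(P, greg hB e)) (r : 'Hom(greg hB e, P)),
    [/\ ghom i, ghom r & cancel i r].
Proof.
move=> sL [pP [p [hp imp ess]]]; have [e [f [hf imf]]] := simple_cyclic sL.
have [q hq pq] := greg_projective hp hf imp.
have imq : limg q = fullv.
  apply: ess; first exact: gsubmod_limg.
  apply/eqP; rewrite eqEsubv subvf; apply/subvP=> v _.
  have /memv_imgP[u _ pvu] : p v \in limg f by rewrite imf memvf.
  rewrite -[v](subrK (q u)) addrC memv_add ?memv_img ?memvf //.
  by rewrite memv_ker linearB /= pvu -pq comp_lfunE subrr.
have [i hi qi] := pP _ _ q \1%VF hq (ghom_id P) imq.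
by exists e, i, q; split=> // v; rewrite -comp_lfunE qi id_lfunE.
Qed.

End Covers.

(** * Self-injectivity in the graded category *)

Section UngradedModules.
Variables (K : fieldType) (B : falgType K) (gB : int -> {vspace B}).
Hypothesis hB : graded_algebra gB.
Implicit Types M N : gmod gB.

(** The module underlying M with B itself as the ring of scalars, the kind
    of module over which self-injectivity quantifies. *)
Definition ungraded M : Type := M.

HB.instance Definition _ M := GRing.Zmodule.copy (ungraded M) M.

Fact ungraded_actA M (a b : B) (v : ungraded M) :
  gact M a (gact M b v) = gact M (a * b) v.
Proof. by rewrite gactM. Qed.

Fact ungraded_actDr M : right_distributive (gact M :
  B -> ungraded M -> ungraded M) +%R.
Proof. by move=> a u v; exact: (linearD (gact M a)). Qed.

Fact ungraded_actDl M (v : ungraded M) : {morph (gact M)^~ v : a b / a + b}.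
Proof. by move=> a b; exact: gactDl. Qed.

HB.instance Definition _ M := GRing.Zmodule_isLmodule.Build B (ungraded M)
  (@ungraded_actA M) (gact1 (g := M)) (@ungraded_actDr M) (@ungraded_actDl M).

Definition ungraded_map M N (f : 'Hom(M, N)) (hf : ghom f) :
  ungraded M -> ungraded N := f.

Fact ungraded_map_linear M N (f : 'Hom(M, N)) (hf : ghom f) :
  linear (ungraded_map hf).
Proof.
move=> a u v; rewrite /ungraded_map; have [fa _] := hf.
apply: (etrans (linearD f (gact M a u) v)).
by congr (_ + _); exact: fa.
Qed.

HB.instance Definition _ M N (f : 'Hom(M, N)) (hf : ghom f) :=
  GRing.isLinear.Build B (ungraded M) (ungraded N) _ (ungraded_map hf)
    (ungraded_map_linear hf).

Definition ungraded_reg M e (f : 'Hom(M, greg hB e)) (hf : ghom f) :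
  ungraded M -> B^o := f.

Fact ungraded_reg_linear M e (f : 'Hom(M, greg hB e)) (hf : ghom f) :
  linear (ungraded_reg hf).
Proof. exact: (ungraded_map_linear hf). Qed.

HB.instance Definition _ M e (f : 'Hom(M, greg hB e)) (hf : ghom f) :=
  GRing.isLinear.Build B (ungraded M) B^o _ (ungraded_reg hf)
    (ungraded_reg_linear hf).

Lemma homogeneous_ind (P : B -> Prop) :
  (forall a b, P a -> P b -> P (a + b)) -> P 0 ->
  (forall i a, a \in gB i -> P a) -> forall a, P a.
Proof.
move=> PD P0 Pg a; rewrite -(@gcomp_sum _ _ _ (greg0 hB) a).
by apply: big_ind => // i _; exact: Pg (gcomp_in i (a : greg0 hB)).
Qed.

(** A linear extension of a homomorphism of graded modules can be replaced by
    its component of degree 0, which is a homomorphism of graded modules. *)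
Lemma self_injective_greg e : self_injective B -> injective_gmod (greg hB e).
Proof.
move=> iB M N j f hj hf kj.
have injj : injective (ungraded_map hj) by apply/lker0P; rewrite kj.
have [g gj] := iB _ _ (ungraded_map hj) (ungraded_reg hf) injj.
have gD (u v : N) : g ((u + v) : N) = g u + g v by exact: raddfD.
have ga a (v : N) : g (gact N a v) = a * g v by exact: (linearZ_LR g a v).
have gk (k : K) (v : N) : g (k *: v) = k *: (g v : B).
  by rewrite -gact_scalar ga mulr_algl.
(* On each homogeneous component of N, h is the part of g of the same degree. *)
pose h (v : N) : greg hB e :=
  \sum_(i <- gsupp N) gcomp (greg hB e) i (g (gcomp N i v) : B).
have h_lin : linear h.
  move=> k u v; rewrite /h scaler_sumr -big_split; apply: eq_bigr => i _.
  by rewrite linearP gD gk linearP.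
have hE i v : v \in ggr N i -> h v = gcomp (greg hB e) i (g v : B).
  move=> vi; rewrite /h; have [si|si] := boolP (i \in gsupp N); last first.
    rewrite (ggr_out si vi) big1 => [|k _];
      last by rewrite linear0 raddf0 linear0.
    by rewrite raddf0 linear0.
  rewrite (big_rem i) //= big1_seq ?addr0 => [|k /andP[_]];
    first by rewrite gcomp_id.
  rewrite mem_rem_uniq ?gsupp_uniq // inE => /andP[ki _].
  by rewrite (gcomp_other vi) 1?eq_sym // raddf0 linear0.
pose hl : {linear N -> greg hB e} := HB.pack h (GRing.isLinear.Build _ _ _ _ h
  h_lin).
have hlE v : linfun hl v = h v by rewrite lfunE.
have hsum v : h v = \sum_(i <- gsupp N) h (gcomp N i v).
  by apply: eq_bigr => i _; rewrite (hE i) ?gcomp_in.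
have ha a v : h (gact N a v) = a * h v.
  have h0 : h 0 = 0 by rewrite -hlE linear0.
  have hD x y : h (x + y) = h x + h y by rewrite -!hlE linearD.
  move: a; apply: homogeneous_ind => [a b ea eb| |i a ai].
  - by rewrite gactDl hD ea eb mulrDl.
  - by rewrite gact0l h0 mul0r.
  rewrite -[in LHS](gcomp_sum v) [h v]hsum mulr_sumr linear_sum /=.
  rewrite (big_morph h hD h0); apply: eq_bigr => k _.
  rewrite (hE (i + k)) ?gact_graded ?gcomp_in // (hE k) ?gcomp_in // ga.
  exact: (@gcomp_act _ _ _ (greg hB e) i k a _ ai).
exists (linfun hl).
  split=> [a v|i v vi]; rewrite ?hlE; first exact: ha.
  by rewrite (hE i) // gcomp_in.
have [_ jg] := hj; have [_ fg] := hf.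
have key i w : w \in ggr M i -> h (j w) = f w.
  move=> wi; rewrite (hE i (j w) (jg _ _ wi));
    have -> : g (j w) = f w by exact: (gj w).
  exact: gcomp_id (fg _ _ wi).
apply/lfunP=> v; rewrite comp_lfunE -(gcomp_sum v) !linear_sum.
by apply: eq_bigr => i _; rewrite /= hlE; exact: key (gcomp_in i v).
Qed.

End UngradedModules.

(** * Duality *)

Section Functionals.
Variable K : fieldType.
Implicit Types V W : vectType K.

Lemma dim_functionals V : \dim {: 'Hom(V, K^o)} = \dim {: V}.
Proof. by rewrite !dimvf /dim /= muln1. Qed.

Lemma functional_separates V (v : V) :
  (forall g : 'Hom(V, K^o), g v = 0) -> v = 0.
Proof.
move=> gv; rewrite (coord_vbasis (memvf v)) big1 // => i _.
have /= := gv (linfun (coord (vbasis fullv) i : V -> K^o)).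
by rewrite lfunE /= => ->; rewrite scale0r.
Qed.

Definition precompose V W (f : 'Hom(V, W)) (g : 'Hom(W, K^o)) : 'Hom(V, K^o) :=
  (g \o f)%VF.

Fact precompose_linear V W (f : 'Hom(V, W)) : linear (precompose f).
Proof. by move=> k g h; rewrite /precompose comp_lfunDl comp_lfunZl. Qed.

HB.instance Definition _ V W (f : 'Hom(V, W)) := GRing.isLinear.Build K
  'Hom(W, K^o) 'Hom(V, K^o) _ (precompose f) (precompose_linear f).

Definition evaluation V (v : V) (g : 'Hom(V, K^o)) : K^o := g v.

Fact evaluation_linear V (v : V) : linear (evaluation v).
Proof. by move=> k g h; rewrite /evaluation add_lfunE scale_lfunE. Qed.

HB.instance Definition _ V (v : V) := GRing.isLinear.Build K
  'Hom(V, K^o) K^o _ (evaluation v) (evaluation_linear v).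

Definition bidual V (v : V) : 'Hom('Hom(V, K^o), K^o) := linfun (evaluation v).

Lemma bidualE V (v : V) g : bidual v g = g v.
Proof. exact: lfunE. Qed.

Fact bidual_linear V : linear (@bidual V).
Proof.
move=> k u v; apply/lfunP=> g.
by rewrite add_lfunE scale_lfunE !bidualE linearP.
Qed.

HB.instance Definition _ V := GRing.isLinear.Build K
  V 'Hom('Hom(V, K^o), K^o) _ (@bidual V) (@bidual_linear V).

End Functionals.

Section Duality.
Variables (K : fieldType) (B B' : falgType K).
Variables (gB : int -> {vspace B}) (gB' : int -> {vspace B'}).
Variables (phi : B' -> B) (phiP : graded_antimorphism gB gB' phi).
Implicit Types M N Q S : gmod gB.

Definition dual_map M N (f : 'Hom(M, N)) :
  'Hom(dualmod phiP N, dualmod phiP M) :=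
  linfun (precompose f).

Lemma dual_mapE M N (f : 'Hom(M, N)) (g : 'Hom(N, K^o)) v :
  (dual_map f g : 'Hom(M, K^o)) v = g (f v).
Proof. by rewrite lfunE /= comp_lfunE. Qed.

Lemma dual_map_ghom M N (f : 'Hom(M, N)) : ghom f -> ghom (dual_map f).
Proof.
move=> [fa fg]; split=> [a g|i g /dual_grP gi].
  by apply/lfunP=> v; rewrite dual_mapE /= !dual_actE dual_mapE fa.
by apply/dual_grP=> j v ji vj; rewrite dual_mapE (gi j) // fg.
Qed.

Lemma dual_map_surj M N (f : 'Hom(M, N)) :
  lker f = 0%VS -> limg (dual_map f) = fullv.
Proof.
move=> kf; apply/vspaceP=> g; rewrite memvf; apply/memv_imgP.
exists ((g : 'Hom(M, K^o)) \o f^-1)%VF; first exact: memvf.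
by apply/lfunP=> v; rewrite dual_mapE comp_lfunE lker0_lfunK // kf.
Qed.

Lemma dual_map_inj M N (f : 'Hom(M, N)) :
  limg f = fullv -> lker (dual_map f) = 0%VS.
Proof.
move=> imf; apply/eqP; rewrite -subv0; apply/subvP=> g; rewrite memv_ker memv0.
move=> /eqP fg; apply/eqP/lfunP=> n; rewrite zero_lfunE.
have /memv_imgP[v _ ->] : n \in limg f by rewrite imf memvf.
by rewrite -dual_mapE fg zero_lfunE.
Qed.

Lemma dualmod_neq0 M : fullv != 0%VS :> {vspace M} ->
  fullv != 0%VS :> {vspace dualmod phiP M}.
Proof. by rewrite -!dimv_eq0 [X in _ -> X != _]dim_functionals. Qed.

Variables (psi : B -> B') (psiP : graded_antimorphism gB' gB psi).
Hypothesis psiK : cancel psi phi.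

Definition bidual_map M : 'Hom(M, dualmod psiP (dualmod phiP M)) :=
  linfun (@bidual K M).

Lemma bidual_mapE M (v : M) (g : 'Hom(M, K^o)) :
  (bidual_map M v : 'Hom('Hom(M, K^o), K^o)) g = g v.
Proof. by rewrite lfunE bidualE. Qed.

Lemma bidual_map_ghom M : ghom (bidual_map M).
Proof.
split=> [a v|i v vi].
  apply/lfunP=> g.
  apply: etrans (bidual_mapE _ _) _; apply: esym.
  apply: etrans (@dual_actE _ _ _ _ psi (dualmod phiP M) a _ g) _.
  by apply: etrans (bidual_mapE _ _) _; rewrite /= dual_actE psiK.
by apply/dual_grP=> j g ji /dual_grP gj; rewrite bidual_mapE (gj i) // eq_sym.
Qed.

Lemma bidual_map_bij M : lker (bidual_map M) = 0%VS /\ limg (bidual_map M)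
  = fullv.
Proof.
have k0 : lker (bidual_map M) = 0%VS.
  apply/eqP; rewrite -subv0; apply/subvP=> v; rewrite memv_ker memv0 => /eqP bv.
  apply/eqP/functional_separates => g; by rewrite -bidual_mapE bv zero_lfunE.
split=> //; apply/eqP; rewrite eqEdim subvf limg_dim_eq ?k0 ?capv0 //=.
by rewrite [X in (X <= _)%N]dim_functionals [X in (X <= _)%N]dim_functionals.
Qed.

Lemma bidual_inverse M : exists2 e : 'Hom(dualmod psiP (dualmod phiP M), M),
  ghom e & forall (F : 'Hom('Hom(M, K^o), K^o)) (g : 'Hom(M, K^o)),
    g (e F) = F g.
Proof.
have [kb imb] := bidual_map_bij M.
have [he _ eK] := ghom_inv (bidual_map_ghom M) kb imb.
exists (bidual_map M)^-1%VF => // F g.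
by rewrite -bidual_mapE eK.
Qed.

(** Dualizing the inclusion of U shows that U is everything as soon as no
    nonzero vector is annihilated by U. *)
Lemma annihilator M (U : {vspace dualmod phiP M}) : gsubmod U ->
  exists Z : {vspace M}, [/\ gsubmod Z,
    forall (g : 'Hom(M, K^o)) v, g \in U -> v \in Z -> g v = 0
    & Z = 0%VS -> U = fullv].
Proof.
move=> sU; have [N [i [hi ki imi]]] := gsub_exists sU.
pose k : 'Hom(M, 'Hom(N, K^o)) :=
  (linfun (precompose i) \o linfun (@bidual K M))%VF.
have kE v n : (k v : 'Hom(N, K^o)) n = (i n : 'Hom(M, K^o)) v.
  by rewrite /k comp_lfunE !lfunE; exact: (bidualE v (i n)).
have inU (g : 'Hom(M, K^o)) : g \in U -> exists n, g = i n.
  by rewrite -imi => /memv_imgP[n _ ->]; exists n.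
have Ui n : i n \in U by rewrite -imi memv_img ?memvf.
have kP v : reflect (forall g : 'Hom(M, K^o),
  g \in U -> g v = 0) (v \in lker k).
  rewrite memv_ker; apply: (iffP eqP) => [kv g /inU[n ->]|Uv].
    by rewrite -kE kv zero_lfunE.
  by apply/lfunP=> n; rewrite kE zero_lfunE Uv.
exists (lker k); split.
- apply: gsubmodP => [a|d] v /kP Uv; apply/kP=> g gU.
    have := Uv _ (gsubmod_act (psi a) sU gU); rewrite /= dual_actE psiK //.
  have := Uv _ (gsubmod_gcomp d sU gU).
  have /dual_grP gd := gcomp_in (M := dualmod phiP M) d g.
  rewrite -{1}(gcomp_sum v) linear_sum /=.
  have g0 e : e != d -> (gcomp (dualmod phiP M) e g : 'Hom(M,
    K^o)) (gcomp M d v) = 0.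
    move=> ed; have /dual_grP ge := gcomp_in (M := dualmod phiP M) e g.
    by apply: (ge d); [rewrite eq_sym | exact: gcomp_in].
  have gE : g (gcomp M d v) = (gcomp (dualmod phiP M) d g : 'Hom(M,
    K^o)) (gcomp M d v).
    rewrite -[in LHS](@gcomp_sum _ _ _ (dualmod phiP M) g) sum_lfunE.
    have [sd|sd] := boolP (d \in gsupp (dualmod phiP M)).
      rewrite (big_rem d) //= big1_seq ?addr0 // => e /andP[_].
      by rewrite mem_rem_uniq ?gsupp_uniq // inE => /andP[ed _]; exact: g0.
    rewrite (ggr_out sd (gcomp_in d (g : dualmod phiP M))) zero_lfunE big1_seq
      // => e.
    by move=> /andP[_ se]; apply: g0; apply: contraNneq sd => <-.
  rewrite gE => <-; have [sd|sd] := boolP (d \in gsupp M).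
    rewrite (big_rem d) //= big1_seq ?addr0 // => e /andP[_].
    rewrite mem_rem_uniq ?gsupp_uniq // inE => /andP[ed _].
    exact: gd ed (gcomp_in e v).
  rewrite (ggr_out sd (gcomp_in d v)) linear0 big1_seq // => e /andP[_ se].
  by apply: gd (gcomp_in e v); apply: contraNneq sd => <-.
- by move=> g v gU /kP; exact.
move=> k0; apply/eqP; rewrite eqEdim subvf [X in (X <= _)%N]dim_functionals.
rewrite -imi (limg_dim_eq (f := i)) ?ki ?capv0 //= -(dim_functionals N).
by rewrite -(limg_dim_eq (f := k) (U := fullv)) ?k0 ?capv0 // dimvS ?subvf.
Qed.

(** A proper graded submodule U of the dual of Q annihilates a nonzero graded
    submodule of Q, hence the socle; so U is contained in the kernel, which is
    not everything. *)
Lemma dual_cover_ess Q S (j : 'Hom(S, Q)) : simple_gmod S -> lker j = 0%VS ->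
  (forall U : {vspace Q}, gsubmod U -> U = 0%VS \/ (limg j <= U)%VS) ->
  forall U : {vspace dualmod phiP Q}, gsubmod U ->
    (U + lker (dual_map j))%VS = fullv -> U = fullv.
Proof.
move=> [S0 _] kj minj U sU; have [Z [sZ UZ Z0]] := annihilator sU.
have [/Z0 //|jZ] := minj Z sZ; have Uk : (U <= lker (dual_map j))%VS.
  apply/subvP=> g gU; rewrite memv_ker; apply/eqP/lfunP=> v.
  by rewrite dual_mapE zero_lfunE UZ // (subvP jZ) ?memv_img ?memvf.
move/addv_idPr: Uk => -> e;
  have := lker_neqT (dualmod_neq0 S0) (dual_map_surj kj).
by rewrite e eqxx.
Qed.


End Duality.

Section DualProjective.
Variables (K : fieldType) (B B' : falgType K).
Variables (gB : int -> {vspace B}) (gB' : int -> {vspace B'}).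
Variables (phi : B' -> B) (phiP : graded_antimorphism gB gB' phi).
Variables (psi : B -> B') (psiP : graded_antimorphism gB' gB psi).
Hypotheses (psiK : cancel psi phi) (phiK : cancel phi psi).

(** A lifting problem for the dual of Q is the transpose of an extension
    problem for Q. *)
Lemma dual_projective (Q : gmod gB) :
  injective_gmod Q -> projective_gmod (dualmod phiP Q).
Proof.
move=> iQ M N p f hp hf imp.
have [eQ heQ eQE] := bidual_inverse phiP psiP psiK Q.
have [eM heM eME] := bidual_inverse psiP phiP phiK M.
have [g hg gp] := iQ _ _ (dual_map psiP p) (eQ \o dual_map psiP f)%VF
  (dual_map_ghom psiP hp) (ghom_comp heQ (dual_map_ghom psiP hf)) (dual_map_inj
    psiP imp).
exists (eM \o dual_map phiP g)%VF;
  first exact: ghom_comp heM (dual_map_ghom phiP hg).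
apply/lfunP=> q; apply/eqP; rewrite -subr_eq0; apply/eqP.
apply: functional_separates => n; rewrite linearB /= !comp_lfunE.
apply/eqP; rewrite subr_eq0; apply/eqP.
have gpn : g (dual_map psiP p n) = eQ (dual_map psiP f n).
  by rewrite -[LHS]comp_lfunE gp comp_lfunE.
apply: etrans (esym (dual_mapE psiP p n _)) _; apply: etrans (eME _ _) _.
apply: etrans (dual_mapE phiP g q _) _; rewrite gpn.
by apply: etrans (eQE _ _) _; exact: (dual_mapE psiP f n q).
Qed.

Lemma dual_cover (Q S : gmod gB) : simple_gmod S ->
  injective_gmod Q -> simple_soc Q S ->
  projective_cover (dualmod phiP Q) (dualmod phiP S).
Proof.
move=> sS iQ [i [hi ki mini]]; split; first exact: dual_projective.
exists (dual_map phiP i); split; first exact: dual_map_ghom.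
  exact: dual_map_surj.
exact: (dual_cover_ess (psi := psi) psiK sS ki mini).
Qed.

End DualProjective.

(** * Triangular decompositions and the opposite algebra *)

Section WeakTriangular.
Variables (K : fieldType) (D : triple K).
Local Notation A := (talg D).
Local Notation gA := (tgr D).
Local Notation Am := (tneg D).
Local Notation T := (tmid D).
Local Notation Ap := (tpos D).

(** What the proof uses of a triangular decomposition.  The tensor
    factorization is replaced by surjectivity of the multiplication together
    with the dimension count; in this form the conditions visibly pass to the
    opposite algebra. *)
Definition weak_triangular : Prop :=
  [/\ [/\ graded_subalgebra gA Am, graded_subalgebra gA T
        & graded_subalgebra gA Ap],
      (Am * T * Ap)%VS = fullv /\ \dim {: A} = (\dim Am * \dim T * \dim Ap)%N,
      [/\ (T <= gA 0)%VS, forall i, i < 0 -> (Ap :&: gA i)%VS = 0%VS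
        & forall i, 0 < i -> (Am :&: gA i)%VS = 0%VS],
      (Am :&: gA 0)%VS = 1%VS /\ (Ap :&: gA 0)%VS = 1%VS
    & (Ap * T)%VS = (T * Ap)%VS /\ (Am * T)%VS = (T * Am)%VS].

Lemma triangular_weak : triangular_decomposition D -> weak_triangular.
Proof.
case=> sub bas deg one [pT mT _]; split=> //; split.
  rewrite -(span_basis bas); apply/eqP; rewrite eqEsubv; apply/andP; split.
    apply/prodvP=> u y uU yP; rewrite (span_basis bas); exact: memvf.
  apply/span_subvP=> _ /allpairsP[[u y] /= [/allpairsP[[a t] /= [aA tT ->]] yP
    ->]].
  by rewrite !memv_mul // vbasis_mem.
have := size_basis (X := in_tuple _) bas; rewrite /= !size_allpairs !size_tuple.
exact.
Qed.

End WeakTriangular.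

Section Converse.
Variables (K : fieldType) (D : triple K).
Local Notation A := (talg D).
Local Notation gA := (tgr D).
Hypothesis hA : graded_algebra gA.

Lemma prodv_converse (U V : {vspace A}) :
  (converse_vspace U * converse_vspace V)%VS = converse_vspace (V * U)%VS.
Proof.
apply/eqP; rewrite eqEsubv; apply/andP; split.
  by apply/prodvP=> u v uU vV; exact: (memv_mul (K := K) (aT := A)).
pose W : {vspace A} := (converse_vspace U * converse_vspace V)%VS.
suff VUW : (V * U <= W)%VS by exact: VUW.
by apply/prodvP=> v u vV uU;
  exact: (@memv_mul K A^c (converse_vspace U) (converse_vspace V) u v).
Qed.

Lemma converse_graded : graded_algebra (tgr (converse_triple D)).
Proof.
have [[[s sP] indep] one mul] := hA; split.
- split.
    exists [seq - i | i <- s]; rewrite big_map; apply/eqP;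
      rewrite -[RHS](eqP sP).
    by apply: eq_bigr => i _; rewrite /= /opp_grading opprK.
  move=> r u ur ug u0 i ir.
  have := indep [seq - i | i <- r] (fun j => u (- j)).
  rewrite map_inj_uniq ?big_map; last exact: oppr_inj.
  rewrite (eq_bigr u) => [|j _]; last by rewrite opprK.
  move/(_ ur _ u0 (- i)); rewrite opprK; apply; last exact: map_f.
  by move=> j; have := ug (- j); rewrite /= /opp_grading opprK.
- by rewrite /= /opp_grading oppr0.
move=> i j; rewrite /= /opp_grading prodv_converse opprD addrC.
exact: mul.
Qed.

Lemma homogeneous_converse (U : {aspace A}) :
  graded_subalgebra gA U -> graded_subalgebra (tgr (converse_triple D))
    (converse_aspace U).
Proof.
move=> [U1 [s sU]]; split=> //; exists [seq - i | i <- s]; rewrite big_map.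
rewrite [LHS]sU; apply: eq_bigr => i _; rewrite /= /opp_grading opprK //.
Qed.

Lemma converse_weak : weak_triangular D -> weak_triangular (converse_triple D).
Proof.
move=> [[gm gt gp] [full dm] [t0 p0 m0] [m1 p1] [pT mT]]; split.
- by split; exact: homogeneous_converse.
- split.
    rewrite /= !prodv_converse -[RHS](full) prodvA //.
  apply: etrans dm _; rewrite mulnC mulnA mulnC mulnA; congr (_ * _)%N;
    exact: mulnC.
- split=> [|i i0|i i0]; rewrite /= /opp_grading.
  + by rewrite oppr0.
  + by apply: m0; rewrite oppr_gt0.
  + by apply: p0; rewrite oppr_lt0.
- by rewrite /= /opp_grading oppr0; split.
by rewrite /= !prodv_converse; split; rewrite ?pT ?mT.
Qed.

End Converse.

(** * Top components and freeness over the negative part *)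

Section TopDegree.
Variables (K : fieldType) (D : triple K).
Local Notation A := (talg D).
Local Notation gA := (tgr D).
Local Notation Am := (tneg D).
Local Notation T := (tmid D).
Local Notation Ap := (tpos D).
Hypotheses (hA : graded_algebra gA) (hD : weak_triangular D).
Local Notation R := (greg0 hA).
Local Notation n := (\dim Am).
Local Notation am k := ((vbasis Am)`_k).
Local Notation C := (T * Ap)%VS.

Lemma memv1_neg : 1 \in Am. Proof. by case: hD => -[[]]. Qed.
Lemma memv1_mid : 1 \in T. Proof. by case: hD => -[_ []]. Qed.
Lemma memv1_pos : 1 \in Ap. Proof. by case: hD => -[_ _ []]. Qed.

Lemma neg_basis (k : 'I_n) : am k \in Am.
Proof. by rewrite vbasis_mem // mem_nth // size_tuple. Qed.

Lemma gcomp_neg i a : a \in Am -> gcomp R i a \in Am.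
Proof.
by case: hD => -[[_ h] _ _] _ _ _ _;
  exact: (iffLR (@homogeneous_gcomp _ _ _ R Am) h i a).
Qed.
Lemma gcomp_pos i x : x \in Ap -> gcomp R i x \in Ap.
Proof.
by case: hD => -[_ _ [_ h]] _ _ _ _;
  exact: (iffLR (@homogeneous_gcomp _ _ _ R Ap) h i x).
Qed.

Lemma mid_degree t : t \in T -> t \in gA 0.
Proof. by move=> tT; case: hD => _ _ [/subvP sT _ _] _ _; exact: sT. Qed.

Lemma vsproj_mid t : t \in T -> vsval (vsproj T t) = t.
Proof. exact: vsprojK. Qed.

Lemma neg_gt0 i a : a \in Am -> 0 < i -> gcomp R i a = 0.
Proof.
move=> aA i0; apply/eqP; rewrite -memv0; case: hD => _ _ [_ _ m0] _ _.
by rewrite -(m0 i i0) memv_cap gcomp_neg //; exact: gcomp_in.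
Qed.

Lemma pos_lt0 i x : x \in Ap -> i < 0 -> gcomp R i x = 0.
Proof.
move=> xA i0; apply/eqP; rewrite -memv0; case: hD => _ _ [_ p0 _] _ _.
by rewrite -(p0 i i0) memv_cap gcomp_pos //; exact: gcomp_in.
Qed.

Lemma neg_scalar a : a \in Am -> exists k : K, gcomp R 0 a = k *: 1.
Proof.
move=> aA; apply/vlineP; case: hD => _ _ _ [<- _] _.
by rewrite memv_cap gcomp_neg //; exact: gcomp_in.
Qed.

Lemma pos_scalar x : x \in Ap -> exists k : K, gcomp R 0 x = k *: 1.
Proof.
move=> xA; apply/vlineP; case: hD => _ _ _ [_ <-] _.
by rewrite memv_cap gcomp_pos //; exact: gcomp_in.
Qed.

(** As A^+ lives in degrees at least 0, its elements without component of
    degree 0 are those of positive degree; similarly for A^-. *)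
Definition pos_part : {vspace A} := (Ap :&: lker (gcomp R 0))%VS.
Definition neg_part : {vspace A} := (Am :&: lker (gcomp R 0))%VS.

Lemma gcomp_one : gcomp R 0 1 = 1.
Proof. by apply: gcomp_id; case: hA. Qed.

Lemma pos_decomp x : x \in Ap -> exists (k :
  K) y, y \in pos_part /\ x = k *: 1 + y.
Proof.
move=> xA; have [k ek] := pos_scalar xA; exists k, (x - k *: 1).
split; last by rewrite addrC subrK.
rewrite memv_cap memvB ?memvZ ?memv1_pos //= memv_ker.
by rewrite linearB linearZ /= gcomp_one ek subrr.
Qed.

Lemma neg_decomp a : a \in Am -> exists (k :
  K) y, y \in neg_part /\ a = k *: 1 + y.
Proof.
move=> xA; have [k ek] := neg_scalar xA; exists k, (a - k *: 1).
split; last by rewrite addrC subrK.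
rewrite memv_cap memvB ?memvZ ?memv1_neg //= memv_ker.
by rewrite linearB linearZ /= gcomp_one ek subrr.
Qed.

Lemma algebra_ind (W : {vspace A}) :
  (forall a c, a \in Am -> c \in C -> a * c \in W) -> forall b, b \in W.
Proof.
move=> WP b; have : b \in (Am * C)%VS.
  by case: hD => _ [full _] _ _ _; rewrite prodvA full memvf.
by apply: subvP; apply/prodvP.
Qed.

Lemma neg_span (V : {vspace A}) u : u \in (Am * V)%VS ->
  exists c : 'I_n -> A, (forall k, c k \in V) /\ u = \sum_(k < n) am k * c k.
Proof.
move=> uV; have /memv_sumP[w wP ->] : u \in (\sum_(k < n) amull (am k) @: V)%VS.
  apply: subvP uV; apply/prodvP=> a v aA vV.
  rewrite (coord_vbasis aA) mulr_suml; apply: memv_sumr => k _.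
  by apply/memv_imgP; exists (coord (vbasis Am) k a *: v);
     rewrite ?memvZ // lfunE /= -scalerAl scalerAr.
have /fin_all_exists[c cP] (k : 'I_n) : exists ck, ck \in V /\ w k = am k * ck.
  by have /memv_imgP[ck ? ->] := wP k isT; exists ck; rewrite lfunE.
by exists c; split=> [k|]; [case: (cP k) | apply: eq_bigr => k _; case: (cP k)].
Qed.

(** The dimension of A leaves no room for relations: A is free as a left
    module over its negative part, on any basis of T A^+. *)
Lemma neg_free (c : 'I_n -> A) : (forall k, c k \in C) ->
  \sum_(k < n) am k * c k = 0 -> forall k, c k = 0.
Proof.
move=> cC c0; pose V (k : 'I_n) := (amull (am k) @: C)%VS.
have dimC : (\dim C <= \dim T * \dim Ap)%N by exact: dim_prodv.
have dimA : \dim {: A} = (n * (\dim T * \dim Ap))%N.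
  by case: hD => _ [_ ->] _ _ _; rewrite mulnA.
have full : (\sum_(k < n) V k)%VS = fullv.
  apply/eqP; rewrite eqEsubv subvf; apply/subvP=> b _;
    apply: algebra_ind b => a y aA yC.
  have /neg_span[d [dC ->]] : a * y \in (Am * C)%VS by exact: memv_mul.
  by apply: memv_sumr => k _; apply/memv_imgP; exists (d k); rewrite ?lfunE.
have dimV : (\sum_(k < n) \dim (C :&: lker (amull (am k))) + \sum_(k < n) \dim
  (V k)
             = n * \dim C)%N.
  rewrite -big_split /= (eq_bigr (fun=> \dim C)) => [|k _];
    last exact: limg_ker_dim.
  by rewrite sum_nat_const card_ord.
have leV : (\dim {:A} <= \sum_(k < n) \dim (V k))%N.
  by rewrite -full; exact: dimv_leq_sum.
have leC : (n * \dim C <= \dim {: A})%N by rewrite dimA leq_mul2l dimC orbT.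
have dir : directv (\sum_(k < n) V k).
  by rewrite directvEgeq /= full; apply: leq_trans leC; rewrite -dimV;
    exact: leq_addl.
have ker0 (k : 'I_n) : (C :&: lker (amull (am k)))%VS = 0%VS.
  apply/eqP; rewrite -dimv_eq0.
  have : (\sum_(k < n) \dim (C :&: lker (amull (am k))) == 0)%N.
    rewrite -leqn0 -(leq_add2r (\sum_(k < n) \dim (V k))) add0n dimV.
    exact: leq_trans leC leV.
  by rewrite sum_nat_eq0 => /forall_inP/(_ k isT).
have akV (k : 'I_n) : true -> am k * c k \in V k.
  by move=> _; apply/memv_imgP; exists (c k); rewrite ?lfunE.
move=> k; apply/eqP; rewrite -memv0 -(ker0 k) memv_cap cC memv_ker lfunE /=.
by rewrite (elimT directv_sum_independent dir _ akV c0).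
Qed.

Lemma gcomp_C i c : c \in C -> gcomp R i c \in C.
Proof.
move=> cC; rewrite memv_preim; apply: subvP cC; apply/prodvP=> t x tT xA.
rewrite -memv_preim -[i]add0r.
have -> : gcomp R (0 + i) (t * x) = t * gcomp R i x.
  exact: (gcomp_act (M := R) i x (mid_degree tT)).
by rewrite memv_mul ?gcomp_pos.
Qed.

Lemma gcomp_orbit (M : modA D) i d b (v : M) : v \in ggr M d ->
  gcomp M (i + d) (gact M b v) = gact M (gcomp R i b) v.
Proof.
move=> vd; move: b; apply: (homogeneous_ind hA) => [a b ea eb| |k a ak].
- by rewrite gactDl !linearD /= ea eb gactDl.
- by rewrite gact0l !linear0 gact0l.
have akv := gact_graded (g := M) ak vd.
have [<-|ki] := eqVneq k i;
  first by rewrite (gcomp_id akv) (gcomp_id (M := R) ak).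
rewrite (gcomp_other akv) ?(inj_eq (addIr d)) //.
by rewrite (gcomp_other (M := R) ak ki) gact0l.
Qed.

Section TopComponent.
Variables (M : modA D) (d : int).
Hypothesis topM : forall i, d < i -> ggr M i = 0%VS.

Lemma pos_part_top x v : x \in pos_part -> v \in ggr M d -> gact M x v = 0.
Proof.
rewrite memv_cap memv_ker => /andP[xA /eqP x0] vd.
rewrite -(@gcomp_sum _ _ _ R x) gact_suml big1 // => i _.
have [i0|i0|->] := ltgtP i 0; last by rewrite x0 gact0l.
  by rewrite pos_lt0 // gact0l.
have := gact_graded (g := M) (gcomp_in i (x : R)) vd.
by rewrite topM ?ltrDr // memv0 => /eqP.
Qed.

Definition mid_stable (X : {vspace M}) : Prop :=
  (X <= ggr M d)%VS /\ forall t v, t \in T -> v \in X -> gact M t v \in X.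

(** The span A^- X, as a finite sum over a basis of A^-. *)
Definition neg_gen (X : {vspace M}) : {vspace M} :=
  (\sum_(k < n) linfun (gact M (am k)) @: X)%VS.

Lemma neg_genP (X : {vspace M}) u : reflect
  (exists x : 'I_n -> M, (forall k,
    x k \in X) /\ u = \sum_(k < n) gact M (am k) (x k))
  (u \in neg_gen X).
Proof.
apply: (iffP memv_sumP) => [[w wP ->]|[x [xX ->]]].
  have /fin_all_exists[x xP] (k : 'I_n) : exists xk,
    xk \in X /\ w k = gact M (am k) xk.
    by have /memv_imgP[xk ? ->] := wP k isT; exists xk; rewrite lfunE.
  by exists x; split=> [k|]; [case: (xP k) | apply: eq_bigr => k _;
    case: (xP k)].
exists (fun k : 'I_n => gact M (am k) (x k)) => // k _; apply/memv_imgP;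
  exists (x k) => //.
by rewrite lfunE.
Qed.

Lemma neg_gen_mem (X : {vspace M}) a v :
  a \in Am -> v \in X -> gact M a v \in neg_gen X.
Proof.
move=> aA vX; apply/neg_genP;
  exists (fun k : 'I_n => coord (vbasis Am) k a *: v).
split=> [k|]; first exact: memvZ.
by rewrite {1}(coord_vbasis aA) gact_suml; apply: eq_bigr => k _;
  rewrite gactZl linearZ.
Qed.

Lemma neg_gen_sub (X : {vspace M}) : (X <= neg_gen X)%VS.
Proof. by apply/subvP=> v vX; rewrite -(gact1 v) neg_gen_mem ?memv1_neg. Qed.

Lemma neg_gen_min (X U : {vspace M}) :
  gsubmod U -> (X <= U)%VS -> (neg_gen X <= U)%VS.
Proof.
move=> sU /subvP XU; apply/subvP=> _ /neg_genP[x [xX ->]].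
by apply: memv_suml => k _; apply: gsubmod_act => //; exact: XU.
Qed.

(** Elements of positive degree of A^+ kill the top component, and those of
    degree 0 are scalars. *)
Lemma mid_stable_C (X : {vspace M}) c v :
  mid_stable X -> c \in C -> v \in X -> gact M c v \in X.
Proof.
move=> [/subvP Xd TX] cC vX; have vd := Xd v vX.
suff /subvP sC : (C <= linfun (orbit_map v) @^-1: X)%VS.
  by have := sC c cC; rewrite -memv_preim lfunE.
apply/prodvP=> t x tT xA; rewrite -memv_preim lfunE /= /orbit_map.
have [k [y [yp ->]]] := pos_decomp xA.
by rewrite mulrDr gactDl !gactM (pos_part_top yp) // linear0 addr0 gactZl gact1
  TX // memvZ.
Qed.

Lemma neg_gen_orbit (X : {vspace M}) b v :
  mid_stable X -> v \in X -> gact M b v \in neg_gen X.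
Proof.
move=> sX vX; suff : b \in (linfun (orbit_map v) @^-1: neg_gen X)%VS.
  by rewrite -memv_preim lfunE.
move: b; apply: algebra_ind => a c aA cC;
  rewrite -memv_preim lfunE /= /orbit_map gactM.
by rewrite neg_gen_mem // (mid_stable_C sX).
Qed.

Lemma neg_gen_gsubmod (X : {vspace M}) : mid_stable X -> gsubmod (neg_gen X).
Proof.
move=> sX; have [/subvP Xd _] := sX.
apply: gsubmodP => [b|i] _ /neg_genP[x [xX ->]]; rewrite linear_sum;
  apply: memv_suml => k _.
  by rewrite /= -gactM neg_gen_orbit.
by rewrite /= -[i](subrK d) gcomp_orbit ?Xd // neg_gen_orbit.
Qed.

(** Only the elements of degree 0 of A^-, which are scalars, keep X in the
    degree d. *)
Lemma neg_gen_top (X : {vspace M}) :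
  mid_stable X -> (neg_gen X :&: ggr M d)%VS = X.
Proof.
move=> sX; have [Xd _] := sX; apply/eqP; rewrite eqEsubv; apply/andP; split;
  last first.
  by rewrite subv_cap neg_gen_sub.
apply/subvP=> u; rewrite memv_cap => /andP[/neg_genP[x [xX ->]] ud].
rewrite -(gcomp_id ud) linear_sum; apply: memv_suml => k _ /=.
rewrite -[d in gcomp M d]add0r gcomp_orbit ?(subvP Xd) //.
have [s ->] := neg_scalar (neg_basis k).
by rewrite gactZl gact1 memvZ.
Qed.

End TopComponent.

Section Projective.
Variables (P : modA D) (d : int).
Hypothesis topP : forall i, d < i -> ggr P i = 0%VS.
Variables (e : int) (i : 'Hom(P, greg hA e)) (r : 'Hom(greg hA e, P)).
Hypotheses (hi : ghom i) (hr : ghom r) (iK : cancel i r).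
Local Notation m := (d - e).

(** The elements of A of degree larger than m are among those killed both by
    r and by the projection to degree m. *)
Let H : {vspace A} := (lker (r : 'Hom(A, P)) :&: lker (gcomp R m))%VS.

Lemma high_degree j c : m < j -> c \in gA j -> c \in H.
Proof.
move=> mj cj; rewrite memv_cap !memv_ker (gcomp_other (M := R) cj) ?gt_eqF //
  eqxx andbT.
have [_ rg] := hr; have := rg (j + e) c; rewrite /= addrK => /(_ cj).
by rewrite topP ?memv0 // -ltrBlDr.
Qed.

(** In a product of degree m, either the factor from A^- has degree 0 and is
    a scalar, or the factor from T A^+ has a degree larger than m. *)
Lemma degree_decomp u : u \in gA m -> exists c w,
  [/\ c \in C, c \in gA m, w \in (Am * (C :&: H))%VS & u = c + w].
Proof.
move=> um; suff : u \in ((C :&: gA m) + Am * (C :&: H))%VS.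
  by case/memv_addP=> c; rewrite memv_cap => /andP[? ?] [w ? ->]; exists c, w.
rewrite -(gcomp_id (M := R) um) memv_preim; move: u {um}.
apply: algebra_ind => a c aA cC; rewrite -memv_preim.
rewrite -(@gcomp_sum _ _ _ R a) -(@gcomp_sum _ _ _ R c) mulr_suml linear_sum.
apply: memv_suml => k _; rewrite mulr_sumr linear_sum;
  apply: memv_suml => j _ /=.
set ak := gcomp R k a; set cj := gcomp R j c.
have akk : ak \in gA k by exact: (gcomp_in (M := R)).
have cjj : cj \in gA j by exact: (gcomp_in (M := R)).
have acg : ak * cj \in ggr R (k + j) by exact: (gact_graded (g := R)).
have [ekj|nkj] := eqVneq (k + j) m; last by rewrite (gcomp_other acg nkj) mem0v.
rewrite -ekj (gcomp_id acg).
have [k0|k0|k0] := ltgtP k 0.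
- apply: (subvP (addvSr _ _));
  rewrite memv_mul ?gcomp_neg // memv_cap gcomp_C //=.
  by apply: high_degree cjj; rewrite -ekj gtrDr.
- by rewrite /ak neg_gt0 // mul0r mem0v.
apply: (subvP (addvSl _ _)); rewrite memv_cap.
have [s es] := neg_scalar aA;
  rewrite /ak k0 es mulr_algl memvZ ?gcomp_C //= memvZ //.
by rewrite add0r.
Qed.

(** The top component of a direct summand P of a shift of A generates freely
    over the negative part: modulo A^- times higher degree, which P does not
    have, elements of degree m of A lie in T A^+, over which A is free. *)
Lemma top_free (v : 'I_n -> P) : (forall k, v k \in ggr P d) ->
  \sum_(k < n) gact P (am k) (v k) = 0 -> forall k, v k = 0.
Proof.
move=> vd v0; have [ia ig] := hi; have [ra _] := hr.
have /fin_all_exists[c cP] (k : 'I_n) : exists c, [/\ c \in C, c \in gA m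
    & (i (v k) : A) - c \in (Am * (C :&: H))%VS].
  have [c [w [? ? wH e1]]] := degree_decomp (ig _ _ (vd k)).
  by exists c; split=> //; rewrite e1 addrC addKr.
have sum_iv : \sum_(k < n) am k * (i (v k) : A) = 0.
  by rewrite -[RHS](linear0 i) -v0 linear_sum; apply: eq_bigr => k _;
    rewrite /= ia.
have : \sum_(k < n) am k * c k \in (Am * (C :&: H))%VS.
  have -> : \sum_(k < n) am k * c k
    = - \sum_(k < n) am k * ((i (v k) : A) - c k).
    apply/eqP; rewrite -addr_eq0 -big_split /= -[X in _ == X]sum_iv; apply/eqP.
    by apply: eq_bigr => k _; rewrite -mulrDr addrC subrK.
  rewrite memvN; apply: memv_suml => k _; have [_ _ wH] := cP k.
  by have := memv_mul (neg_basis k) wH; rewrite prodvA; apply: subvP;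
    exact: prodvSl (asubv _).
case/neg_span=> c' [c'P sumc].
have cc (k : 'I_n) : c k = c' k.
  apply/eqP; rewrite -subr_eq0; apply/eqP; move: k.
  apply: (@neg_free (fun k : 'I_n => c k - c' k)) => [k|].
    have [cC _ _] := cP k; have := c'P k; rewrite memv_cap => /andP[c'C _].
    exact: memvB.
  rewrite (eq_bigr (fun k : 'I_n => am k * c k - am k * c' k)) => [|k _];
    last exact: mulrBr.
  by rewrite sumrB sumc subrr.
move=> k; have [_ cm wH] := cP k; have := c'P k;
  rewrite -cc !memv_cap !memv_ker.
rewrite (gcomp_id (M := R) cm) => /and3P[_ _ /eqP c0].
rewrite c0 subr0 in wH; rewrite -(iK (v k)); apply/eqP; rewrite -memv_ker.
apply: subvP wH; apply/prodvP=> a y _; rewrite !memv_cap => /and3P[_ ry _].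
rewrite memv_ker in ry; rewrite memv_ker; apply/eqP.
by apply: etrans (ra a y) _; rewrite (eqP ry) linear0.
Qed.

Lemma neg_gen_disjoint (X Y : {vspace P}) : mid_stable d X -> mid_stable d Y ->
  (X :&: Y = 0)%VS -> (neg_gen X :&: neg_gen Y = 0)%VS.
Proof.
move=> [/subvP Xd _] [/subvP Yd _] XY; apply/eqP; rewrite -subv0;
  apply/subvP=> u.
rewrite memv_cap => /andP[/neg_genP[x [xX ->]] /neg_genP[y [yY exy]]].
rewrite memv0 big1 // => k _; have xy : x k = y k.
  apply/eqP; rewrite -subr_eq0; apply/eqP; move: k.
  apply: (@top_free (fun k : 'I_n => x k - y k)) => [k|];
    first exact: memvB (Xd _ (xX k)) (Yd _ (yY k)).
  rewrite (eq_bigr (fun k : 'I_n =>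
    gact P (am k) (x k) - gact P (am k) (y k))) => [|k _].
    by rewrite sumrB exy subrr.
  exact: linearB.
suff -> : x k = 0 by rewrite linear0.
by apply/eqP; rewrite -memv0 -XY memv_cap xX xy yY.
Qed.

End Projective.

End TopDegree.

(** * Weights *)

Section GradedSimpleModules.
Variables (K : fieldType) (B : falgType K) (gB : int -> {vspace B}).
Hypothesis gB0 : forall b, b \in gB 0.
Implicit Types l : gmod gB.

Lemma concentrated_gsubmod l d (U : {vspace l}) : ggr l d = fullv ->
  (forall b v, v \in U -> gact l b v \in U) -> gsubmod U.
Proof.
move=> ld bU; apply: gsubmodP => // i v vU;
  have vd : v \in ggr l d by rewrite ld memvf.
have [<-|di] := eqVneq d i; first by rewrite (gcomp_id vd).
by rewrite (gcomp_other vd di) mem0v.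
Qed.

Lemma degree_gsubmod l d : gsubmod (ggr l d).
Proof.
apply: gsubmodP => [b|i] v vd; first by rewrite -[d]add0r gact_graded.
have [<-|di] := eqVneq d i; first by rewrite (gcomp_id vd).
by rewrite (gcomp_other vd di) mem0v.
Qed.

Lemma simple_concentrated l : simple_gmod l -> exists d, ggr l d = fullv.
Proof.
move=> [l0 sl]; have [d [x [xd x0]]] := homogeneous_vector l0; exists d.
by case: (sl _ (degree_gsubmod l d)) => // e; move: xd x0;
  rewrite e memv0 => ->.
Qed.

Lemma concentrated_unique l d d' : fullv != 0%VS :> {vspace l} ->
  ggr l d = fullv -> ggr l d' = fullv -> d = d'.
Proof.
move=> l0 ld ld'; apply/eqP; apply: contraNT l0 => dd'; rewrite -subv0.
apply/subvP=> v _; rewrite memv0; apply/eqP.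
by apply: (ggr_disjoint (M := l) _ _ dd'); rewrite ?ld ?ld' memvf.
Qed.

Lemma concentrated_ghom l l' d (f : 'Hom(l, l')) :
  ggr l d = fullv -> ggr l' d = fullv ->
  (forall b v, f (gact l b v) = gact l' b (f v)) -> ghom f.
Proof.
move=> ld ld' fb; split=> // i v vi; have [->|id] := eqVneq i d.
  by rewrite ld' memvf.
have -> : v = 0 by apply: ggr_disjoint vi _ id; rewrite ld memvf.
by rewrite linear0 mem0v.
Qed.

Lemma simple_orbit l (v : l) :
  simple_gmod l -> v != 0 -> limg (linfun (orbit_map v)) = fullv.
Proof.
move=> sl v0; have [d ld] := simple_concentrated sl.
have sv : gsubmod (limg (linfun (orbit_map v))).
  apply: (concentrated_gsubmod ld) => b _ /memv_imgP[c _ ->]; apply/memv_imgP.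
  by exists (b * c); rewrite ?memvf // !lfunE /= /orbit_map gactM.
case: (proj2 sl _ sv) => // e; case/negP: v0; rewrite -memv0 -e.
by apply/memv_imgP; exists 1; rewrite ?memvf // lfunE /= /orbit_map gact1.
Qed.

End GradedSimpleModules.

Section Weights.
Variables (K : fieldType) (D : triple K).
Local Notation A := (talg D).
Local Notation gA := (tgr D).
Local Notation Am := (tneg D).
Local Notation T := (tmid D).
Local Notation Ap := (tpos D).
Hypotheses (hA : graded_algebra gA) (hD : weak_triangular D).
Local Notation R := (greg0 hA).
Implicit Types (M N P L : modA D) (l : modT D).

Lemma sub_mid0 t : t \in sub_grading gA T 0.
Proof. by rewrite memv_sub_grading mid_degree // subvsP. Qed.

Lemma subvs_one : vsval (1 : subvs_of T) = 1 :> A.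
Proof. by apply/eqP; rewrite algid_eq1 memv1_mid. Qed.

(** The part of M of largest degree is, as a T-module, isomorphic to l. *)
Definition top_weight M l : Prop := exists d (j : 'Hom(l, M)),
  [/\ forall i, d < i -> ggr M i = 0%VS, lker j = 0%VS, limg j = ggr M d,
      forall t v, j (gact l t v) = gact M (vsval t) (j v) & ggr l d = fullv].

Lemma top_weight_giso M M' l : giso M M' -> top_weight M l -> top_weight M' l.
Proof.
move=> /gisoW[f hf [kf imf]] [d [j [topM kj imj jT ld]]].
have injf : injective f by apply/lker0P; rewrite kf.
have injj : injective j by apply/lker0P; rewrite kj.
have grM' i : ggr M' i = (f @: ggr M i)%VS.
  apply/vspaceP=> w; have /memv_imgP[v _ ->] : w \in limg f
    by rewrite imf memvf.
  have [_ fg] := hf; apply/idP/memv_imgP=> [fvi|[u ui ->]]; last exact: fg.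
  by exists v => //; rewrite (_ : v = gcomp M i v) ?gcomp_in //; apply: injf;
     rewrite (ghom_gcomp _ _ hf) gcomp_id.
exists d, (f \o j)%VF; split=> //.
- by move=> i di; rewrite grM' topM // limg0.
- by apply/eqP/lker0P=> u v; rewrite !comp_lfunE => /injf/injj.
- by rewrite limg_comp imj grM'.
by move=> t v; rewrite !comp_lfunE jT; case: hf => fa _; rewrite fa.
Qed.

Lemma top_weight_giso_r M l l' : giso l l' -> top_weight M l -> top_weight M l'.
Proof.
move=> /giso_sym/gisoW[f hf [kf imf]] [d [j [topM kj imj jT ld]]].
have injf : injective f by apply/lker0P; rewrite kf.
have injj : injective j by apply/lker0P; rewrite kj.
exists d, (j \o f)%VF; split=> //.
- by apply/eqP/lker0P=> u v; rewrite !comp_lfunE => /injj/injf.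
- by rewrite limg_comp imf imj.
- by move=> t v; rewrite !comp_lfunE; case: hf => fa _; rewrite fa jT.
apply/vspaceP=> v; rewrite memvf.
have vd : f v = f (gcomp l' d v)
  by rewrite (ghom_gcomp _ _ hf) gcomp_id // ld memvf.
by rewrite (injf _ _ vd) gcomp_in.
Qed.

Lemma top_weight_unique M l l' : simple_gmod l -> simple_gmod l' ->
  top_weight M l -> top_weight M l' -> giso l l'.
Proof.
move=> [l0 _] [l0' _] [d [j [topM kj imj jT ld]]] [d' [j' [topM' kj' imj' jT'
  ld']]].
have Md : ggr M d != 0%VS by rewrite -imj; apply: limg_neq0 l0 kj.
have Md' : ggr M d' != 0%VS by rewrite -imj'; apply: limg_neq0 l0' kj'.
have ed : d = d'.
  by case: (ltgtP d d') => // [/topM|/topM'] e; rewrite e eqxx in Md Md'.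
have jK : cancel j' (j'^-1)%VF by apply: lker0_lfunK; rewrite kj'.
have injj : injective j by apply/lker0P; rewrite kj.
pose f := (j'^-1 \o j)%VF.
have j'f v : j' (f v) = j v.
  by rewrite comp_lfunE limg_lfunVK // imj' -ed -imj memv_img ?memvf.
have hf : ghom f.
  apply: (concentrated_ghom (d := d)); rewrite // ?ed // => t v.
  by apply: (can_inj jK); rewrite j'f jT' j'f jT.
apply: giso_bij hf _ _.
  by apply/eqP/lker0P=> u v /(congr1 j'); rewrite !j'f => /injj.
apply/vspaceP=> v; rewrite memvf; have : j' v \in limg j.
  by rewrite imj ed -imj' memv_img ?memvf.
case/memv_imgP=> u _ e; have -> : v = f u by apply: (can_inj jK); rewrite j'f.
by rewrite memv_img ?memvf.
Qed.

Lemma top_degree M : fullv != 0%VS :> {vspace M} ->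
  exists2 d, ggr M d != 0%VS & forall i, d < i -> ggr M i = 0%VS.
Proof.
move=> M0; have [e [x [xe x0]]] := homogeneous_vector M0.
have gr0 i v : v \in ggr M i -> v != 0 -> ggr M i != 0%VS.
  by move=> vi; apply: contraNneq => e0; rewrite -memv0 -e0.
have supp i : ggr M i != 0%VS -> i \in gsupp M.
  apply: contraR => si; rewrite -subv0; apply/subvP=> v vi.
  by rewrite (ggr_out si vi) mem0v.
have maxs (s : seq int) : (exists2 i, i \in s & ggr M i != 0%VS) ->
    exists2 d, ggr M d != 0%VS & forall i, i \in s -> ggr M i != 0%VS -> i <= d.
  elim: s => [[]|a s IHs] //= exi.
  have [|no] := pselect (exists2 i, i \in s & ggr M i != 0%VS).
    case/IHs=> d d0 maxd; have [a0|a0] := boolP (ggr M a == 0%VS).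
      exists d => // i; rewrite inE => /orP[/eqP->|]; last exact: maxd.
      by rewrite a0.
    have [da|ad] := leP d a; [exists a | exists d] => // i;
      rewrite inE => /orP[/eqP-> //|si i0];
        rewrite ?(le_trans (maxd i si i0)) //.
    by move=> _; exact: ltW.
  case: exi => i; rewrite inE => /orP[/eqP->|si] i0; last by case: no; exists i.
  exists a => // k; rewrite inE => /orP[/eqP-> //|sk k0]; by case: no; exists k.
have [|d d0 maxd] := maxs (gsupp M).
  by exists e; [apply: supp|]; exact: gr0 xe x0.
exists d => // i di; apply/eqP; apply: contraTT di => i0.
by rewrite -leNgt maxd ?supp.
Qed.

(** The module l is the component of degree d itself. *)
Lemma top_weight_exists M d :
  ggr M d != 0%VS -> (forall i, d < i -> ggr M i = 0%VS) ->
  (forall X : {vspace M}, mid_stable d X -> X = 0%VS \/ X = ggr M d) ->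
  exists2 l, simple_gmod l & top_weight M l.
Proof.
move=> Md topM minX; pose V := subvs_of (ggr M d).
pose act (t : subvs_of T) (v : V) : V := vsproj (ggr M d) (gact M (vsval t)
  (vsval v)).
have actE t v : vsval (act t v) = gact M (vsval t) (vsval v).
  have := gact_graded (g := M) (mid_degree hD (subvsP t)) (subvsP v).
  by rewrite add0r; exact: vsprojK.
pose gr i : {vspace V} := if i == d then fullv else 0%VS.
have g_lin v : linear (act^~ v).
  by move=> k s t; apply: val_inj; rewrite /= !actE gactDl gactZl.
have g_linr t : linear (act t).
  by move=> k u v; apply: val_inj; rewrite /= !actE linearP.
have g_1 v : act 1 v = v by apply: val_inj; rewrite /= actE subvs_one gact1.
have g_M s t v : act (s * t) v = act s (act t v).
  by apply: val_inj; rewrite /= !actE gactM.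
have g_gr : is_grading gr.
  apply: (@grading_of_comp _ _ gr (fun i v =>
    if i == d then v else 0) [:: d]) => //.
  - by move=> i v; rewrite /gr; case: eqP => _; rewrite ?memvf ?mem0v.
  - by move=> v; rewrite big_seq1 eqxx.
  - by move=> i u v; case: eqP => _; rewrite ?addr0.
  move=> i j v; rewrite /gr; case: (eqVneq j d) => [->|_].
    by move=> _ /negPf; rewrite eq_sym => ->.
  by rewrite memv0 => /eqP-> _; case: eqP.
have g_act i j t v : t \in sub_grading gA T i -> v \in gr j ->
  act t v \in gr (i + j).
  move=> ti; rewrite /gr; case: (eqVneq j d) => [->|_]; last first.
    rewrite memv0 => /eqP->; suff -> : act t 0 = 0 by rewrite mem0v.
    by apply: val_inj; rewrite /= actE linear0.
  have [->|i0] := eqVneq i 0; first by rewrite add0r eqxx => _; exact: memvf.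
  have -> : (i + d == d) = false by rewrite -subr_eq0 addrK; exact: negPf.
  have -> : t = 0.
    apply: val_inj; apply: (ggr_disjoint (M := R) (j := 0) _ _ i0).
      by have := ti; rewrite memv_sub_grading.
    by have := mid_degree hD (subvsP t).
  by move=> _; rewrite memv0; apply/eqP/val_inj; rewrite /= actE gact0l.
pose l := @GMod K _ (sub_grading gA T) V act gr g_lin g_linr g_1 g_M g_gr g_act.
have ld : ggr l d = fullv by rewrite /= /gr eqxx.
pose j : 'Hom(l, M) := linfun vsval.
have jE v : j v = vsval v by rewrite lfunE.
have injj : injective j by move=> u v; rewrite !jE; exact: val_inj.
have imj : limg j = ggr M d.
  apply/vspaceP=> v; apply/memv_imgP/idP=> [[u _ ->]|vd];
    first by rewrite jE subvsP.
  by exists (vsproj (ggr M d) v : V); rewrite ?memvf // jE vsprojK.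
have kj : lker j = 0%VS by apply/eqP/lker0P.
have jT t v : j (gact l t v) = gact M (vsval t) (j v) by rewrite !jE actE.
exists l; last by exists d, j.
split.
  rewrite -dimv_eq0 -(limg_dim_eq (f := j)) ?kj ?capv0 // imj dimv_eq0 //.
move=> U [aU _]; have := minX (j @: U)%VS; case.
- split; first by apply/subvP=> _ /memv_imgP[u uU ->]; rewrite jE subvsP.
  move=> t _ tT /memv_imgP[u uU ->].
  by rewrite -[t](vsproj_mid tT) -jT memv_img // aU.
- by move=> e; left; apply/eqP;
  rewrite -(eq_limg_ker0 _ _ (f := j)) ?kj // e limg0.
by rewrite -imj => e; right; apply/eqP;
  rewrite -(eq_limg_ker0 _ _ (f := j)) ?kj // e.
Qed.

Lemma simple_top_weight M :
  simple_gmod M -> exists2 l, simple_gmod l & top_weight M l.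
Proof.
move=> [M0 sM]; have [d Md topM] := top_degree M0.
apply: (top_weight_exists Md topM) => X sX.
have eX := neg_gen_top hA hD sX; have [Xd _] := sX.
case: (sM _ (neg_gen_gsubmod hA hD topM sX)) => e; rewrite e in eX;
  [left|right].
  by rewrite -eX cap0v.
by rewrite -eX capfv.
Qed.

End Weights.

(** * Construction of standard modules *)

Section StandardModules.
Variables (K : fieldType) (D : triple K).
Local Notation A := (talg D).
Local Notation gA := (tgr D).
Local Notation Am := (tneg D).
Local Notation T := (tmid D).
Local Notation Ap := (tpos D).
Hypotheses (hA : graded_algebra gA) (hD : weak_triangular D).
Local Notation R := (greg0 hA).
Local Notation am k := ((vbasis Am)`_k).
Local Notation C := (T * Ap)%VS.
Local Notation pos_part := (pos_part hA).
Local Notation neg_part := (neg_part hA).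
Implicit Types (M N P L : modA D) (l : modT D).

(* The part of positive degree of B^+, and a complement of T in A. *)
Local Notation Bp := (T * pos_part)%VS.
Local Notation aug := (neg_part * C + Bp)%VS.

Lemma gcomp_mulr i d b y :
  y \in gA d -> gcomp R (i + d) (b * y) = gcomp R i b * y.
Proof. by move=> yd; exact: (gcomp_orbit hA (M := R) i b yd). Qed.

Lemma gcomp_mull i d b y :
  b \in gA d -> gcomp R (d + i) (b * y) = b * gcomp R i y.
Proof. by move=> bd; exact: (gcomp_act (M := R) i y bd). Qed.

Lemma sub_mid_C : (T <= C)%VS.
Proof. by apply/subvP=> t tT; rewrite -[t]mulr1 memv_mul ?memv1_pos. Qed.

Lemma Bp_sub_C : (Bp <= C)%VS.
Proof. by apply: prodvSr; exact: capvSl. Qed.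

Lemma gcomp_Bp i y : y \in Bp -> gcomp R i y \in Bp.
Proof.
move=> yB; rewrite memv_preim; apply: subvP yB; apply/prodvP=> t x tT.
rewrite memv_cap memv_ker => /andP[xA /eqP x0]; rewrite -memv_preim -[i]add0r.
rewrite (gcomp_mull i x (mid_degree hD tT)) memv_mul // memv_cap (gcomp_pos hA
  hD) //=.
have xi := gcomp_in (M := R) i x; have [i0|i0] := eqVneq i 0.
  by rewrite i0 x0 mem0v.
by rewrite memv_ker (gcomp_other xi).
Qed.

Lemma gcomp0_Bp y : y \in Bp -> gcomp R 0 y = 0.
Proof.
move=> yB; apply/eqP; rewrite -memv_ker; apply: subvP yB; apply/prodvP=> t x tT.
rewrite memv_cap !memv_ker => /andP[xA /eqP x0].
by rewrite -[X in gcomp R X]addr0 (gcomp_mull 0 x (mid_degree hD tT)) x0 mulr0.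
Qed.

Lemma C_decomp c : c \in C -> exists t y, [/\ t \in T, y \in Bp & c = t + y].
Proof.
move=> cC; suff : c \in (T + Bp)%VS by case/memv_addP=> t tT [y yB ->];
  exists t, y.
apply: subvP cC; apply/prodvP=> t x tT xA;
  have [k [y [yp ->]]] := pos_decomp hA hD xA.
by rewrite mulrDr memv_add ?memv_mul // -scalerAr mulr1 memvZ.
Qed.

Lemma C_positive c : c \in C -> gcomp R 0 c = 0 -> c \in Bp.
Proof.
move=> /C_decomp[t [y [tT yB ->]]]; rewrite linearD /= (gcomp0_Bp yB) addr0.
by rewrite (gcomp_id (M := R) (mid_degree hD tT)) => ->; rewrite add0r.
Qed.

(** Together T and aug span A, and the sum of their dimensions is at most that
    of A, because 1 is missing in neg_part and in pos_part. *)
Lemma mid_aug : (T :&: aug)%VS = 0%VS.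
Proof.
have full : (T + aug)%VS = fullv.
  apply/eqP; rewrite eqEsubv subvf; apply/subvP=> b _.
  apply: (algebra_ind hD) b => a c aA cC;
    have [k [y [yn ->]]] := neg_decomp hA hD aA.
  rewrite mulrDl -scalerAl mul1r; have [t [z [tT zB ec]]] := C_decomp cC.
  rewrite {1}ec scalerDr -addrA memv_add ?memvZ // addrC memv_add ?memv_mul
    ?memvZ //.
have one_ker : gcomp R 0 1 != 0 by rewrite (gcomp_one hA) oner_eq0.
have dimn : (\dim neg_part < \dim Am)%N.
  rewrite ltn_neqAle dimvS ?capvSl // andbT; apply: contra one_ker => /eqP e.
  have : 1 \in neg_part; last by rewrite memv_cap memv_ker => /andP[].
  have /eqP-> : neg_part == Am :> {vspace A} by rewrite eqEdim capvSl e /=.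
  exact: memv1_neg hD.
have dimp : (\dim pos_part < \dim Ap)%N.
  rewrite ltn_neqAle dimvS ?capvSl // andbT; apply: contra one_ker => /eqP e.
  have : 1 \in pos_part; last by rewrite memv_cap memv_ker => /andP[].
  have /eqP-> : pos_part == Ap :> {vspace A} by rewrite eqEdim capvSl e /=.
  exact: memv1_pos hD.
have dimA : \dim {: A} = (\dim Am * (\dim T * \dim Ap))%N.
  by case: hD => _ [_ ->] _ _ _; rewrite mulnA.
have dimC : (\dim C <= \dim T * \dim Ap)%N by exact: dim_prodv.
have dimB : (\dim Bp <= \dim T * \dim pos_part)%N by exact: dim_prodv.
have dimN : (\dim (neg_part * C) <= \dim neg_part * (\dim T * \dim Ap))%N.
  by apply: leq_trans (dim_prodv _ _) _; rewrite leq_mul2l dimC orbT.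
have dimS : (\dim aug <= \dim (neg_part * C) + \dim Bp)%N.
  by rewrite -dimv_sum_cap leq_addr.
have := dimv_sum_cap T aug; rewrite full dimA => e.
apply/eqP; rewrite -dimv_eq0; move: e dimS dimN dimB dimp dimn.
move: (\dim (T :&: _)) (\dim aug) (\dim (neg_part * C)) (\dim Bp) => x s u v.
move: (\dim neg_part) (\dim pos_part) (\dim Am) (\dim Ap) (\dim T) => a b m p t.
move=> e su uA vB bp am.
have := leq_mul am (leqnn (t * p)%N); have := leq_mul (leqnn t) bp.
by rewrite mulnS mulSn; lia.
Qed.

Lemma pos_act_Bp x y : x \in Ap -> y \in pos_part -> x * y \in pos_part.
Proof.
move=> xA; rewrite !memv_cap !memv_ker => /andP[yA /eqP y0]; rewrite memvM //=.
rewrite -(@gcomp_sum _ _ _ R y) mulr_sumr linear_sum big1 // => j _ /=.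
have yj := gcomp_in (M := R) j y.
have [j0|j0|->] := ltgtP j 0; last by rewrite y0 mulr0 linear0.
  by rewrite (pos_lt0 hA hD yA j0) mulr0 linear0.
rewrite -[X in gcomp R X](subrK j) (gcomp_mulr _ _ yj) sub0r.
by rewrite (pos_lt0 hA hD xA) ?oppr_lt0 // mul0r.
Qed.

Lemma C_act_Bp : (C * Bp <= Bp)%VS.
Proof.
have [_ _ _ _ [pT _]] := hD;
  rewrite -prodvA (prodvA Ap) pT prodvA prodvA prodv_id.
rewrite -prodvA; apply: prodvSr; apply/prodvP=> x y xA yp; exact: pos_act_Bp.
Qed.

Lemma neg_act_Bp : (Am * Bp <= aug)%VS.
Proof.
apply/prodvP=> a y aA yB; have [k [a' [an ->]]] := neg_decomp hA hD aA.
rewrite mulrDl -scalerAl mul1r addrC memv_add ?memvZ // memv_mul //.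
exact: (subvP Bp_sub_C).
Qed.

Lemma alg_act_Bp : (fullv * Bp <= aug)%VS.
Proof.
have [_ [<- _] _ _ _] := hD; rewrite -(prodvA Am) -prodvA.
exact: subv_trans (prodvSr _ C_act_Bp) neg_act_Bp.
Qed.

Lemma gcomp_pos_mid b : b \in (Ap * T)%VS -> gcomp R 0 b = 0 -> b \in Bp.
Proof. by have [_ _ _ _ [-> _]] := hD; exact: C_positive. Qed.

Lemma pos_mid_Bp : (pos_part * T <= Bp)%VS.
Proof.
apply/prodvP=> x t; rewrite memv_cap memv_ker => /andP[xA /eqP x0] tT.
apply: gcomp_pos_mid; first exact: memv_mul.
by rewrite -[X in gcomp R X]addr0 (gcomp_mulr 0 x (mid_degree hD tT)) x0 mul0r.
Qed.

(** Applied to the annihilator of a vector: modulo aug, the left ideal of A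
    that it generates contains no more elements of T than the annihilator. *)
Lemma alg_act_ideal (I : {vspace A}) : (I <= T)%VS -> (T * I <= I)%VS ->
  (fullv * I <= I + aug)%VS.
Proof.
move=> IT TI; have pI : (Ap * I <= I + Bp)%VS.
  apply/prodvP=> x t xA tI; have [k [y [yp ->]]] := pos_decomp hA hD xA.
  rewrite mulrDl -scalerAl mul1r memv_add ?memvZ //.
  by apply: (subvP pos_mid_Bp); rewrite memv_mul // (subvP IT).
have cI : (C * I <= I + Bp)%VS.
  rewrite -prodvA; apply: subv_trans (prodvSr _ pI) _; rewrite prodvDr.
  by apply: addvS TI _; rewrite prodvA prodv_id.
have [_ [<- _] _ _ _] := hD; rewrite -(prodvA Am) -prodvA.
apply: subv_trans (prodvSr _ cI) _; rewrite prodvDr subv_add; apply/andP; split.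
  apply/prodvP=> a t aA tI; have [k [a' [an ->]]] := neg_decomp hA hD aA.
  rewrite mulrDl -scalerAl mul1r memv_add ?memvZ //;
    apply: (subvP (addvSl _ _)).
  by rewrite memv_mul // (subvP sub_mid_C) // (subvP IT).
by apply: subv_trans neg_act_Bp _; exact: addvSr.
Qed.

Section Construction.
Variables (l : modT D) (d : int) (v0 : l).
Hypotheses (sl : simple_gmod l) (ld : ggr l d = fullv) (v0n0 : v0 != 0).

Let Ann : {vspace A} := (linfun vsval @: lker (linfun (orbit_map v0)))%VS.

Let AnnP a : reflect (exists2 t : subvs_of T,
  a = vsval t & gact l t v0 = 0) (a \in Ann).
Proof.
apply: (iffP memv_imgP) => [[t tk ->]|[t -> t0]].
  by move: tk; rewrite memv_ker !lfunE => /eqP ?; exists t.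
by exists t; rewrite ?lfunE // memv_ker lfunE; apply/eqP.
Qed.

Let J : {vspace A} := (fullv * Ann + fullv * Bp)%VS.

Let AnnT : (Ann <= T)%VS.
Proof. by apply/subvP=> _ /AnnP[t -> _]; exact: subvsP. Qed.

Let J_one : 1 \notin J.
Proof.
apply/negP=> J1; have : 1 \in (Ann + aug)%VS.
  apply: subvP J1; rewrite subv_add; apply/andP; split.
    apply: alg_act_ideal AnnT _; apply/prodvP=> s _ sT /AnnP[t -> t0].
    apply/AnnP; exists (vsproj T s * t); first by rewrite /= vsprojK.
    by rewrite gactM t0 linear0.
  by apply: subv_trans alg_act_Bp _; exact: addvSr.
case/memv_addP=> t tAnn [y yaug e1]; have y0 : y = 0.
  apply/eqP; rewrite -memv0 -mid_aug memv_cap yaug andbT.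
  have -> : y = 1 - t by rewrite e1 addrC addKr.
  by rewrite memvB ?memv1_mid // (subvP AnnT).
have e2 : t = 1 by rewrite e1 y0 addr0.
move: tAnn; rewrite e2 => /AnnP[s es].
have -> : s = 1 by apply: val_inj;
  exact: etrans (esym es) (esym (subvs_one hD)).
by rewrite gact1 => e; case/negP: v0n0; rewrite e.
Qed.

Let J_sub : @gsubmod _ _ _ (greg hA d) J.
Proof.
apply: (iffLR (@gsubmod_shift _ _ _ R d J)); apply: gsubmodP => [b v|i v].
  case/memv_addP=> x xJ [y yJ ->].
  have act (X : {vspace A}) z : z \in (fullv * X)%VS ->
    b * z \in (fullv * X)%VS.
    move=> zX; have := memv_mul (memvf b) zX; rewrite prodvA; apply: subvP.
    exact: prodvSl (subvf _).
  by rewrite /= mulrDr memv_add ?act.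
rewrite memv_preim; apply: subvP; rewrite subv_add; apply/andP; split.
  apply/prodvP=> b t _ tA; rewrite -memv_preim -[i]addr0.
  rewrite (gcomp_mulr i b (mid_degree hD (subvP AnnT _ tA))).
  by apply: (subvP (addvSl _ _)); rewrite memv_mul ?memvf.
apply/prodvP=> b y _ yB; rewrite -memv_preim -(@gcomp_sum _ _ _ R y) mulr_sumr
  linear_sum.
apply: memv_suml => j _ /=; rewrite -[i](subrK j).
rewrite (gcomp_mulr _ b (gcomp_in (M := R) j y)).
by apply: (subvP (addvSr _ _)); rewrite memv_mul ?memvf ?gcomp_Bp.
Qed.

(* A linear choice of elements of T that map v0 to given vectors. *)
Let s : 'Hom(l, subvs_of T) := ((linfun (orbit_map v0))^-1)%VF.

Let sE v : gact l (s v) v0 = v.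
Proof.
have := @limg_lfunVK _ _ _ (linfun (orbit_map v0)) v.
rewrite (simple_orbit (sub_mid0 hD) sl v0n0) memvf => /(_ isT).
by rewrite lfunE.
Qed.

(** The induced module is generated by 1 (x) v0, so it is the quotient of a
    shift of A by the left ideal J generated by the annihilator of v0 in T and
    by the elements of B^+ of positive degree.  It is nonzero because 1 is not
    in J. *)
Lemma standard_module_exists : exists M (tau : A -> l -> M),
  [/\ balanced tau, tau 1 v0 != 0 & is_Delta l M].
Proof.
have [M [q [[qa qg] kq imq]]] := gquo_exists J_sub.
have qJ a : a \in J -> q a = 0 by rewrite -kq memv_ker => /eqP.
have JAnn a t : gact l t v0 = 0 -> a * vsval t \in J.
  move=> t0; apply: (subvP (addvSl _ _)); rewrite memv_mul ?memvf //.
  by apply/AnnP; exists t.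
have qmod a t t' : gact l t v0 = gact l t' v0 ->
  q (a * vsval t) = q (a * vsval t').
  move=> e; apply/eqP; rewrite -subr_eq0 -linearB -mulrBr; apply/eqP/qJ.
  by apply: (@JAnn a (t - t'));
    rewrite gactDl e -scaleN1r gactZl scaleN1r subrr.
pose tau (a : A) (v : l) : M := q (a * vsval (s v)).
have tauE a : tau a v0 = q a.
  by rewrite /tau (qmod a _ 1) ?sE ?gact1 // (subvs_one hD) mulr1.
have tau_bal : balanced tau.
  split=> [v k a b|a k u v|a t v|a b i v i0 bB bi]; rewrite /tau.
  - by rewrite mulrDl -scalerAl linearP.
  - by rewrite linearP /= mulrDr -scalerAr linearP.
  - by rewrite -mulrA; apply: (qmod a (t * s v) (s (gact l t v)));
    rewrite gactM !sE.
  apply: qJ; rewrite -mulrA; apply: (subvP (addvSr _ _));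
    rewrite memv_mul ?memvf //.
  have sT := subvsP (s v); apply: gcomp_pos_mid.
    by have := memv_mul bB sT; rewrite -prodvA prodv_id.
  rewrite -[X in gcomp R X]addr0 (gcomp_mulr 0 b (mid_degree hD sT)).
  by rewrite (gcomp_other (M := R) bi i0) mul0r.
exists M, tau; split=> //.
  by rewrite tauE -memv_ker kq J_one.
exists tau; split=> // [a b v|i j a v ai vj|W sg [sl1 sl2 sT sB]].
- by rewrite /tau -mulrA; exact: qa.
- have [jd|jd] := eqVneq j d; last first.
    have -> : v = 0 by apply: ggr_disjoint vj _ jd; rewrite ld memvf.
    by rewrite /tau linear0 mulr0 linear0 mem0v.
  apply: qg; rewrite /= jd addrK -[i]addr0.
  have [_ _ /(_ i 0)/prodvP mul] := hA; apply: mul => //.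
  exact: mid_degree hD _ (subvsP (s v)).
pose f0l : {linear A -> W} := HB.pack (fun a => sg a v0)
  (GRing.isLinear.Build _ _ _ _ (fun a => sg a v0) (sl1 v0)).
have sgD a u v : sg a (u + v) = sg a u + sg a v by have := sl2 a 1 u v;
  rewrite !scale1r.
have sg0 a : sg a 0 = 0 by apply: (addrI (sg a 0)); rewrite -sgD !addr0.
pose f0 : 'Hom(greg hA d, W) := linfun f0l.
have f0E a : f0 a = sg a v0 by rewrite lfunE.
have f0J a : a \in J -> f0 a = 0.
  move=> aJ; apply/eqP; rewrite -memv_ker; apply: subvP aJ; rewrite subv_add.
  apply/andP; split; apply/prodvP=> b y _.
    by case/AnnP=> t -> t0; rewrite memv_ker f0E sT t0 sg0.
  move=> yB; rewrite memv_ker f0E.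
  have yi i : gcomp R i y \in Bp by exact: gcomp_Bp.
  have -> : sg (b * y) v0 = f0l (b * y) by [].
  rewrite -(@gcomp_sum _ _ _ R y) mulr_sumr linear_sum /=; apply/eqP;
    apply: big1 => i _.
  have [->|i0] := eqVneq i 0.
    by rewrite gcomp0_Bp // mulr0; exact: (linear0 f0l).
  apply: sB i0 _ (gcomp_in (M := R) i y); have [_ _ _ _ [-> _]] := hD.
  exact: subvP Bp_sub_C _ (yi i).
pose f : 'Hom(M, W) := (f0 \o q^-1)%VF.
have fq a : f (q a) = sg a v0.
  rewrite -f0E comp_lfunE; apply/eqP; rewrite -subr_eq0 -linearB; apply/eqP/f0J.
  by rewrite -kq memv_ker linearB /= limg_lfunVK ?subrr // imq memvf.
have onM m : exists a, m = q a.
  by have /memv_imgP[a _ ->] : m \in limg q; [rewrite imq memvf | exists a].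
exists f; split=> [a v|f' f'P].
  by rewrite /tau fq sT sE.
by apply/lfunP=> m; have [a ->] := onM m; rewrite fq -tauE f'P.
Qed.

End Construction.

Lemma Delta_is_Delta l : simple_gmod l -> is_Delta l (Delta l).
Proof.
move=> sl; have [d ld] := simple_concentrated (sub_mid0 hD) sl.
have v0 : vpick (fullv : {vspace l}) != 0 by rewrite vpick0; case: sl.
apply: chooseP; have [M [tau [_ _ MD]]] := standard_module_exists sl ld v0.
by exists M.
Qed.

End StandardModules.

(** * Simple heads of standard modules *)

Section StandardTop.
Variables (K : fieldType) (D : triple K).
Local Notation A := (talg D).
Local Notation gA := (tgr D).
Local Notation Am := (tneg D).
Local Notation T := (tmid D).
Local Notation Ap := (tpos D).
Hypotheses (hA : graded_algebra gA) (hD : weak_triangular D).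
Local Notation R := (greg0 hA).
Local Notation am k := ((vbasis Am)`_k).
Implicit Types (M N P L : modA D) (l : modT D).

Definition top_generated M l : Prop := exists d (j : 'Hom(l, M)),
  [/\ forall i, d < i -> ggr M i = 0%VS, lker j = 0%VS, limg j = ggr M d,
      forall t v, j (gact l t v) = gact M (vsval t) (j v) & ggr l d = fullv]
  /\ neg_gen (ggr M d) = fullv.

(** The identity of M and a projection onto a subspace X containing all tau a v
    agree on the tau a v, hence are equal. *)
Lemma is_Delta_span l M (tau : A -> l -> M) (X : {vspace M}) : balanced tau ->
  (forall (W : vectType K) (sg : A -> l -> W), balanced sg ->
     exists! f : 'Hom(M, W), forall a v, f (tau a v) = sg a v) ->
  (forall a v, tau a v \in X) -> X = fullv.
Proof.
move=> tb tU tX; apply/vspaceP=> m; rewrite memvf;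
  have [g [_ gU]] := tU M tau tb.
have e1 : g = \1%VF by apply: gU => a v; rewrite id_lfunE.
have e2 : g = projv X by apply: gU => a v; rewrite projv_id.
by rewrite -[m](id_lfunE m) -e1 e2 memv_proj.
Qed.

(** The preimage of U in the simple module l is zero or everything. *)
Lemma top_dichotomy l M d (j : 'Hom(l, M)) (U : {vspace M}) : simple_gmod l ->
  ggr l d = fullv -> limg j = ggr M d ->
  (forall t v, j (gact l t v) = gact M (vsval t) (j v)) -> gsubmod U ->
  (U :&: ggr M d)%VS = 0%VS \/ (ggr M d <= U)%VS.
Proof.
move=> [_ sl] ld imj jT sU; pose X := (j @^-1: U)%VS.
have sX : gsubmod X.
  by apply: (concentrated_gsubmod ld) => t v; rewrite -!memv_preim jT;
    exact: gsubmod_act.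
rewrite -imj; case: (sl X sX) => eX; [left|right].
  apply/eqP; rewrite -subv0; apply/subvP=> u; rewrite memv_cap.
  case/andP=> uU /memv_imgP[v _ eu]; move: uU;
    rewrite eu memv_preim -/X eX !memv0.
  by move=> /eqP->; rewrite linear0.
by apply/subvP=> _ /memv_imgP[v _ ->]; rewrite memv_preim -/X eX memvf.
Qed.

(** The action of A on the top component is balanced: elements of positive
    degree of B^+ lead beyond the largest degree of M. *)
Lemma is_Delta_map l M N : simple_gmod l -> is_Delta l N -> top_weight M l ->
  exists (f : 'Hom(N, M)) v, ghom f /\ f v != 0.
Proof.
move=> [l0 _] [tau [tb tM tg tU]] [d [j [topM kj imj jT ld]]].
have jd v : j v \in ggr M d by rewrite -imj memv_img ?memvf.
have sb : balanced (fun (a : A) (v : l) => gact M a (j v)).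
  split=> [v|a|a t v|a b i v i0 bB bi].
  - exact: gact_linearl.
  - by move=> k u v; rewrite !linearP.
  - by rewrite gactM jT.
  rewrite gactM; suff -> : gact M b (j v) = 0 by rewrite linear0.
  have : b \in (T * pos_part hA)%VS.
    by apply: gcomp_pos_mid bB _ => //; exact: (gcomp_other (M := R) bi i0).
  move=> bTp; apply/eqP; suff : b \in lker (linfun (orbit_map (j v))).
    by rewrite memv_ker lfunE.
  apply: subvP bTp; apply/prodvP=> t x tT xp;
    rewrite memv_ker lfunE /= /orbit_map gactM.
  by rewrite (pos_part_top hD topM xp (jd v)) linear0.
have [f [fP _]] := tU M _ sb.
have span (X : {vspace N}) : (forall a v, tau a v \in X) -> forall m, m \in X.
  by move=> tX m; rewrite (is_Delta_span tb tU tX) memvf.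
have fa a m : f (gact N a m) = gact M a (f m).
  pose X := lker ((f \o linfun (gact N a)) - (linfun (gact M a) \o f))%VF.
  have : m \in X.
    apply: span => b v; apply/eqlfunP; rewrite !comp_lfunE !lfunE /= -tM !fP.
    by rewrite gactM.
  by move/eqlfunP; rewrite !comp_lfunE !lfunE.
have fg i m : f (gcomp N i m) = gcomp M i (f m).
  pose X := lker ((f \o gcomp N i) - (gcomp M i \o f))%VF.
  have : m \in X; last by move/eqlfunP; rewrite !comp_lfunE.
  apply: span => b v; apply/eqlfunP; rewrite !comp_lfunE.
  move: b; apply: (homogeneous_ind hA) => [a b ea eb| |k a ak].
  - have [t1 _ _ _] := tb; have := t1 v 1 a b; rewrite !scale1r => ->.
    by rewrite !linearD /= ea eb.
  - have [t1 _ _ _] := tb; have t0 : tau 0 v = 0.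
      by have := t1 v (-1) 0 0; rewrite scaler0 addr0 scaleN1r addNr.
    by rewrite t0 !linear0.
  have tk : tau a v \in ggr N (k + d) by apply: tg; rewrite // ld memvf.
  have fk : f (tau a v) \in ggr M (k + d) by rewrite fP gact_graded.
  have [<-|ki] := eqVneq (k + d) i; first by rewrite !gcomp_id.
  by rewrite (gcomp_other tk ki) (gcomp_other fk ki) linear0.
exists f, (tau 1 (vpick fullv)); split; first exact: ghomP.
by rewrite fP gact1 -memv_ker kj memv0 vpick0.
Qed.

(** The top component is 1 (x) l.  That the map v |-> 1 (x) v is injective is
    tested on one balanced map for which it does not vanish. *)
Lemma is_Delta_top l M : simple_gmod l -> is_Delta l M -> top_generated M l.
Proof.
move=> sl [tau [tb tM tg tU]];
  have [d ld] := simple_concentrated (sub_mid0 hD) sl.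
have [t1 t2 tT tB] := tb.
pose jl : {linear l -> M} := HB.pack (tau 1) (GRing.isLinear.Build _ _ _ _ (tau
  1) (t2 1)).
pose j : 'Hom(l, M) := linfun jl.
have jE v : j v = tau 1 v by rewrite lfunE.
have tE a v : tau a v = gact M a (j v) by rewrite jE -tM mulr1.
have jT t v : j (gact l t v) = gact M (vsval t) (j v).
  by rewrite -tE jE -tT mul1r.
have jd v : j v \in ggr M d.
  by rewrite jE -[d]add0r tg ?ld ?memvf //; case: hA.
have jpos x v : x \in pos_part hA -> gact M x (j v) = 0.
  rewrite memv_cap memv_ker => /andP[xA /eqP x0];
    rewrite -tE -(@gcomp_sum _ _ _ R x).
  rewrite tE gact_suml big1 // => i _; rewrite -tE.
  have [->|i0] := eqVneq i 0.
    by rewrite x0 tE gact0l.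
  rewrite -[X in tau X]mul1r; apply: tB i0 _ (gcomp_in (M := R) i x).
  by rewrite -[X in X \in _]mulr1 memv_mul ?memv1_mid ?(gcomp_pos hA hD).
have jstable t v : t \in T -> v \in limg j -> gact M t v \in limg j.
  move=> sT /memv_imgP[u _ ->].
  by rewrite -(vsproj_mid sT) -jT memv_img ?memvf.
have full : neg_gen (limg j) = fullv.
  apply: (is_Delta_span tb tU) => b v; rewrite tE.
  suff : b \in (linfun (orbit_map (j v)) @^-1: neg_gen (limg j))%VS.
    by rewrite -memv_preim lfunE.
  apply: (algebra_ind hD) b => a c aA cC;
    rewrite -memv_preim lfunE /= /orbit_map gactM.
  rewrite (neg_gen_mem aA) //.
  suff : c \in (linfun (orbit_map (j v)) @^-1: limg j)%VS
    by rewrite -memv_preim lfunE.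
  apply: subvP cC; apply/prodvP=> t x tT' xA;
    rewrite -memv_preim lfunE /= /orbit_map gactM.
  apply: jstable tT' _; have [k [y [yp ->]]] := pos_decomp hA hD xA.
  by rewrite gactDl (jpos _ _ yp) addr0 gactZl gact1 memvZ // memv_img ?memvf.
have gcj i k v : gcomp M (i + d) (gact M (am k) (j v))
  = gact M (gcomp R i (am k)) (j v).
  exact: gcomp_orbit.
have topM i : d < i -> ggr M i = 0%VS.
  move=> di; apply/eqP; rewrite -subv0; apply/subvP=> u ui;
    rewrite memv0 -(gcomp_id ui).
  have /neg_genP[x [xX ->]] : u \in neg_gen (limg j) by rewrite full memvf.
  rewrite linear_sum big1 // => k _ /=; have /memv_imgP[v _ ->] := xX k.
  rewrite -[i](subrK d) gcj (neg_gt0 hA hD) ?gact0l ?subr_gt0 //.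
  exact: neg_basis.
have imj : limg j = ggr M d.
  apply/eqP; rewrite eqEsubv; apply/andP; split.
    by apply/subvP=> _ /memv_imgP[v _ ->].
  apply/subvP=> u ud; rewrite -(gcomp_id ud).
  have /neg_genP[x [xX ->]] : u \in neg_gen (limg j) by rewrite full memvf.
  rewrite linear_sum; apply: memv_suml => k _ /=;
    have /memv_imgP[v _ ->] := xX k.
  rewrite -[d in gcomp M d]add0r gcj.
  have [s ->] := neg_scalar hA hD (neg_basis k).
  by rewrite gactZl gact1 memvZ // memv_img ?memvf.
have v0 : vpick (fullv : {vspace l}) != 0 by rewrite vpick0; case: sl.
have [N [tau' [tb' t'0 _]]] := standard_module_exists hA hD sl ld v0.
have [g [gP _]] := tU N tau' tb'.
have kj : lker j = 0%VS.
  have skj : gsubmod (lker j).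
    apply: (concentrated_gsubmod ld) => t v; rewrite !memv_ker jT => /eqP->.
    by rewrite linear0.
  case: (proj2 sl _ skj) => // e; case/eqP: t'0.
  have /eqP : j (vpick fullv) == 0 by rewrite -memv_ker e memvf.
  by rewrite jE -gP => ->; rewrite linear0.
by exists d, j; split=> //; rewrite -imj.
Qed.

(** A module generated by its top component has a largest proper submodule:
    a submodule is proper exactly when it misses the top component. *)
Lemma top_generated_head M l : simple_gmod l -> top_generated M l ->
  exists L, [/\ simple_gmod L, simple_head M L & top_weight L l].
Proof.
move=> [l0 sl] [d [j [[topM kj imj jT ld] full]]].
have Md0 : ggr M d != 0%VS by rewrite -imj; apply: limg_neq0 l0 kj.
have prop U : gsubmod U -> U <> fullv -> (U :&: ggr M d)%VS = 0%VS.
  move=> sU UT; case: (top_dichotomy (conj l0 sl) ld imj jT sU) => // MU.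
  by case: UT; apply/eqP; rewrite eqEsubv subvf -full neg_gen_min.
pose Q (U : {vspace M}) := gsubmod U /\ (U :&: ggr M d)%VS = 0%VS.
have [||U [[sU UM] maxU]] := @ex_maxf _ Q (fun U => \dim U) (\dim {: M}).
- by exists 0%VS; split; [exact: gsubmod0 | rewrite cap0v].
- by move=> U _; exact: dimvS (subvf _).
have maxU' V : gsubmod V -> V = fullv \/ (V <= U)%VS.
  move=> sV; have [->|/eqP VT] := eqVneq V fullv; [by left|right].
  have VM := prop V sV VT; apply/addv_idPr/eqP;
    rewrite eq_sym eqEdim addvSr maxU //.
  split; first exact: gsubmodD.
  apply/eqP; rewrite -subv0; apply/subvP=> x; rewrite memv_cap => /andP[xUV xd].
  have /memv_addP[v vV [u uU ex]] := xUV; rewrite -(gcomp_id xd) ex linearD /=.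
  have -> : gcomp M d v = 0.
    by apply/eqP; rewrite -memv0 -VM memv_cap gsubmod_gcomp // gcomp_in.
  have -> : gcomp M d u = 0.
    by apply/eqP; rewrite -memv0 -UM memv_cap gsubmod_gcomp // gcomp_in.
  by rewrite addr0 mem0v.
have [L [q [hq kq imq]]] := gquo_exists sU.
have qinj v : v \in ggr M d -> q v = 0 -> v = 0.
  move=> vd qv; apply/eqP; rewrite -memv0 -UM memv_cap vd andbT -kq memv_ker qv
    //.
have injj : injective j by apply/lker0P; rewrite kj.
have grL i : ggr L i = (q @: ggr M i)%VS.
  apply/vspaceP=> w; have /memv_imgP[v _ ->] : w \in limg q
    by rewrite imq memvf.
  have [_ qg] := hq; apply/idP/memv_imgP=> [qvi|[u ui ->]]; last exact: qg.
  exists (gcomp M i v); first exact: gcomp_in.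
  by rewrite (ghom_gcomp _ _ hq) gcomp_id.
exists L; split.
- split.
    apply: contraNneq Md0 => L0; rewrite -subv0; apply/subvP=> v vd;
      rewrite memv0.
    apply/eqP/(qinj v vd); have := memvf (q v); rewrite L0 memv0; exact: eqP.
  move=> V sV; have eV : (q @: (q @^-1: V))%VS = V
    by rewrite lpreimK // imq subvf.
  case: (maxU' _ (gsubmod_preim hq sV)) => e; [right|left]; rewrite -eV.
    by rewrite e imq.
  apply/eqP; rewrite -subv0; apply/subvP=> _ /memv_imgP[v /(subvP e) vU ->].
  by rewrite memv0 -memv_ker kq.
- by exists q; split=> //; rewrite kq.
exists d, (q \o j)%VF; split=> //.
- by move=> i di; rewrite grL topM // limg0.
- apply/eqP/lker0P=> u v; rewrite !comp_lfunE => quv; apply: injj; apply/eqP.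
  rewrite -subr_eq0; apply/eqP/qinj; last by rewrite linearB /= quv subrr.
  by rewrite -linearB -imj memv_img ?memvf.
- by rewrite limg_comp imj grL.
by move=> t v; rewrite !comp_lfunE jT; case: hq => qa _; rewrite qa.
Qed.

Lemma Delta_top_generated l : simple_gmod l -> top_generated (Delta l) l.
Proof. by move=> sl; apply: is_Delta_top => //; exact: Delta_is_Delta. Qed.

Lemma Lmod_spec (x : IrrT D) :
  [/\ simple_gmod (Lmod x), simple_head (Delta (irr_rep x)) (Lmod x)
    & top_weight (Lmod x) (irr_rep x)].
Proof.
have sx := irr_rep_simple x.
have [L [sL hdL wL]] := top_generated_head sx (Delta_top_generated sx).
have : hd_iso (Delta (irr_rep x)) (Lmod x).
  by apply: chooseP; exists L; exact: simple_head_hd.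
move/(hd_iso_giso (simple_head_hd sL hdL)) => isoL; split.
- exact: giso_simple isoL sL.
- have [p [hp imp maxp]] := hdL; have [f hf [kf imf]] := gisoW isoL.
  exists (f \o p)%VF; split; first exact: ghom_comp.
    by rewrite limg_comp imp.
  move=> U /maxp[->|Up]; [by left | right].
  apply: subv_trans Up _; apply/subvP=> v;
    rewrite !memv_ker comp_lfunE => /eqP->.
  by rewrite linear0.
exact: top_weight_giso isoL wL.
Qed.

Lemma Lmod_simple (x : IrrT D) : simple_gmod (Lmod x).
Proof. by case: (Lmod_spec x). Qed.

Lemma Lmod_weight (x : IrrT D) : top_weight (Lmod x) (irr_rep x).
Proof. by case: (Lmod_spec x). Qed.

Lemma Delta_onto_simple l M :
  simple_gmod l -> simple_gmod M -> top_weight M l ->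
  exists2 f : 'Hom(Delta l, M), ghom f & limg f = fullv.
Proof.
move=> sl sM wM.
have [f [v [hf fv]]] := is_Delta_map sl (Delta_is_Delta hA hD sl) wM.
by exists f => //; exact: simple_surj sM hf fv.
Qed.

Lemma Lmod_unique M (x : IrrT D) : simple_gmod M -> top_weight M (irr_rep x) ->
  giso M (Lmod x).
Proof.
move=> sM wM; have [sL hdL _] := Lmod_spec x.
have [f hf imf] := Delta_onto_simple (irr_rep_simple x) sM wM.
have [p [hp imp maxp]] := simple_head_quo sL hdL hf imf (proj1 sM).
apply: (giso_bij hp _ imp); case: (proj2 sM _ (gsubmod_ker hp)) => // e.
by have := lker_neqT (proj1 sL) imp; rewrite e eqxx.
Qed.

End StandardTop.

Section IrrClasses.
Variables (K : fieldType) (B : falgType K) (gB : int -> {vspace B}).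

Lemma irr_repE (x : Irr gB) : sval x = giso (irr_rep x).
Proof. by rewrite /irr_rep; case: cid2. Qed.

Lemma irr_eq (x y : Irr gB) : giso (irr_rep x) (irr_rep y) -> x = y.
Proof.
move=> xy; have eC : sval x = sval y.
  rewrite !irr_repE; apply/funext=> M; apply/propext; split.
    exact: giso_trans (giso_sym xy).
  exact: giso_trans xy.
by case: x y eC {xy} => [C hC] [C' hC'] /= e; subst C'; congr exist;
  exact: Prop_irrelevance.
Qed.

Lemma irr_class_rep (M : gmod gB) (sM : simple_gmod M) :
  giso M (irr_rep (irr_class sM)).
Proof.
have := irr_repE (irr_class sM); rewrite /= => e.
suff : giso (irr_rep (irr_class sM)) M by exact: giso_sym.
by rewrite -e; exact: giso_refl.
Qed.

Lemma irr_of_simple (M : gmod gB) : simple_gmod M -> exists x :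
  Irr gB, giso M (irr_rep x).
Proof. by move=> sM; exists (irr_class sM); exact: irr_class_rep. Qed.

End IrrClasses.

(** * Highest weights of projective covers *)

Section HighestWeights.
Variables (K : fieldType) (D : triple K).
Local Notation A := (talg D).
Local Notation gA := (tgr D).
Hypotheses (hA : graded_algebra gA) (hD : weak_triangular D).
Implicit Types (M N P L : modA D) (l : modT D) (x y : IrrT D).

Lemma deg_spec x : ggr (irr_rep x) (deg x) = fullv.
Proof.
exact: chooseP (simple_concentrated (sub_mid0 hD) (irr_rep_simple x)).
Qed.

Lemma simple_is_Lmod M : simple_gmod M -> exists x, giso M (Lmod x).
Proof.
move=> sM; have [l sl wM] := simple_top_weight hA hD sM.
have [x lx] := irr_of_simple sl; exists x; apply: (Lmod_unique hA hD sM).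
exact: top_weight_giso_r lx wM.
Qed.

Lemma Lmod_inj x y : giso (Lmod x) (Lmod y) -> x = y.
Proof.
move=> xy; apply: irr_eq; apply: (top_weight_unique (M := Lmod y)).
- exact: irr_rep_simple.
- exact: irr_rep_simple.
- exact: top_weight_giso xy (Lmod_weight hA hD x).
exact: Lmod_weight.
Qed.

(** In a composition series exactly one factor meets the simple top component
    of P.  That factor is L(x), and the others live in smaller degrees. *)
Lemma composition_factors P x n (F : nat -> {vspace P}) :
  top_weight P (irr_rep x) -> gfiltration (@simple_gmod K A gA) n F ->
  #|[set i : 'I_n | `[< subquo_iso (F i.+1) (F i) (Lmod x) >]]| = 1%N /\
  forall y (i : 'I_n), subquo_iso (F i.+1) (F i) (Lmod y) ->
    y = x \/ deg y < deg x.
Proof.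
move=> [d [j [topP kj imj jT ld]]] [F0 Fn Fstep].
have [l0 sl] := irr_rep_simple x;
  have ed := concentrated_unique l0 ld (deg_spec x).
have Pd0 : ggr P d != 0%VS by rewrite -imj; apply: limg_neq0 l0 kj.
have sF i : (i <= n)%N -> gsubmod (F i).
  case: i => [_|i ltin]; first by rewrite F0; exact: gsubmod0.
  by have [] := Fstep i ltin.
have alt i : (i <= n)%N -> ~~ (ggr P d <= F i)%VS ->
  (F i :&: ggr P d)%VS = 0%VS.
  by move=> lein /negP nb; case: (top_dichotomy (conj l0 sl) ld imj jT (sF i
    lein)).
pose b i := (ggr P d <= F i)%VS.
have bmono i k : (i <= k)%N -> (k <= n)%N -> b i -> b k.
  move=> leik lekn bi; elim: k leik lekn => [|k IHk];
    first by rewrite leqn0 => /eqP<-.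
  rewrite leq_eqVlt => /orP[/eqP<- //|]; rewrite ltnS => leik ltkn.
  have [_ FF _] := Fstep k ltkn; apply: subv_trans FF; apply: IHk => //;
    exact: ltnW.
(* The filtration swallows the top component at a single step i0. *)
have [i0 [lti0 nb0 b1]] : exists i, [/\ (i < n)%N, ~~ b i & b i.+1].
  have exb : exists k, b k && (k <= n)%N by exists n;
    rewrite leqnn andbT /b Fn subvf.
  case: (ex_minnP exb) => -[|k] /andP[bk lekn] mink.
    by case/negP: Pd0; rewrite -subv0 -F0.
  exists k; split=> //; apply/negP=> bk'; have := mink k;
    rewrite bk' (ltnW lekn) ltnn.
  by move/(_ isT).
have jumpU i : (i < n)%N -> ~~ b i -> b i.+1 -> i = i0.
  move=> ltin nbi bi1; have [ii0|ii0|//] := ltngtP i i0.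
    by case/negP: nb0; apply: bmono bi1 => //; exact: ltnW.
  by case/negP: nbi; apply: bmono b1 => //; exact: ltnW.
have jump N : subquo_iso (F i0.+1) (F i0) N -> giso N (Lmod x).
  move=> isoN; have [_ FF [N' sN' isoN']] := Fstep i0 lti0.
  have isoNN := subquo_giso (sF _ lti0) isoN' isoN.
  apply: (Lmod_unique hA hD (giso_simple isoNN sN')).
  have [f [fa fg fU kf]] := isoN.
  have inF v : j v \in F i0.+1 by rewrite (subvP b1) // -imj memv_img ?memvf.
  have grN i w : w \in ggr N i -> exists2 v,
    v \in (F i0.+1 :&: ggr P i)%VS & w = f v.
    move=> wi; have /memv_imgP[v vF ew] : w \in (f @: F i0.+1)%VS
      by rewrite fU memvf.
    exists (gcomp P i v); first
      by rewrite memv_cap gcomp_in (gsubmod_gcomp i (sF _ lti0) vF).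
    by rewrite (gcomp_graded_on i (sF _ lti0) fg) // -ew gcomp_id.
  exists d, (f \o j)%VF; split=> //.
  - move=> i di; apply/eqP; rewrite -subv0; apply/subvP=> w /grN[v].
    by rewrite memv_cap topP // memv0 => /andP[_ /eqP->] ->;
      rewrite linear0 mem0v.
  - apply/eqP; rewrite -subv0 -kj; apply/subvP=> v;
    rewrite !memv_ker comp_lfunE => fjv.
    rewrite -memv0 -(alt i0 (ltnW lti0) nb0) memv_cap -imj memv_img ?memvf //
      andbT.
    by rewrite -kf memv_cap inF memv_ker.
  - apply/vspaceP=> w; apply/memv_imgP/idP=> [[v _ ->]|/grN[v]].
      by rewrite comp_lfunE fg // -imj memv_img ?memvf.
    rewrite memv_cap -imj => /andP[_ /memv_imgP[u _ ->]] ->.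
    by exists u; rewrite ?memvf // comp_lfunE.
  by move=> t v; rewrite !comp_lfunE jT fa.
have nojump y (i : 'I_n) : subquo_iso (F i.+1) (F i) (Lmod y) ->
  i <> i0 :> nat ->
    deg y < deg x.
  move=> [f [fa fg fU kf]] ii0; rewrite ltNge; apply/negP=> ledy.
  have [k [jy [_ kjy imjy _ ky]]] := Lmod_weight hA hD y.
  have [ly0 _] := irr_rep_simple y;
    have ek := concentrated_unique ly0 ky (deg_spec y).
  have : ggr (Lmod y) k != 0%VS by rewrite -imjy; apply: limg_neq0 ly0 kjy.
  rewrite -subv0 => /subvPn[w wk]; rewrite memv0.
  have /memv_imgP[v vF ew] : w \in (f @: F i.+1)%VS by rewrite fU memvf.
  have lti := ltn_ord i; have sFi := sF _ lti.
  rewrite -(gcomp_id wk) ew -(gcomp_graded_on k sFi fg) //.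
  have vkF := gsubmod_gcomp k sFi vF; have vkk := gcomp_in k v.
  have [dk|] := ltP d k.
    by move: vkk; rewrite (topP k dk) memv0 => /eqP->; rewrite linear0 eqxx.
  move=> kd; have ekd : k = d by apply/eqP; rewrite eq_le kd ed ek.
  have [bi|nbi] := boolP (b i).
    have : gcomp P k v \in F i by rewrite (subvP bi) // -ekd.
    by rewrite -kf memv_cap memv_ker => /andP[_ ->].
  have [bi1|nbi1] := boolP (b i.+1); first by case: ii0; exact: jumpU.
  have : gcomp P k v \in (F i.+1 :&: ggr P d)%VS by rewrite memv_cap vkF -ekd.
  by rewrite alt // memv0 => /eqP->; rewrite linear0 eqxx.
split=> [|y i isoy].
  rewrite (_ : [set i | _] = [set Ordinal lti0]) ?cards1 //.
  apply/setP=> i; rewrite !inE; apply/asboolP/eqP=> [isoi|->].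
    apply: val_inj => /=; apply: contrapT => /(nojump _ _ isoi).
    by rewrite ltxx.
  have [_ _ [N sN isoN]] := Fstep i0 lti0.
  exact: subquo_giso_r isoN (jump N isoN).
have [ei|ni] := pselect (i = i0 :> nat); last by right; exact: nojump ni.
by left; rewrite ei in isoy; apply: Lmod_inj; exact: jump.
Qed.

(** The multiplicity is the number of factors in some composition series, and
    composition_factors applies to all of them. *)
Lemma top_weight_highest P x :
  top_weight P (irr_rep x) -> has_highest_weight P x.
Proof.
move=> wP; have multE S : exists n (F : nat -> {vspace P}),
    gfiltration (@simple_gmod K A gA) n F /\
    mult P S = #|[set i : 'I_n | `[< subquo_iso (F i.+1) (F i) S >]]|.
  apply: (@chooseP nat 0%N (fun m => exists n (F : nat -> {vspace P}),
    gfiltration (@simple_gmod K A gA) n F /\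
    m = #|[set i : 'I_n | `[< subquo_iso (F i.+1) (F i) S >]]|)).
  have [n [F FP]] := composition_series_exists P.
  by exists #|[set i : 'I_n | `[< subquo_iso (F i.+1) (F i) S >]]|, n, F.
split=> [|y].
  by have [n [F [FP ->]]] := multE (Lmod x);
    have [] := composition_factors wP FP.
have [n [F [FP ->]]] := multE (Lmod y);
  have [_ fac] := composition_factors wP FP.
move/eqP; rewrite cards_eq0 => /set0Pn[i]; rewrite inE => /asboolP; exact: fac.
Qed.

Lemma highest_weight_unique M x y :
  has_highest_weight M x -> has_highest_weight M y -> x = y.
Proof.
move=> [mx hx] [my hy].
have [|e|yx] := hx y; rewrite ?my //; have [|//|xy] := hy x; rewrite ?mx //.
by have := lt_trans xy yx; rewrite ltxx.
Qed.

Lemma hw_eq x y : top_weight (Pmod x) (irr_rep y) -> hw x = y.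
Proof.
move=> w; apply: highest_weight_unique (top_weight_highest w).
by apply: chooseP; exists y; exact: top_weight_highest.
Qed.

Lemma Pmod_cover x : projective_cover (Pmod x) (Lmod x).
Proof. exact: chooseP (projective_cover_exists hA (Lmod_simple hA hD x)). Qed.

(** A nonzero map Delta l -> P is injective on the simple top component, hence
    everywhere because A^- acts freely on the top component of P. *)
Lemma Delta_embeds l P L :
  simple_gmod l -> simple_gmod L -> projective_cover P L ->
  top_weight P l -> exists i : 'Hom(Delta l, P), ghom i /\ lker i = 0%VS.
Proof.
move=> sl sL cP wP; have [e [i [r [hi hr iK]]]] := cover_retract hA sL cP.
have [f [v [hf fv]]] := is_Delta_map hA hD sl (Delta_is_Delta hA hD sl) wP.
have [d [j [[topN kj imj jT ld] full]]] := Delta_top_generated hA hD sl.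
have [d' [j' [topP kj' imj' _ ld']]] := wP.
have [l0 lsim] := sl; have ed := concentrated_unique l0 ld ld';
  rewrite -ed in topP.
exists f; split=> //; have [fa fg] := hf.
have injd u : u \in ggr (Delta l) d -> f u = 0 -> u = 0.
  rewrite -imj => /memv_imgP[w _ ->] fw.
  have sk : gsubmod (lker (f \o j)%VF).
    apply: (concentrated_gsubmod ld) => t z;
      rewrite !memv_ker !comp_lfunE jT fa.
    by move=> /eqP->; rewrite linear0.
  case: (lsim _ sk) => e0.
    have : w \in lker (f \o j)%VF by rewrite memv_ker comp_lfunE fw.
    by rewrite e0 memv0 => /eqP->; rewrite linear0.
  case/eqP: fv; have /neg_genP[z [zX ->]] : v \in neg_gen (ggr (Delta l) d).
    by rewrite full memvf.
  rewrite linear_sum big1 // => k _; have := zX k;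
    rewrite -imj => /memv_imgP[u' _ ->] /=.
  have : u' \in lker (f \o j)%VF by rewrite e0 memvf.
  by rewrite fa memv_ker comp_lfunE => /eqP->; rewrite linear0.
apply/eqP; rewrite -subv0; apply/subvP=> u; rewrite memv_ker memv0.
have /neg_genP[z [zX ->]] : u \in neg_gen (ggr (Delta l) d)
  by rewrite full memvf.
rewrite linear_sum => /eqP fz; rewrite big1 // => k _.
suff -> : z k = 0 by rewrite linear0.
apply: (injd _ (zX k)); move: k.
have fzd k : f (z k) \in ggr P d by apply: fg.
apply: (top_free hD topP hi hr iK fzd).
by apply: etrans fz; apply: eq_bigr => k _; rewrite /= fa.
Qed.

End HighestWeights.

(** * Top components over a self-injective algebra *)

Section SelfInjective.
Variables (K : fieldType) (D : triple K).
Local Notation A := (talg D).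
Local Notation gA := (tgr D).
Local Notation T := (tmid D).
Hypotheses (hA : graded_algebra gA) (hD : weak_triangular D).
Implicit Types (M N P L : modA D) (l : modT D) (x y : IrrT D).

Lemma cover_injective P L :
  self_injective A -> simple_gmod L -> projective_cover P L ->
  injective_gmod P.
Proof.
move=> iA sL cP; have [e [i [r [hi hr iK]]]] := cover_retract hA sL cP.
exact: retract_injective hi hr iK (self_injective_greg iA).
Qed.

Lemma cover_neq0 P L : simple_gmod L -> projective_cover P L ->
  fullv != 0%VS :> {vspace P}.
Proof.
move=> [L0 _] [_ [p [_ imp _]]]; apply: contra L0 => /eqP P0.
by rewrite -imp P0 limg0.
Qed.

(** Disjoint T-submodules of the top component generate disjoint submodules,
    of which one vanishes because P is uniform.  By semisimplicity of T, a
    proper nonzero T-submodule would be disjoint from some nonzero one. *)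
Lemma cover_top_weight P L : semisimple_algebra (subvs_of T) ->
  simple_gmod L -> projective_cover P L -> injective_gmod P ->
  exists x, top_weight P (irr_rep x).
Proof.
move=> [s smin sfull] sL cP iP; have P0 := cover_neq0 sL cP.
have [d Pd topP] := top_degree P0.
have [e [i [r [hi hr iK]]]] := cover_retract hA sL cP.
suff minX X : mid_stable d X -> X = 0%VS \/ X = ggr P d.
  have [l sl wP] := top_weight_exists hA hD Pd topP minX.
  have [x lx] := irr_of_simple sl; exists x; exact: top_weight_giso_r lx wP.
move=> sX; have [Xd TX] := sX; have [->|XPd] := eqVneq X (ggr P d);
  [by right|left].
have [v vd vX] : exists2 v, v \in ggr P d & v \notin X.
  by apply/subvPn; apply: contra XPd => PX; rewrite eqEsubv Xd.
pose f := (linfun (orbit_map v) \o linfun vsval)%VF : 'Hom(subvs_of T, P).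
have fE t : f t = gact P (vsval t) v by rewrite comp_lfunE !lfunE.
(* Some minimal left ideal I moves v outside X; by minimality I v misses X. *)
have [I Is IX] : exists2 I, I \in s & ~~ (f @: I <= X)%VS.
  apply: contrapT => no; case/negP: vX; rewrite -(gact1 v) -(subvs_one hD) -fE.
  have : (f @: fullv <= X)%VS; last by move/subvP; apply;
    rewrite memv_img ?memvf.
  rewrite -sfull big_seq; apply: (big_ind (fun Y => f @: Y <= X)%VS).
  - by rewrite limg0 sub0v.
  - by move=> Y Z fY fZ; rewrite limgD subv_add fY.
  by move=> I Is; apply: contrapT => /negP IX; apply: no; exists I.
have [II I0 minI] := smin I Is.
pose J := (I :&: f @^-1: X)%VS.
have JJ : (fullv * J <= J)%VS.
  apply/prodvP=> b c _; rewrite !memv_cap -!memv_preim => /andP[cI fc].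
  rewrite (subvP II) ?memv_mul ?memvf //= fE gactM -fE TX ?subvsP //.
have J0 : J = 0%VS.
  have [//|eJ] := minI J JJ (capvSl _ _); case/negP: IX; rewrite -eJ.
  by apply/subvP=> _ /memv_imgP[c + ->];
    rewrite memv_cap -memv_preim => /andP[].
pose Y := (f @: I)%VS.
have sY : mid_stable d Y.
  split=> [|t _ tT /memv_imgP[c cI ->]].
    apply/subvP=> _ /memv_imgP[c cI ->]; rewrite fE -[d]add0r gact_graded //.
    exact: mid_degree hD _ (subvsP c).
  apply/memv_imgP; exists (vsproj T t * c);
    first by rewrite (subvP II) ?memv_mul ?memvf.
  by rewrite !fE /= gactM vsproj_mid.
have XY : (X :&: Y = 0)%VS.
  apply/eqP; rewrite -subv0; apply/subvP=> u; rewrite memv_cap => /andP[uX].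
  case/memv_imgP=> c cI eu;
    have : c \in J by rewrite memv_cap cI -memv_preim -eu.
  by rewrite J0 eu !memv0 => /eqP->; rewrite linear0.
have := neg_gen_disjoint hD topP hi hr iK sX sY XY.
case/(injective_uniform sL (cover_simple_head sL cP) iP
       (neg_gen_gsubmod hA hD topP sX) (neg_gen_gsubmod hA hD topP sY)) => e0.
  by apply/eqP; rewrite -subv0 -e0; exact: neg_gen_sub.
case/negP: IX; apply: subv_trans (sub0v X); rewrite -e0; exact: neg_gen_sub.
Qed.

End SelfInjective.

(** * Shifts of weights *)

Section Shifts.
Variables (K : fieldType) (D : triple K).
Local Notation gA := (tgr D).
Local Notation T := (tmid D).
Hypotheses (hA : graded_algebra gA) (hD : weak_triangular D).
Implicit Types (M N P L : modA D) (l : modT D) (x y : IrrT D).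

Definition shift_irr x (e : int) :
  IrrT D := irr_class (simple_shift e (irr_rep_simple x)).

Lemma shift_irr_rep x e : giso (gshift (irr_rep x) e) (irr_rep (shift_irr x e)).
Proof. exact: irr_class_rep. Qed.

Lemma giso_shift (B : falgType K) (gB : int -> {vspace B}) (M N : gmod gB) e :
  giso M N -> giso (gshift M e) (gshift N e).
Proof.
move=> [f [g [hf hg fK gK]]]; exists f, g; split=> //.
  exact: (iffLR (@ghom_shift _ _ _ M N e f)).
exact: (iffLR (@ghom_shift _ _ _ N M e g)).
Qed.

Lemma shift_irrK x e : shift_irr (shift_irr x e) (- e) = x.
Proof.
apply: irr_eq; apply: giso_trans (giso_sym (shift_irr_rep _ _)) _.
apply: giso_trans (giso_shift (- e) (giso_sym (shift_irr_rep x e))) _.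
have ggE i : ggr (gshift (gshift (irr_rep x) e) (- e)) i = ggr (irr_rep x) i.
  by rewrite /= opprK addrK.
exists \1%VF, \1%VF; split; try by move=> v; rewrite !id_lfunE.
  by split=> [a v|i v]; rewrite !id_lfunE // ggE.
by split=> [a v|i v]; rewrite !id_lfunE // ggE.
Qed.

Lemma top_weight_shift M l e :
  top_weight M l -> top_weight (gshift M e) (gshift l e).
Proof.
move=> [d [j [topM kj imj jT ld]]]; exists (d + e), j; split=> //=;
  rewrite ?addrK //.
by move=> i di; rewrite topM // ltrBrDr.
Qed.

Lemma simple_soc_shift (B : falgType K) (gB : int -> {vspace B}) (M S :
  gmod gB) e :
  simple_soc M S -> simple_soc (gshift M e) (gshift S e).
Proof.
move=> [j [hj kj minj]]; exists j; split=> //.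
  exact: (iffLR (@ghom_shift _ _ _ S M e j)).
by move=> U sU; apply: minj; exact: (iffRL (@gsubmod_shift _ _ _ M e U)).
Qed.

Lemma Lmod_shift x e : giso (gshift (Lmod x) e) (Lmod (shift_irr x e)).
Proof.
apply: (Lmod_unique hA hD); first exact/simple_shift/Lmod_simple.
apply: top_weight_giso_r (shift_irr_rep x e) _.
by apply: top_weight_shift; exact: Lmod_weight.
Qed.

Lemma Pmod_shift x e : giso (gshift (Pmod x) e) (Pmod (shift_irr x e)).
Proof.
apply: cover_unique (projective_cover_shift e (Pmod_cover hA hD x)) _
  (Lmod_shift x e).
exact: Pmod_cover.
Qed.

(** Simple T-modules are quotients of the finitely many simple summands of the
    regular module, so up to shift there are only finitely many of them. *)
Lemma finite_shift_orbits : semisimple_algebra (subvs_of T) ->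
  exists (m : nat) (c : IrrT D -> 'I_m),
    forall x y, c x = c y -> exists e, y = shift_irr x e.
Proof.
move=> [s smin sfull].
(* The summands of the regular module that have the simple module of x as
   a quotient classify x up to shift. *)
pose hits x (i : 'I_(size s)) := exists (v : irr_rep x) b,
  b \in (nth 0%VS s i) /\ gact (irr_rep x) b v != 0.
have exh x : exists i, hits x i.
  apply: contrapT => no; have [l0 _] := irr_rep_simple x.
  have v0 : vpick (fullv : {vspace irr_rep x}) != 0 by rewrite vpick0.
  case/negP: v0; rewrite -(gact1 (vpick _)).
  have : (fullv <= lker (linfun (orbit_map (vpick (fullv : {vspace irr_rep
    x})))))%VS.
    rewrite -sfull big_seq; apply: (big_ind (fun Y => Y <= _)%VS).
    - exact: sub0v.
    - by move=> Y Z fY fZ; rewrite subv_add fY.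
    move=> I Is; apply/subvP=> b bI; rewrite memv_ker lfunE;
      apply: contrapT => /negP bv.
    apply: no; have lti : (index I s < size s)%N by rewrite index_mem.
    by exists (Ordinal lti), (vpick fullv), b; rewrite /= nth_index.
  by move/subvP/(_ 1 (memvf _)); rewrite memv_ker lfunE.
exists (size s), (fun x => sval (cid (exh x))) => x y.
case: (cid (exh x)) (cid (exh y)) =>
  i [v [b [bI bv]]] [i' [v' [b' [b'I b'v']]]] /= ei.
rewrite -ei in b'I; have [II I0 minI] := smin (nth 0%VS s i) (mem_nth 0%VS
  (ltn_ord i)).
set I := (nth 0%VS s i) in bI b'I II I0 minI.
have sub0 := sub_mid0 hD.
have inj (z : IrrT D) (w : irr_rep z) c : c \in I ->
  gact (irr_rep z) c w != 0 ->
    (I :&: lker (linfun (orbit_map w)))%VS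
      = 0%VS /\ (linfun (orbit_map w) @: I)%VS = fullv.
  move=> cI cw; split.
    case: (minI (I :&: lker (linfun (orbit_map w)))%VS) => //; last 1 first.
    - by move=> e; case/negP: cw; move: cI;
      rewrite -{1}e memv_cap memv_ker lfunE => /andP[].
    - apply/prodvP=> a c' _; rewrite !memv_cap !memv_ker !lfunE /= /orbit_map.
      move=> /andP[c'I /eqP c'w]; rewrite (subvP II) ?memv_mul ?memvf //=.
      by rewrite gactM c'w linear0.
    exact: capvSl.
  have sI : gsubmod (linfun (orbit_map w) @: I)%VS.
    apply: (concentrated_gsubmod (deg_spec hD z)) => a _ /memv_imgP[c' c'I ->].
    apply/memv_imgP; exists (a * c');
      first by rewrite (subvP II) ?memv_mul ?memvf.
    by rewrite !lfunE /= /orbit_map gactM.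
  case: (proj2 (irr_rep_simple z) _ sI) => // e0; case/negP: cw;
    rewrite -memv0 -e0.
  by apply/memv_imgP; exists c; rewrite ?lfunE.
have [kv imv] := inj x v b bI bv; have [kv' imv'] := inj y v' b' b'I b'v'.
pose e := deg y - deg x; exists e; apply: irr_eq; apply: giso_sym.
apply: giso_trans (giso_sym (shift_irr_rep x e)) _.
pose fv := (linfun (orbit_map v) \o projv I)%VF;
  pose fv' := (linfun (orbit_map v') \o projv I)%VF.
have fvE c : c \in I -> fv c = gact (irr_rep x) c v.
  by move=> cI; rewrite comp_lfunE projv_id // lfunE.
have fvE' c : c \in I -> fv' c = gact (irr_rep y) c v'.
  by move=> cI; rewrite comp_lfunE projv_id // lfunE.
pose f : 'Hom(gshift (irr_rep x) e, irr_rep y) := (fv' \o fv^-1)%VF.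
have kfv : (lker fv <= lker fv')%VS.
  apply/subvP=> c; rewrite !memv_ker !comp_lfunE => /eqP fc0.
  suff -> : projv I c = 0 by rewrite linear0.
  by apply/eqP; rewrite -memv0 -kv memv_cap memv_proj memv_ker fc0 eqxx.
have imfv : limg fv = fullv by rewrite limg_comp limg_proj.
have fP c : c \in I -> f (gact (irr_rep x) c v) = gact (irr_rep y) c v'.
  move=> cI; rewrite -fvE // -fvE' // comp_lfunE; apply/eqP;
    rewrite -subr_eq0 -linearB.
  by rewrite -memv_ker (subvP kfv) // memv_ker linearB /= limg_lfunVK ?subrr //
    imfv memvf.
have onI (u : irr_rep x) : exists2 c, c \in I & u = gact (irr_rep x) c v.
  have /memv_imgP[c cI ->] : u \in (linfun (orbit_map v) @: I)%VS
    by rewrite imv memvf.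
  by exists c; rewrite ?lfunE.
have hf : ghom f.
  apply: (concentrated_ghom (d := deg y)).
  - by rewrite /= /e opprB addrCA subrr addr0; exact: deg_spec.
  - exact: deg_spec.
  move=> a u; have [c cI ->] := onI u.
  have acI : a * c \in I by rewrite (subvP II) ?memv_mul ?memvf.
  by rewrite [gact (gshift _ _) _ _]/= -gactM !fP // gactM.
apply: (giso_bij hf).
  apply/eqP; rewrite -subv0; apply/subvP=> u; have [c cI ->] := onI u.
  rewrite memv_ker fP // => cv'; suff -> : c = 0 by rewrite gact0l mem0v.
  by apply/eqP; rewrite -memv0 -kv' memv_cap cI memv_ker lfunE.
apply/vspaceP=> w; rewrite memvf.
have /memv_imgP[c cI ->] : w \in (linfun (orbit_map v') @: I)%VS
  by rewrite imv' memvf.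
by rewrite lfunE /= /orbit_map -fP // memv_img ?memvf.
Qed.

(** An injective map that commutes with the shifts induces an injective self
    map of the finite set of shift orbits. *)
Lemma equivariant_surjective (f : IrrT D -> IrrT D) :
  semisimple_algebra (subvs_of T) -> injective f ->
  (forall x e, f (shift_irr x e) = shift_irr (f x) e) -> forall y, exists x,
    f x = y.
Proof.
move=> hT injf fsh y; have [m [c cP]] := finite_shift_orbits hT.
(* Among the first m + 1 iterates of y, two lie in the same shift orbit. *)
have [i [k [ik cik]]] : exists i k,
  (i < k)%N /\ c (iter i f y) = c (iter k f y).
  pose g (i : 'I_m.+1) := c (iter i f y).
  have ninj : ~ injective g by move=> /leq_card; rewrite !card_ord ltnn.
  apply: contrapT => no; apply: ninj => i k gik; apply: val_inj => /=.
  have [lt|lt|//] := ltngtP (i : nat) k.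
    by case: no; exists i, k.
  by case: no; exists k, i.
have [e ye] := cP _ _ cik; have injit : injective (iter i f).
  by elim: i {ik cik ye} => [|i IHi] u v //= /injf/IHi.
have itsh j x : iter j f (shift_irr x e) = shift_irr (iter j f x) e.
  by elim: j => //= j ->; rewrite fsh.
have eki : iter (k - i).-1.+1 f y = shift_irr y e.
  apply: injit; rewrite itsh -ye -iterD; congr (iter _ f y); lia.
exists (shift_irr (iter (k - i).-1 f y) (- e)).
by rewrite fsh -iterS eki shift_irrK.
Qed.

End Shifts.

(** * Weights of dual modules *)

Section DualWeights.
Variables (K : fieldType) (D : triple K).
Local Notation A := (talg D).
Local Notation gA := (tgr D).
Local Notation gA' := (tgr (converse_triple D)).
Hypotheses (hA : graded_algebra gA) (hD : weak_triangular D).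
Implicit Types (M N P L : modA D) (l : modT D) (x y : IrrT D).

Fact to_converse_antimorphism : graded_antimorphism gA gA' (fun a : A^c => a :
  A).
Proof. by []. Qed.

Definition dual_converse M : modA (converse_triple D) :=
  dualmod to_converse_antimorphism M.

Lemma dual_converse_simple M : simple_gmod M -> simple_gmod (dual_converse M).
Proof. by apply: dual_simple => b; exists b. Qed.

(** Dualizing preserves the degrees of a module, and elements of T commute
    with the projection to the degree d. *)
Lemma dual_top_weight M l :
  top_weight M l -> top_weight (dual_converse M) (dualT l).
Proof.
move=> [d [j [topM kj imj jT ld]]].
have jK : cancel j (j^-1)%VF by apply: lker0_lfunK; rewrite kj.
pose r := (j^-1 \o gcomp M d)%VF : 'Hom(M, l).
have jd v : j v \in ggr M d by rewrite -imj memv_img ?memvf.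
have rj v : r (j v) = v by rewrite comp_lfunE gcomp_id // jK.
have jr v : j (r v) = gcomp M d v.
  by rewrite comp_lfunE limg_lfunVK // imj gcomp_in.
pose j' : 'Hom(dualT l, dual_converse M) := linfun (precompose r).
have j'E (g : 'Hom(l, K^o)) v : (j' g : 'Hom(M, K^o)) v = g (r v).
  by rewrite lfunE /= comp_lfunE.
exists d, j'; split.
- move=> i di; apply/eqP; rewrite -subv0; apply/subvP=> g /dual_grP gi;
  rewrite memv0.
  apply/eqP/lfunP=> v; rewrite zero_lfunE -(gcomp_sum v) linear_sum big1 // =>
    k _ /=.
  have vk := gcomp_in k v; have [ki|ki] := eqVneq k i; last exact: gi ki vk.
  by move: vk; rewrite ki topM // memv0 => /eqP->; rewrite linear0.
- apply/eqP; rewrite -subv0; apply/subvP=> g; rewrite memv_ker memv0 => /eqP g0.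
  by apply/eqP/lfunP=> v; rewrite -[v in LHS]rj -j'E g0 !zero_lfunE.
- apply/vspaceP=> g; apply/memv_imgP/dual_grP=> [[g' _ ->] k v kd vk|gd].
    by rewrite j'E comp_lfunE (gcomp_other vk kd) !linear0.
  exists ((g : 'Hom(M, K^o)) \o j)%VF; first exact: memvf.
  apply/lfunP=> v; rewrite j'E comp_lfunE jr.
  by rewrite dual_gr_gcomp //; apply/dual_grP.
- move=> t g; apply/lfunP=> v; rewrite j'E.
  apply: etrans (@dual_actE _ _ _ _ (@converse_sub K D) l t g (r v)) _.
  apply: esym; apply: etrans (@dual_actE _ _ _ _ (fun a : A^c =>
    a : A) M _ (j' g) v) _.
  rewrite j'E; congr (g _); apply: (can_inj jK).
  rewrite jT !jr val_converse_sub -[d in LHS]add0r gcomp_act //.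
  by apply: (mid_degree hD); exact: (subvsP t).
apply/vspaceP=> g; rewrite memvf; apply/dual_grP=> k v kd vk.
have -> : v = 0 by apply: ggr_disjoint vk _ kd; rewrite ld memvf.
by rewrite linear0.
Qed.

Lemma dual_IrrT_rep x : giso (dualT (irr_rep x)) (irr_rep (dual_IrrT x)).
Proof. exact: irr_class_rep. Qed.

End DualWeights.

Section StandardNonzero.
Variables (K : fieldType) (D : triple K).
Hypotheses (hA : graded_algebra (tgr D)) (hD : weak_triangular D).

Lemma Delta_neq0 (l : modT D) :
  simple_gmod l -> fullv != 0%VS :> {vspace Delta l}.
Proof.
move=> sl; have [d [j [[_ kj _ _ _] _]]] := Delta_top_generated hA hD sl.
apply: contraNneq (limg_neq0 (proj1 sl) kj) => e; rewrite -subv0 -e;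
  exact: subvf.
Qed.

End StandardNonzero.

(** * Socles of standard modules and heads of costandard modules *)

Section MainArgument.
Variables (K : fieldType) (D : triple K).
Local Notation A := (talg D).
Local Notation gA := (tgr D).
Local Notation T := (tmid D).
Hypotheses (hA : graded_algebra gA) (hD : weak_triangular D).
Hypotheses (hT : semisimple_algebra (subvs_of T)) (hinj : self_injective A).
Implicit Types (x y : IrrT D).

Let hA' := converse_graded hA.
Let hD' := converse_weak hD.

Lemma Pmod_injective x : injective_gmod (Pmod x).
Proof.
exact: cover_injective hinj (Lmod_simple hA hD x) (Pmod_cover hA hD x).
Qed.

Lemma Pmod_head x : simple_head (Pmod x) (Lmod x).
Proof. exact: cover_simple_head (Lmod_simple hA hD x) (Pmod_cover hA hD x). Qed.

Lemma Pmod_neq0 x : fullv != 0%VS :> {vspace Pmod x}.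
Proof. exact: cover_neq0 (Lmod_simple hA hD x) (Pmod_cover hA hD x). Qed.

Lemma hw_spec x : top_weight (Pmod x) (irr_rep (hw x)).
Proof.
have [y wy] := cover_top_weight hA hD hT (Lmod_simple hA hD x) (Pmod_cover hA
  hD x)
  (@Pmod_injective x).
by rewrite (hw_eq hA hD wy).
Qed.

Lemma nakayama_spec x : simple_soc (Pmod x) (Lmod (nakayama x)).
Proof.
have [S sS socS] := uniform_simple_soc (Pmod_neq0 x) (fun X Y sX sY XY =>
  injective_uniform (Lmod_simple hA hD x) (Pmod_head x) (@Pmod_injective x) sX
    sY XY).
have [y Sy] := simple_is_Lmod hA hD sS.
have socy := simple_soc_r socS (giso_sym Sy).
have : soc_iso (Pmod x) (Lmod (nakayama x)).
  apply: (@chooseP _ x (fun m => soc_iso (Pmod x) (Lmod m))); exists y.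
  exact: simple_soc_soc (Lmod_simple hA hD y) socy.
move/(simple_soc_giso (Lmod_simple hA hD y) socy)/giso_sym.
exact: simple_soc_r socy.
Qed.

Lemma nakayama_eq x y : simple_soc (Pmod x) (Lmod y) -> nakayama x = y.
Proof.
move=> socy; apply: (Lmod_inj hA hD); apply: giso_sym.
apply: simple_soc_giso (Lmod_simple hA hD y) socy _.
exact: simple_soc_soc (Lmod_simple hA hD _) (nakayama_spec x).
Qed.

(** P(x) is the injective hull of its socle, and its head determines x. *)
Lemma nakayama_inj : injective (@nakayama K D).
Proof.
move=> x y exy; have := nakayama_spec y; rewrite -exy => socy.
have := injective_hull_unique (Lmod_simple hA hD _) (@Pmod_injective x)
  (@Pmod_injective y) (nakayama_spec x) socy.
case/gisoW=> q hq [_ imq]; apply: (Lmod_inj hA hD).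
have := simple_head_quo (Lmod_simple hA hD x) (Pmod_head x) hq imq (Pmod_neq0
  y).
move/(simple_head_hd (Lmod_simple hA hD x))/hd_iso_giso; apply.
exact: simple_head_hd (Lmod_simple hA hD y) (Pmod_head y).
Qed.

Lemma Delta_soc x : simple_soc (Delta (irr_rep (hw x))) (Lmod (nakayama x)).
Proof.
have sl := irr_rep_simple (hw x).
have [i [hi ki]] := Delta_embeds hA hD sl (Lmod_simple hA hD x) (Pmod_cover hA
  hD x)
  (hw_spec x).
exact: simple_soc_sub (Lmod_simple hA hD _) (nakayama_spec x) hi ki (Delta_neq0
  hA hD sl).
Qed.

(** The socle of Delta (hw x) is that of P(x), which determines x. *)
Lemma hw_inj : injective (@hw K D).
Proof.
move=> x y exy; apply: nakayama_inj; apply: (Lmod_inj hA hD).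
have := Delta_soc y; rewrite -exy => socy.
apply: simple_soc_giso (Lmod_simple hA hD _) (Delta_soc x) _.
exact: simple_soc_soc (Lmod_simple hA hD _) socy.
Qed.

Lemma hw_shift x e : hw (shift_irr x e) = shift_irr (hw x) e.
Proof.
apply: (hw_eq hA hD); apply: top_weight_giso (Pmod_shift hA hD x e) _.
apply: top_weight_giso_r (shift_irr_rep (hw x) e) _.
exact: top_weight_shift (hw_spec x).
Qed.

Lemma nakayama_shift x e : nakayama (shift_irr x e) = shift_irr (nakayama x) e.
Proof.
apply: nakayama_eq; have [f hf [kf imf]] := gisoW (giso_sym (Pmod_shift hA hD x
  e)).
apply: simple_soc_r (giso_sym (Lmod_shift hA hD (nakayama x) e)).
apply: simple_soc_sub _ (simple_soc_shift e (nakayama_spec x)) hf kf (Pmod_neq0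
  _).
exact/simple_shift/Lmod_simple.
Qed.

(** P(x) is the injective hull of its socle. *)
Lemma dual_Pmod_cover x : projective_cover (dual_converse (Pmod x))
  (dual_converse (Lmod (nakayama x))).
Proof.
apply: (@dual_cover _ _ _ _ _ _ _ _ (converse_antimorphism D)) => //.
- exact: Lmod_simple.
- exact: Pmod_injective.
exact: nakayama_spec.
Qed.

Lemma dual_hw x : dual_IrrT (hw x) = hw (dual_IrrT (nakayama x)).
Proof.
apply: esym; apply: (hw_eq hA' hD').
have sL := dual_converse_simple (Lmod_simple hA hD (nakayama x)).
have isoL : giso (dual_converse (Lmod (nakayama x))) (Lmod (dual_IrrT (nakayama
  x))).
  apply: (Lmod_unique hA' hD' sL).
  apply: top_weight_giso_r (dual_IrrT_rep _) _.
  by apply: (dual_top_weight hD); exact: Lmod_weight.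
have isoP := cover_unique (dual_Pmod_cover x) (Pmod_cover hA' hD' _) isoL.
apply: top_weight_giso isoP _; apply: top_weight_giso_r (dual_IrrT_rep _) _.
by apply: (dual_top_weight hD); exact: hw_spec.
Qed.

(** The embedding of a standard module of the opposite algebra into the dual
    of P(x) dualizes to a surjection of P(x) onto the costandard module. *)
Lemma nabla_head x : simple_head (nabla (irr_rep (hw x))) (Lmod x).
Proof.
have sl := dual_simple (converse_sub_antimorphism D) (@converse_sub_surj K D)
  (irr_rep_simple (hw x)).
have sL := dual_converse_simple (Lmod_simple hA hD (nakayama x)).
have [i [hi ki]] := Delta_embeds hA' hD' sl sL (dual_Pmod_cover x)
  (dual_top_weight hD (hw_spec x)).
have psiK : cancel (fun a : A => a : A^c) (fun a : A^c => a : A) by [].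
have hb := bidual_map_ghom (to_converse_antimorphism D) (converse_antimorphism
  D) psiK (Pmod x).
have [_ imb] := bidual_map_bij (to_converse_antimorphism D)
  (converse_antimorphism D) (Pmod x).
have hd := dual_map_ghom (converse_antimorphism D) hi.
have imd := dual_map_surj (converse_antimorphism D) ki.
apply: (simple_head_quo (Lmod_simple hA hD x) (Pmod_head x) (ghom_comp hd hb)).
  by rewrite limg_comp imb.
by apply: dualmod_neq0; exact: (Delta_neq0 hA' hD' sl).
Qed.

End MainArgument.

(** * The permutations of the simple graded T-modules *)

Lemma bijective_inverse (X : Type) (f : X -> X) : injective f ->
  (forall y, exists x, f x = y) -> exists2 g : X -> X, cancel f g & cancel g f.
Proof.
move=> injf surjf; pose g y := sval (cid (surjf y)).
have fg y : f (g y) = y by rewrite /g; case: cid.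
by exists g => // x; apply: injf; rewrite fg.
Qed.

Theorem theorem5p8 (K : fieldType) (D : triple K)
    (hA : graded_algebra (tgr D)) (hD : triangular_decomposition D)
    (hT : semisimple_algebra (subvs_of (tmid D)))
    (hinj : self_injective (talg D)) :
  let nu : IrrT D -> IrrT D := @nakayama K D in
  let h : IrrT D -> IrrT D := @hw K D in
  (forall l : IrrT D, highest_weight_object (Pmod l)) /\
  (* (a) *)
  bijective h /\
  exists hV nuV : IrrT D -> IrrT D,
    [/\ cancel h hV, cancel hV h, cancel nu nuV & cancel nuV nu] /\
    let dag : IrrT D -> IrrT D := nu \o hV in
    [/\ (* (b) *)
        bijective dag /\
        (forall l : IrrT D, soc_iso (Delta (irr_rep l)) (Lmod (dag l))),
        (* (c) *)
        forall (l : IrrT D) (n : nat) (F : nat -> {vspace Pmod l}),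
          standard_filtration n F ->
          subquo_iso (F 1%N) 0%VS (Delta (irr_rep (h l))),
        (* (d) *)
        forall l : IrrT D,
          dual_IrrT (h l) = hw (dual_IrrT (nu l)),
        (* (e) *)
        forall (l : IrrT D) (n : nat) (F : nat -> {vspace Pmod l}),
          costandard_filtration n F ->
          subquo_iso fullv (F n.-1) (nabla (irr_rep (h l)))
      & (* (f) *)
        forall l : IrrT D,
          [/\ hd_iso (nabla (irr_rep l)) (Lmod (nuV (dag l))),
              hd_iso (nabla (irr_rep l)) (Lmod (hV l))
            & giso (Lmod (nuV (dag l))) (Lmod (hV l))]].
Proof.
move=> nu h; have hw := triangular_weak hD.
have [hV hK hVK] := bijective_inverse (hw_inj hA hw hT hinj)
  (equivariant_surjective hw hT (hw_inj hA hw hT hinj) (hw_shift hA hw hT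
    hinj)).
have [nuV nuK nuVK] := bijective_inverse (nakayama_inj hA hw hinj)
  (equivariant_surjective hw hT (nakayama_inj hA hw hinj) (nakayama_shift hA hw
    hinj)).
split.
  by move=> l; exists (h l); apply: (top_weight_highest hA hw); exact: hw_spec.
split; first by exists hV.
exists hV, nuV; split; first by split.
have socP l : simple_soc (Delta (irr_rep l)) (Lmod (nu (hV l))).
  by rewrite -{1}(hVK l); exact: Delta_soc.
have hdN l : simple_head (nabla (irr_rep l)) (Lmod (hV l)).
  by rewrite -{1}(hVK l); exact: nabla_head.
have hdN' l : hd_iso (nabla (irr_rep l)) (Lmod (hV l)).
  exact: simple_head_hd (Lmod_simple hA hw _) (hdN l).
move=> dag; split.
- split=> [|l]; last exact: simple_soc_soc (Lmod_simple hA hw _) (socP l).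
  exists (h \o nuV) => l; first by rewrite /dag /= nuK; exact: hVK.
  by rewrite /dag /= hK; exact: nuVK.
- move=> l [|n] F [F0 Fn Fstep].
    by have := Pmod_neq0 hA hw l; rewrite -Fn F0 eqxx.
  have [sF1 _ [_ [k ->] isoN]] := Fstep 0%N isT; rewrite F0 in isoN.
  have [j [hj kj _]] := subquo_inj sF1 isoN.
  have socN := simple_soc_sub (Lmod_simple hA hw _) (nakayama_spec hA hw hinj
    l) hj kj
    (Delta_neq0 hA hw (irr_rep_simple k)).
  suff -> : h l = k by [].
  rewrite -(hVK k); congr h; apply: (nakayama_inj hA hw hinj);
    apply: (Lmod_inj hA hw).
  apply: simple_soc_giso (Lmod_simple hA hw _) socN _.
  exact: simple_soc_soc (Lmod_simple hA hw _) (socP k).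
- by move=> l; exact: dual_hw.
- move=> l [|n] F [F0 Fn Fstep].
    by have := Pmod_neq0 hA hw l; rewrite -Fn F0 eqxx.
  have [_ _ [_ [k ->] isoN]] := Fstep n (ltnSn n); rewrite Fn in isoN.
  suff -> : h l = k by [].
  have [q [hq _ imq]] := subquo_surj isoN.
  have N0 : fullv != 0%VS :> {vspace nabla (irr_rep k)}.
    have [p [_ imp _]] := hdN k; have [L0 _] := Lmod_simple hA hw (hV k).
    by apply: contra L0 => /eqP e; rewrite -imp e limg0.
  rewrite -(hVK k); congr h; apply: (Lmod_inj hA hw);
    apply: hd_iso_giso (hdN' k).
  apply: simple_head_hd (Lmod_simple hA hw l) _.
  exact: simple_head_quo (Lmod_simple hA hw l) (Pmod_head hA hw l) hq imq N0.
move=> l; rewrite /dag /= nuK; split=> //; exact: giso_refl.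
Qed.
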